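(* For every integer $d\ge 2$, the quotient $v_d^{(1)}/v_d^{(0)}$ is an integer, and $$\frac{v_d^{(1)}}{v_d^{(0)}}=\frac{P_d(3)-2d-1}{4},$$ where $P_d(x)$ is the $d$-th Legendre polynomial, $$P_d(x)=2^{-d}\sum_{k=0}^{\lfloor d/2\rfloor}(-1)^k\binom{d-k}{k}\binom{2d-2k}{d-k}x^{d-2k}=\sum_{k=0}^{d}\binom{d+k}{2k}\binom{2k}{k}\left(\frac{x-1}{2}\right)^k.$$
   Context: For an integer $d\ge 1$, let $\mathcal{E}_d\subset\mathbb{R}^d$ be the set of coefficient vectors $(a_1,\dots,a_d)$ of real polynomials $x^d+a_1x^{d-1}+\dots+a_d$ all of whose (complex) roots have absolute value less than $1$. For $s\ge 0$, let $\mathcal{E}_d^{(s)}\subseteq\mathcal{E}_d$ be the subset of those coefficient vectors whose polynomial has exactly $s$ pairs of complex conjugate non-real roots. Let $v_d^{(s)}=\lambda_d(\mathcal{E}_d^{(s)})$ denote the $d$-dimensional Lebesgue measure of $\mathcal{E}_d^{(s)}$. *)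

(* Defs.v *)
From HB Require Import structures.
From mathcomp Require Import all_boot all_order all_algebra.
From mathcomp Require Import all_classical all_reals all_analysis.
From mathcomp Require Import complex.

Set Implicit Arguments.
Unset Strict Implicit.
Unset Printing Implicit Defensive.

Import Order.TTheory GRing.Theory Num.Theory.

Local Open Scope classical_set_scope.
Local Open Scope ring_scope.

Definition tcons (T : Type) (n : nat) (p : T * n.-tuple T) : n.+1.-tuple T :=
  [tuple of p.1 :: p.2].

Definition lebesgue_cons (R : realType) (n : nat)
    (m : set (n.-tuple (measurableTypeR R)) -> \bar R) :
    set (n.+1.-tuple (measurableTypeR R)) -> \bar R :=
  pushforward (@lebesgue_measure R \x m)%E (@tcons (measurableTypeR R) n).

(* Lebesgue measure on R^n = n.-tuple R, as the n-fold product of the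
   one-dimensional one; R^0 is a point, of measure 1. *)
Fixpoint lebesgue_tuple (R : realType) (n : nat) :
    set (n.-tuple (measurableTypeR R)) -> \bar R :=
  match n with
  | 0 => dirac [tuple]
  | m.+1 => lebesgue_cons (@lebesgue_tuple R m)
  end.

Section lebesgue_cons_measure.
Context {R : realType} (n : nat).
Local Open Scope ereal_scope.
Local Notation mR := (measurableTypeR R).
Variable m : {sigma_finite_measure set (n.-tuple mR) -> \bar R}.

Let uncons (t : n.+1.-tuple mR) : mR * n.-tuple mR :=
  (thead t, [tuple of behead t]).

Let tconsK : cancel (@tcons mR n) uncons.
Proof. by case=> x t; rewrite /uncons theadE; congr pair; apply/val_inj. Qed.

Let measurable_tcons : measurable_fun setT (@tcons mR n).
Proof. exact: measurable_cons. Qed.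

Let measurable_uncons : measurable_fun setT uncons.
Proof.
apply/measurable_fun_pairP; split; last exact: measurable_behead.
exact: measurable_tnth.
Qed.

Let lebesgue_cons0 : lebesgue_cons m set0 = 0.
Proof. by rewrite /lebesgue_cons /pushforward preimage_set0 measure0. Qed.

Let lebesgue_cons_ge0 A : 0 <= lebesgue_cons m A.
Proof. exact: measure_ge0. Qed.

Let lebesgue_cons_sigma_additive : semi_sigma_additive (lebesgue_cons m).
Proof.
move=> F mF tF mUF; rewrite /lebesgue_cons /pushforward preimage_bigcup.
apply: measure_semi_sigma_additive.
- by move=> k; rewrite -[X in measurable X]setTI; exact: measurable_tcons.
- apply/trivIsetP => /= i j _ _ ij; rewrite -preimage_setI.
  by move/trivIsetP : tF => /(_ _ _ _ _ ij) ->//; rewrite preimage_set0.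
- by rewrite -preimage_bigcup -[X in measurable X]setTI; exact: measurable_tcons.
Qed.

HB.instance Definition _ := isMeasure.Build _ _ _ (lebesgue_cons m)
  lebesgue_cons0 lebesgue_cons_ge0 lebesgue_cons_sigma_additive.

Let lebesgue_cons_sigma_finite : sigma_finite setT (lebesgue_cons m).
Proof.
have /sigma_finiteP[F [TF ndF Foo]] := sigma_finiteT (@lebesgue_measure R).
have /sigma_finiteP[G [TG ndG Goo]] := sigma_finiteT m.
have GF k : @tcons mR n @^-1` (uncons @^-1` (F k `*` G k)) = F k `*` G k.
  by apply/seteqP; split => p; rewrite /preimage /mkset tconsK.
exists (fun k => uncons @^-1` (F k `*` G k)).
  apply/seteqP; split => // t _.
  have : (\bigcup_k F k) (thead t) by rewrite -TF.
  have : (\bigcup_k G k) [tuple of behead t] by rewrite -TG.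
  move=> [j _ Gj] [i _ Fi]; exists (maxn i j) => //; split => /=.
  - by move: Fi; exact/subsetPset/ndF/leq_maxl.
  - by move: Gj; exact/subsetPset/ndG/leq_maxr.
move=> k; have [mF Fk] := Foo k; have [mG Gk] := Goo k; split.
  rewrite -[X in measurable X]setTI; apply: measurable_uncons => //.
  exact: measurableX.
rewrite /lebesgue_cons /pushforward GF product_measure1E//.
by rewrite lte_mul_pinfty// ge0_fin_numE.
Qed.

HB.instance Definition _ := Measure_isSigmaFinite.Build _ _ _ (lebesgue_cons m)
  lebesgue_cons_sigma_finite.

End lebesgue_cons_measure.

Section lebesgue_tuple_measure.
Context {R : realType} (n : nat).
Local Open Scope ereal_scope.
Local Notation mR := (measurableTypeR R).

Lemma lebesgue_tuple_packed :
  exists m : {sigma_finite_measure set (n.-tuple mR) -> \bar R},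
    @lebesgue_tuple R n = m.
Proof.
elim: n => [|k [m mE]]; first by exists (dirac ([tuple] : 0.-tuple mR)).
by exists (lebesgue_cons m); rewrite /= mE.
Qed.

Let lebesgue_tuple0 : @lebesgue_tuple R n set0 = 0.
Proof. by have [m ->] := lebesgue_tuple_packed. Qed.

Let lebesgue_tuple_ge0 A : 0 <= @lebesgue_tuple R n A.
Proof. by have [m ->] := lebesgue_tuple_packed. Qed.

Let lebesgue_tuple_sigma_additive : semi_sigma_additive (@lebesgue_tuple R n).
Proof.
have [m ->] := lebesgue_tuple_packed; exact: measure_semi_sigma_additive.
Qed.

HB.instance Definition _ := isMeasure.Build _ _ _ (@lebesgue_tuple R n)
  lebesgue_tuple0 lebesgue_tuple_ge0 lebesgue_tuple_sigma_additive.

Let lebesgue_tuple_sigma_finite : sigma_finite setT (@lebesgue_tuple R n).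
Proof. have [m ->] := lebesgue_tuple_packed; exact: sigma_finiteT. Qed.

HB.instance Definition _ := Measure_isSigmaFinite.Build _ _ _
  (@lebesgue_tuple R n) lebesgue_tuple_sigma_finite.

End lebesgue_tuple_measure.

Lemma lebesgue_tuple_box (R : realType) (n : nat)
    (A : 'I_n -> set (measurableTypeR R)) :
  (forall i, measurable (A i)) ->
  lebesgue_tuple [set t | forall i, A i (tnth t i)] =
    (\prod_(i < n) lebesgue_measure (A i))%E.
Proof.
elim: n A => [|n IH] A mA.
  rewrite big_ord0 /= diracE (_ : _ \in _ = true)//.
  by apply/mem_set => -[].
pose B : 'I_n -> set (measurableTypeR R) := fun i => A (lift ord0 i).
pose SB := [set t : n.-tuple (measurableTypeR R) | forall i, B i (tnth t i)].
have mB : measurable SB.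
  rewrite (_ : SB = \bigcap_(i in [set: 'I_n]) ((@tnth _ _ ^~ i) @^-1` B i)).
    apply: fin_bigcap_measurable => // i _; rewrite -[X in measurable X]setTI.
    by apply: measurable_tnth => //; exact: mA.
  by apply/seteqP; split => t /= h => [i _|i]; exact: h.
rewrite big_ord_recl -(IH B); last by move=> i; exact: mA.
rewrite /= /lebesgue_cons /pushforward.
rewrite -product_measure1E//; congr product_measure1.
apply/seteqP; split => -[x t] /=.
  move=> h; split; first exact: (h ord0).
  by move=> i; have := h (lift ord0 i); rewrite tnthS.
move=> [Ax Bt] i; case: (unliftP ord0 i) => [j ->|->//].
by rewrite tnthS; exact: Bt.
Qed.

(* With indices starting at 0: X^d + a_0 X^(d-1) + ... + a_(d-1). *)
Definition monic_of (R : realType) (d : nat) (a : d.-tuple R) : {poly R} :=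
  'X^d + \sum_(i < d) tnth a i *: 'X^(d - i.+1).

Definition complexify (R : realType) (p : {poly R}) : {poly R[i]} :=
  map_poly (real_complex R) p.

(* The order on R[i] compares real numbers, and the norm on R[i] has real
   values in R[i], so that `|z| < 1 is the usual inequality. *)
Definition E_ (R : realType) (d : nat) : set (d.-tuple R) :=
  [set a | forall z : R[i], root (complexify (monic_of a)) z -> `|z| < 1].

(* p is a monic polynomial whose roots, listed with multiplicity, are the reals
   xs together with exactly s conjugate pairs {z, z^*} of non-real numbers. *)
Definition conj_pairs (R : realType) (p : {poly R}) (s : nat) : Prop :=
  exists (xs : seq R) (zs : seq R[i]),
    [/\ size zs = s, {in zs, forall z, z \isn't Num.real} &
      complexify p = \prod_(x <- xs) ('X - (real_complex R x)%:P) *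
                     \prod_(z <- zs) (('X - z%:P) * ('X - (conjc z)%:P))].

Definition E_s (R : realType) (d s : nat) : set (d.-tuple R) :=
  [set a | @E_ R d a /\ conj_pairs (monic_of a) s].

Definition v_ (R : realType) (d s : nat) : R :=
  fine (@lebesgue_tuple R d (@E_s R d s)).

Definition legendre (R : realType) (d : nat) : {poly R} :=
  2 ^- d *: \sum_(0 <= k < d./2.+1)
    ((-1) ^+ k * 'C(d - k, k)%:R * 'C(2 * d - 2 * k, d - k)%:R) *:
      'X^(d - 2 * k).

(* Main.v *)
(** In root coordinates, reached by splitting off one real root at a time with the
    one-variable area formula, the volume for no conjugate pair is [V_d / d!], where [V_d] is
    the integral of the absolute Vandermonde product [Delta] over the cube [(-1, 1)^d]. For one
    conjugate pair it is [1 / (d-2)!] times the integral over [b^2 < 4 c < 4] of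
    [F(b, c) = int Delta(x) prod_i (x_i^2 + b x_i + c) dx] over [(-1, 1)^(d-2)].

    Let [<f, g>] be the double integral of [sgn(y - x) f(x) g(y)] over [(-1, 1)^2]. The
    antisymmetric polynomial [A(z, w) = (z - w) F(-(z + w), z w)] satisfies
    [<A(., w), g> = - V_d g(w) / (d (d-1))] for every polynomial [g] of degree less than [d] and
    integral [0]: symmetrise over the roots and use Lagrange interpolation. The kernel
    [B(z, w) = sum_k (2k+1)/4 (P_k(z) P_k'(w) - P_k'(z) P_k(w))], over the [k < d] with [k = d-1]
    modulo 2, satisfies [<B(., w), g> = - g(w)], and antisymmetry makes such a kernel unique, so
    that [A = V_d / (d (d-1)) B]. A product formula [P_k(z) P_k(w) = N_k(-(z + w), z w)] gives
    [F = V_d / (d (d-1)) sum_k (2k+1)/4 dN_k/dc], whose integral over [b^2 < 4 c < 4] is explicit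
    and telescopes to [(P_d(3) - 2d - 1) / 4]. *)
Require Import Defs.
From HB Require Import structures.
From mathcomp Require Import all_boot all_order all_algebra.
From mathcomp Require Import all_classical all_reals all_analysis.
From mathcomp Require Import measurable_realfun polyrcf complex ring lra zify.

Set Implicit Arguments.
Unset Strict Implicit.
Unset Printing Implicit Defensive.

Import Order.TTheory GRing.Theory Num.Theory.
Import numFieldNormedType.Exports.

Local Open Scope classical_set_scope.
Local Open Scope ring_scope.

(** * Legendre polynomials *)

Section legendre_theory.
Variable R : realFieldType.
Implicit Types p q : {poly R}.

(** V_d is never evaluated: since d (d-1) (d-2)! = d!, it cancels in the quotient, and only its
    positivity matters. The sign of prod_i (y - x_i), as a function of y, jumps at x_j by twice the
    sign of prod_(i != j) (x_j - x_i). Up to a constant it is therefore the sum over j of sgn(y -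
    x_j) times these signs, which lets the pairing absorb x, and then y, as new variables of Delta.
    That constant is why g must have integral 0. Testing against such g leaves a multiple of P_d'
    undetermined in the kernel, and antisymmetry removes it. Legendre polynomials invert the pairing
    because <p', g> = 2 int p g when int g = 0, and (2k+1) P_k is the derivative of P_(k+1) -
    P_(k-1). The kernel identity is about real z and w, hence 4 c <= b^2; it reaches the region of
    complex pairs because F is a polynomial in c. The argument 3 comes from the integral of N_k(b,
    1) over |b| < 2, which equals that of P_k over [-1, 3]. Integrality holds because P_d(3) = sum_j
    C(d, j)^2 2^(d-j) is 2d + 1 modulo 4. *)

Lemma bin_trinomial n k :
  ('C(n + k, 2 * k) * 'C(2 * k, k) = 'C(n, k) * 'C(n + k, k))%N.
Proof.
have [kn|nk] := leqP k n; last first.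
  by rewrite (@bin_small (n + k)) ?(@bin_small n)//; lia.
have h1 : ('C(n + k, 2 * k) * ((2 * k)`! * (n - k)`!) = (n + k)`!)%N.
  by rewrite -(@bin_fact (n + k) (2 * k)); [congr (_ * (_ * _`!))%N; lia|lia].
have h2 : ('C(2 * k, k) * (k`! * k`!) = (2 * k)`!)%N.
  by rewrite -(@bin_fact (2 * k) k); [congr (_ * (_ * _`!))%N; lia|lia].
have h3 : ('C(n, k) * (k`! * (n - k)`!) = n`!)%N by rewrite bin_fact.
have h4 : ('C(n + k, k) * (k`! * n`!) = (n + k)`!)%N.
  by rewrite -(@bin_fact (n + k) k); [congr (_ * (_ * _`!))%N; lia|lia].
apply/eqP; rewrite -(eqn_pmul2r (fact_gt0 k)) -(eqn_pmul2r (fact_gt0 k)).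
rewrite -(eqn_pmul2r (fact_gt0 (n - k))); apply/eqP.
by nia.
Qed.

Definition legcoef n k : R := ('C(n, k) * 'C(n + k, k))%:R.

(** Legendre's equation read on the coefficients in powers of (x - 1)/2. *)
Lemma legcoefSr n k :
  k.+1%:R ^+ 2 * legcoef n k.+1 =
  (n%:R * (n%:R + 1) - k%:R * (k%:R + 1)) * legcoef n k.
Proof.
rewrite /legcoef; have [kn|nk] := leqP k n; last first.
  by rewrite (@bin_small n k) ?(@bin_small n k.+1) ?mul0n ?mulr0// ltnW.
have h1 := mul_bin_left n k.
have h2 := mul_bin_diag (n + k).+1 k.
rewrite /= -addnS in h2.
have -> : (n%:R * (n%:R + 1) - k%:R * (k%:R + 1) : R) = ((n - k) * (n + k).+1)%:R.
  by rewrite natrM -[(n + k).+1%:R]natr1 natrD natrB//; ring.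
rewrite -natrX -!natrM; congr _%:R.
transitivity ((k.+1 * 'C(n, k.+1)) * (k.+1 * 'C(n + k.+1, k.+1)))%N; first by lia.
by rewrite h1 -h2 addnS; lia.
Qed.

Lemma legcoefSl n k :
  (n.+1%:R - k%:R) * legcoef n.+1 k = (n.+1%:R + k%:R) * legcoef n k.
Proof.
rewrite /legcoef; have [kn|nk] := leqP k n; last first.
  have [->|kn1] := eqVneq k n.+1; first by rewrite subrr mul0r bin_small ?mul0n ?mulr0.
  by rewrite (@bin_small n k) ?(@bin_small n.+1 k) ?mul0n ?mulr0//; lia.
have h1 := mul_bin_down n.+1 k.
have h2 := mul_bin_down (n.+1 + k) k.
rewrite /= addnK in h2; rewrite /= in h1.
rewrite -natrB 1?ltnW// -natrD -!natrM; congr _%:R.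
by rewrite mulnA -h1 mulnCA h2; lia.
Qed.

Lemma legcoef_small n k : (n < k)%N -> legcoef n k = 0.
Proof. by move=> nk; rewrite /legcoef bin_small. Qed.

Definition leg_u : {poly R} := 2^-1 *: ('X - 1).

Definition leg n : {poly R} := \sum_(k < n.+1) legcoef n k *: leg_u ^+ k.

Lemma legE n m : (n < m)%N -> leg n = \sum_(k < m) legcoef n k *: leg_u ^+ k.
Proof.
move=> nm; rewrite -(big_mkord xpredT (fun k => legcoef n k *: leg_u ^+ k)).
rewrite (@big_cat_nat _ _ _ n.+1)//= big_mkord [X in _ + X]big_nat.
rewrite [X in _ + X]big1 ?addr0// => i /andP[ni _].
by rewrite legcoef_small// scale0r.
Qed.

Lemma deriv_leg_u : leg_u^`() = (2^-1)%:P.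
Proof. by rewrite /leg_u derivZ derivB derivX derivC subr0 alg_polyC. Qed.

Lemma deriv_leg_uX k : (leg_u ^+ k.+1)^`() = (k.+1%:R / 2) *: leg_u ^+ k.
Proof.
rewrite deriv_exp deriv_leg_u /= -mulr_natl -!mul_polyC polyCM polyC_natr.
by ring.
Qed.

(** Legendre's differential operator. It sends X^m to - m (m + 1) X^m plus lower terms, so the
    eigenvectors for - n (n + 1) form a line; closed forms are identified with [leg n] in this
    way. *)
Definition legL p : {poly R} := ((1 - 'X^2) * p^`())^`().

Fact legL_is_linear : linear legL.
Proof.
by move=> a p q; rewrite /legL derivD derivZ mulrDr -scalerAr derivD derivZ.
Qed.
HB.instance Definition _ :=
  GRing.isLinear.Build R {poly R} {poly R} _ legL legL_is_linear.

Lemma leg_u_quad : 1 - 'X^2 = - (4 *: (leg_u * (leg_u + 1))) :> {poly R}.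
Proof.
have e : 'X = 1 + 2 *: leg_u :> {poly R}.
  by rewrite /leg_u scalerA divff ?pnatr_eq0// scale1r addrC subrK.
by rewrite {1}e -!mul_polyC !polyC_natr; ring.
Qed.

Lemma legL_leg_uX k :
  legL (leg_u ^+ k.+1) =
  - ((k.+1%:R ^+ 2) *: leg_u ^+ k + (k.+1%:R * k.+2%:R) *: leg_u ^+ k.+1).
Proof.
rewrite /legL deriv_leg_uX leg_u_quad.
have -> : - (4 *: (leg_u * (leg_u + 1))) * ((k.+1%:R / 2) *: leg_u ^+ k) =
   - ((k.+1%:R * 2) *: (leg_u ^+ k.+1 + leg_u ^+ k.+2)).
  rewrite -scalerAr mulNr -scalerAl scalerN scalerA; congr (- (_ *: _)).
    by field.
  by rewrite !exprSr; ring.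
rewrite derivN derivZ derivD !deriv_leg_uX !scalerDr !scalerA.
by congr (- (_ *: _ + _ *: _)); field.
Qed.

Lemma legL_leg n : legL (leg n) = - (n%:R * (n%:R + 1)) *: leg n.
Proof.
(* The operator spills the k-th term into the power k - 1; by [legcoefSr] these spills telescope,
   with both end terms [c 0] and [c n.+1] equal to 0. *)
pose c k := (k%:R ^+ 2 * legcoef n k) *: leg_u ^+ k.-1.
have step k : legL (legcoef n k *: leg_u ^+ k) =
    - (n%:R * (n%:R + 1)) *: (legcoef n k *: leg_u ^+ k) + (c k.+1 - c k).
  rewrite [LHS]linearZ /= {}/c legcoefSr /=; case: k => [|k].
    rewrite /legL expr0 (derivC 1) mulr0 (derivC 0) scaler0.
    rewrite scalerA -scalerBl -scalerDl; apply/esym/eqP; rewrite scaler_eq0.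
    by apply/orP; left; apply/eqP; ring.
  rewrite legL_leg_uX scalerN scalerDr !scalerA opprD addrA -scalerDl addrC.
  have -> : k.+2%:R = k.+1%:R + 1 :> R by rewrite natr1.
  move: (k.+1%:R : R) (legcoef n k.+1) (n%:R : R) => x y z; rewrite -!mul_polyC /=.
  by congr (_ + _); rewrite -?[- (_ * _)]mulNr -?polyCN; congr (_%:P * _); ring.
rewrite /leg linear_sum /=.
rewrite -(big_mkord xpredT (fun k => legL (legcoef n k *: leg_u ^+ k))).
under eq_bigr do rewrite step.
rewrite big_split/= telescope_sumr// /c legcoef_small// mulr0 scale0r.
by rewrite expr0n/= mul0r scale0r subr0 addr0 big_mkord scaler_sumr.
Qed.

Lemma leg_horner1 n : (leg n).[1] = 1.
Proof.
rewrite /leg horner_sum big_ord_recl /= big1 ?addr0.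
  by rewrite hornerZ expr0 hornerC mulr1 /legcoef !bin0.
move=> i _; rewrite hornerZ horner_exp /leg_u !hornerE/=.
by rewrite subrr mulr0 expr0n mulr0.
Qed.

Lemma legL_coef p i : (legL p)`_i =
  i.+2%:R * i.+1%:R * p`_i.+2 - i%:R * i.+1%:R * p`_i.
Proof.
rewrite /legL coef_deriv mulrBl mul1r coefB coef_deriv coefXnM coef_deriv.
case: i => [|i] /=; first by rewrite subr0 mul0r mul0r subr0 mulr1 mulr1n mulr_natl.
rewrite (_ : (i.+2 - 2) = i)%N; last by rewrite -addn2 addnK.
by rewrite mulrnBl -!mulrnA -!natrM !mulr_natl.
Qed.

(** On leading coefficients the equation forces m (m + 1) = n (n + 1), hence m = n, for the degree m
    of a nonzero eigenvector. *)
Lemma legL_eigen0 n p :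
  legL p = - (n%:R * (n%:R + 1)) *: p -> p`_n = 0 -> p = 0.
Proof.
move=> eigp pn0; apply/eqP/negPn/negP => p0.
have pm : p`_(size p).-1 != 0 by rewrite -lead_coefE lead_coef_eq0.
have := congr1 (fun r : {poly R} => r`_(size p).-1) eigp.
rewrite legL_coef coefZ [p`_(_.+2)]nth_default; last by rewrite (leq_trans (leqSpred _))// leqW.
set m := (size p).-1 in pm *.
have nm : m <> n by move=> nm; rewrite nm pn0 eqxx in pm.
move=> e; have : (m * m.+1)%:R = (n * n.+1)%:R :> R.
  apply: (mulIf pm); rewrite !natrM -!natr1; rewrite -natr1 in e.
  by move: e; rewrite -[m.+1%:R]natr1 mulr0 sub0r mulNr => /oppr_inj.
by move/eqP; rewrite eqr_nat => /eqP; nia.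
Qed.

Lemma size_leg_u : size leg_u = 2%N.
Proof. by rewrite /leg_u size_scale ?size_XsubC// invr_eq0 pnatr_eq0. Qed.

Lemma size_leg_uX k : size (leg_u ^+ k) = k.+1.
Proof. have := size_exp leg_u k; rewrite size_leg_u mul1n => {2}<-.
by rewrite prednK// lt0n size_poly_eq0 expf_neq0// -size_poly_eq0 size_leg_u. Qed.

Lemma size_leg_le n : (size (leg n) <= n.+1)%N.
Proof.
apply: (leq_trans (size_sum _ _ _)); apply/bigmax_leqP => i _.
by apply: leq_trans (size_scale_leq _ _) _; rewrite size_leg_uX.
Qed.

Lemma leg_coefn n : (leg n)`_n = 'C(2 * n, n)%:R / 2 ^+ n.
Proof.
rewrite /leg big_ord_recr /= coefD nth_default ?add0r; last first.
  apply: (leq_trans (size_sum _ _ _)); apply/bigmax_leqP => i _.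
  by apply: leq_trans (size_scale_leq _ _) _; rewrite size_leg_uX.
have e : (leg_u ^+ n)`_n = 2^-1 ^+ n.
  have := lead_coef_exp leg_u n; rewrite lead_coefE size_leg_uX /= => ->.
  by rewrite /leg_u lead_coefZ lead_coefXsubC mulr1.
by rewrite coefZ e /legcoef binn mul1n addnn mul2n exprVn.
Qed.

Lemma leg_coefn_neq0 n : (leg n)`_n != 0.
Proof.
rewrite leg_coefn mulf_neq0 ?invr_eq0 ?expf_neq0 ?pnatr_eq0//.
by rewrite -lt0n bin_gt0; lia.
Qed.

Lemma legL_eigen n p : legL p = - (n%:R * (n%:R + 1)) *: p ->
  p = (p`_n / (leg n)`_n) *: leg n.
Proof.
move=> eigp; apply/eqP; rewrite -subr_eq0; apply/eqP; apply: (@legL_eigen0 n).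
  rewrite linearB [X in _ - X]linearZ /= eigp legL_leg [in RHS]scalerBr; congr (_ - _).
  by rewrite !scalerA mulrC.
by rewrite coefB coefZ divfK ?subrr// leg_coefn_neq0.
Qed.

Lemma size_leg n : size (leg n) = n.+1.
Proof.
apply/eqP; rewrite eqn_leq size_leg_le/= ltnNge; apply/negP => h.
by have := leg_coefn_neq0 n; rewrite nth_default ?eqxx.
Qed.

Lemma leg0 : leg 0 = 1.
Proof. by rewrite /leg big_ord1 /legcoef !bin0 scale1r expr0. Qed.

Lemma leg1 : leg 1 = 'X.
Proof.
rewrite /leg big_ord_recl big_ord1 /legcoef !bin0 muln1 scale1r expr0 /=.
by rewrite expr1 /leg_u /bump/= !binn bin1 scalerA divff ?pnatr_eq0// scale1r addrC subrK.
Qed.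

(** [legcoef n.+2 i.+1] and [legcoef n i.+1] are both multiples of [legcoef n.+1 i], and
    (n+3+i)(n+2+i) - (n-i)(n+1-i) = 2 (i+1) (2n+3). *)
Lemma deriv_leg n : (leg n.+2)^`() - (leg n)^`() = (2 * n.+1 + 1)%:R *: leg n.+1.
Proof.
rewrite [in RHS]/leg [leg n.+2]/leg (@legE n n.+3); last by rewrite !ltnS leqW.
rewrite -derivB -sumrB raddf_sum big_ord_recl /= expr0 -scalerBl derivZ.
rewrite (derivC 1) scaler0 add0r scaler_sumr; apply: eq_bigr => i _.
rewrite -scalerBl derivZ deriv_leg_uX !scalerA; congr (_ *: _).
have i1 : i.+1%:R != 0 :> R by rewrite pnatr_eq0.
apply: (mulfI i1); apply: (mulfI i1).
have h1 := legcoefSr n.+2 i; have h2 := legcoefSr n i.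
have h3 := legcoefSl n i; have h4 := legcoefSl n.+1 i.
rewrite /bump /= add1n.
have e1 : i.+1%:R ^+ 2 * legcoef n.+2 i.+1 =
    (n%:R + 3 + i%:R) * ((n%:R + 2 + i%:R) * legcoef n.+1 i).
  rewrite h1; move: h4; rewrite -!natr1 => h4.
  transitivity ((n%:R + 3 + i%:R) * ((n%:R + 1 + 1 - i%:R) * legcoef n.+2 i)); first by ring.
  by rewrite h4; ring.
have e2 : i.+1%:R ^+ 2 * legcoef n i.+1 =
    (n%:R - i%:R) * ((n%:R + 1 - i%:R) * legcoef n.+1 i).
  rewrite h2; move: h3; rewrite -!natr1 => h3.
  transitivity ((n%:R - i%:R) * ((n%:R + 1 + i%:R) * legcoef n i)); first by ring.
  by rewrite h3.
transitivity (i.+1%:R / 2 * (i.+1%:R ^+ 2 * legcoef n.+2 i.+1 -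
   i.+1%:R ^+ 2 * legcoef n i.+1)); first by ring.
by rewrite e1 e2 natrD natrM -!natr1; field.
Qed.

(** At index 0 the coefficient is a division by 0, hence 0: the antiderivative has no constant term,
    without a case distinction. *)
Definition prim p : {poly R} := \poly_(i < (size p).+1) (p`_i.-1 / i%:R).

Lemma coef_prim p i : (prim p)`_i = p`_i.-1 / i%:R.
Proof.
rewrite coef_poly; case: ltnP => // h; rewrite nth_default ?mul0r//.
by case: i h.
Qed.

Lemma deriv_prim p : (prim p)^`() = p.
Proof.
apply/polyP => i; rewrite coef_deriv coef_prim /= -[LHS]mulr_natr divfK//.
Qed.

Fact prim_is_linear : linear prim.
Proof.
by move=> a p q; apply/polyP => i; rewrite coefD coefZ !coef_prim coefD coefZ mulrDl mulrA.
Qed.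
HB.instance Definition _ :=
  GRing.isLinear.Build R {poly R} {poly R} _ prim prim_is_linear.

Lemma prim_deriv p : prim p^`() = p - (p`_0)%:P.
Proof.
apply/polyP => -[|i]; rewrite coef_prim coefB coefC /=.
  by rewrite invr0 mulr0 subrr.
by rewrite coef_deriv -[_ *+ _]mulr_natr mulfK ?subr0// pnatr_eq0.
Qed.

Lemma size_prim p : (size (prim p) <= (size p).+1)%N.
Proof. exact: size_poly. Qed.

Definition intg (a b : R) p : R := (prim p).[b] - (prim p).[a].

Fact intg_is_linear a b : linear_for *%R (intg a b).
Proof.
by move=> c p q; rewrite /intg linearP !hornerD !hornerZ; ring.
Qed.
HB.instance Definition _ a b :=
  GRing.isLinear.Build R {poly R} R _ (intg a b) (@intg_is_linear a b).

Lemma intg_deriv a b p : intg a b p^`() = p.[b] - p.[a].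
Proof. by rewrite /intg prim_deriv !hornerE; ring. Qed.

(** The two integrands differ by the derivative of (1 - X^2)(p' q - p q'), which vanishes at both
    endpoints. *)
Lemma intg_legL p q : intg (-1) 1 (legL p * q) = intg (-1) 1 (p * legL q).
Proof.
apply/eqP; rewrite -subr_eq0 -linearB /=.
have -> : legL p * q - p * legL q = ((1 - 'X^2) * (p^`() * q - p * q^`()))^`().
  by rewrite /legL !(derivM, derivB); ring.
by rewrite intg_deriv !hornerE; apply/eqP; ring.
Qed.

Lemma intg_leg_orth n m : n != m -> intg (-1) 1 (leg n * leg m) = 0.
Proof.
move=> nm; have := intg_legL (leg n) (leg m).
rewrite !legL_leg -scalerAl -scalerAr ![intg _ _ (_ *: _)]linearZ /=.
move/eqP; rewrite -subr_eq0 -mulrBl mulf_eq0 => /orP[|/eqP//].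
rewrite opprK addrC subr_eq0 !natr1 -!natrM eqr_nat => /eqP e.
by move/eqP: nm; nia.
Qed.

Lemma intg_leg n : intg (-1) 1 (leg n.+1) = 0.
Proof. by rewrite -[leg _]mulr1 -leg0 intg_leg_orth. Qed.

(** Integrating [deriv_leg] over [-1, 1] kills its right side, so P_(n+2) - P_n takes at -1 the
    value 0 that it takes at 1. *)
Lemma leg_hornerN1 n : (leg n).[-1] = (-1) ^+ n.
Proof.
have [m] := ubnP n; elim: m n => // m IH [|[|n]] hn.
- by rewrite leg0 hornerC expr0.
- by rewrite leg1 hornerX expr1.
have := congr1 (intg (-1) 1) (deriv_leg n).
rewrite linearB linearZ /= !intg_deriv intg_leg mulr0 !leg_horner1.
rewrite (IH n); last by lia.
by rewrite exprSr exprSr; move=> h; lra.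
Qed.

(** [deriv_leg] unfolds P_j' into multiples of P_i with i < j, all orthogonal to P_n. *)
Lemma intg_leg_deriv n j : (j <= n)%N -> intg (-1) 1 (leg n * (leg j)^`()) = 0.
Proof.
have [m] := ubnP j; elim: m j => // m IH [|[|j]] hj jn.
- by rewrite leg0 (derivC 1) mulr0 linear0.
- by rewrite leg1 derivX -leg0 intg_leg_orth//; lia.
have -> : (leg j.+2)^`() = (leg j)^`() + (2 * j.+1 + 1)%:R *: leg j.+1.
  by rewrite -deriv_leg addrC subrK.
rewrite mulrDr linearD -scalerAr /= [X in _ + X]linearZ/= IH ?add0r; [|lia|lia].
by rewrite intg_leg_orth ?mulr0//; lia.
Qed.

(** In (2n+1) P_n = P_(n+1)' - P_(n-1)' the second term is orthogonal to P_n, and the first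
    integrates by parts to the boundary value 2 of P_(n+1) P_n. *)
Lemma intg_leg_sqr n : intg (-1) 1 (leg n * leg n) = 2 / (2 * n + 1)%:R.
Proof.
case: n => [|n].
  by rewrite leg0 mulr1 -(derivX R) intg_deriv !hornerX muln0 add0n divr1; ring.
have nz : (2 * n.+1 + 1)%:R != 0 :> R by rewrite pnatr_eq0; lia.
apply: (mulfI nz); rewrite mulrC [RHS]mulrC divfK// mulrC.
have -> : (2 * n.+1 + 1)%:R * intg (-1) 1 (leg n.+1 * leg n.+1) =
   intg (-1) 1 (leg n.+1 * ((leg n.+2)^`() - (leg n)^`())).
  by rewrite deriv_leg -scalerAr linearZ.
rewrite mulrBr linearB /= [X in _ - X]intg_leg_deriv// subr0.
have := intg_deriv (-1) 1 (leg n.+2 * leg n.+1).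
rewrite derivM linearD /= [X in _ + X]intg_leg_deriv// addr0 mulrC => ->.
rewrite !hornerM !leg_horner1 !leg_hornerN1 [_ ^+ n.+2]exprSr mulrN1 mulNr.
by rewrite -exprMn mulrNN mulr1 expr1n; ring.
Qed.

Lemma leg_basis n p : (size p <= n)%N ->
  exists c : nat -> R, p = \sum_(k < n) c k *: leg k.
Proof.
elim: n p => [|n IH] p sp.
  by exists (fun=> 0); rewrite big_ord0; apply/eqP; rewrite -size_poly_eq0 -leqn0.
have [|c hc] := IH (p - (p`_n / (leg n)`_n) *: leg n).
  apply/leq_sizeP => j nj; rewrite coefB coefZ.
  have [->|jn] := eqVneq j n; first by rewrite divfK ?subrr// leg_coefn_neq0.
  by rewrite (nth_default _ (_ : size p <= j)%N) ?(nth_default _ (_ : size (leg n) <= j)%N)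
     ?mulr0 ?subr0 ?size_leg//; lia.
exists (fun k => if k == n then p`_n / (leg n)`_n else c k).
rewrite big_ord_recr /= eqxx -[LHS](subrK ((p`_n / (leg n)`_n) *: leg n)); congr (_ + _).
by rewrite hc; apply: eq_bigr => i _; rewrite ltn_eqF.
Qed.

Lemma poly_ext_infinite p q (f : nat -> R) : injective f ->
  (forall i, p.[f i] = q.[f i]) -> p = q.
Proof.
move=> inj_f pq; apply/eqP; rewrite -subr_eq0; apply/negPn/negP => h.
have := @max_poly_roots _ (p - q) [seq f i | i <- iota 0 (size (p - q))] h.
rewrite size_map size_iota ltnn map_inj_uniq// iota_uniq => hh.
suff : false by [].
by apply: hh => //; apply/allP => _ /mapP[i _ ->]; rewrite rootE !hornerE pq subrr.
Qed.

Lemma poly_ext p q : (forall x, p.[x] = q.[x]) -> p = q.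
Proof.
move=> pq; apply: (@poly_ext_infinite _ _ (fun i => i%:R)) => //.
by move=> i j /eqP; rewrite eqr_nat => /eqP.
Qed.

End legendre_theory.

(** * The product formula for Legendre polynomials *)

Section product_formula.
Variable R : realFieldType.
Implicit Types (p q f : {poly R}) (y : R).
Local Notation leg := (@leg R).
Local Notation legL := (@legL R).
Local Notation intg := (@intg R).

Lemma derivn_legL f j : (legL f)^`(j) =
  (1 - 'X^2) * f^`(j.+2) - (2 * j.+1)%:R *: ('X * f^`(j.+1)) -
  (j * j.+1)%:R *: f^`(j).
Proof.
elim: j => [|j IH].
  rewrite mul0n scale0r subr0 /legL derivM derivB derivXn (derivC 1) sub0r.
  by rewrite !derivnS derivn0 -!mul_polyC polyC_natr; ring.
rewrite derivnS IH !derivB !derivZ !derivM derivB derivXn (derivC 1) derivX.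
by rewrite -!derivnS -!mul_polyC !polyC_natr; ring.
Qed.

Definition pc k : R := (k`!%:R ^+ 2 * 4 ^+ k)^-1.

Lemma pcS k : pc k.+1 * (4 * k.+1%:R ^+ 2) = pc k.
Proof.
rewrite /pc factS natrM exprMn [4 ^+ k.+1]exprS.
have h : k`!%:R != 0 :> R by rewrite pnatr_eq0 -lt0n fact_gt0.
have h1 : k.+1%:R != 0 :> R by rewrite pnatr_eq0.
have h4 : 4 ^+ k != 0 :> R by rewrite expf_neq0// pnatr_eq0.
by move: h1; set c := k.+1%:R; clearbody c => h1; field; rewrite h h4 h1.
Qed.

(** For m large enough this is Legendre's generalised translation, the mean over the angle a of f(x
    y + sqrt((1 - x^2)(1 - y^2)) cos a), in Taylor form. Odd powers of the cosine average to 0, and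
    the mean of its 2k-th power divided by (2k)! is [pc k]. *)
Definition ptrans f y m : {poly R} := \sum_(k < m) (pc k * (1 - y ^+ 2) ^+ k) *:
  ((f^`(2 * k) \Po (y *: 'X)) * (1 - 'X^2) ^+ k).

Lemma deriv_oneBX2 k :
  ((1 - 'X^2) ^+ k.+1 : {poly R})^`() = - (2 * k.+1)%:R *: ('X * (1 - 'X^2) ^+ k).
Proof.
rewrite deriv_exp /= derivB derivXn (derivC 1) -mul_polyC.
by rewrite !(polyCN, polyC_natr); ring.
Qed.

Lemma deriv_comp_scale f y : (f \Po (y *: 'X))^`() = y *: (f^`() \Po (y *: 'X)).
Proof. by rewrite deriv_comp derivZ derivX alg_polyC mulrC mul_polyC. Qed.

(** For F0, F1, F2 the derivatives of f of orders 2k, 2k+1, 2k+2 at y X, the first bracket is, by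
    [derivn_legL], the derivative of order 2k of [legL f] at y X. The remaining two terms are those
    that telescope once weighted by [pc]. *)
Lemma legL_dilate (F0 F1 F2 : {poly R}) y k :
  F0^`() = y *: F1 -> F1^`() = y *: F2 ->
  legL (F0 * (1 - 'X^2) ^+ k) =
  ((1 - (y *: 'X) ^+ 2) * F2 - (2 * (2 * k).+1)%:R *: ((y *: 'X) * F1) -
    (2 * k * (2 * k).+1)%:R *: F0) * (1 - 'X^2) ^+ k +
  ((4 * k%:R ^+ 2) *: (F0 * (1 - 'X^2) ^+ k.-1) -
   (1 - y ^+ 2) *: (F2 * (1 - 'X^2) ^+ k)).
Proof.
move=> dF0 dF1; case: k => [|k].
  rewrite /legL expr0 !mulr1 dF0 derivM derivB derivXn (derivC 1) derivZ dF1.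
  rewrite -!mul_polyC !(polyCM, polyCB, polyCD, polyC_natr, polyC_exp).
  by ring.
rewrite /legL derivM deriv_oneBX2 dF0 /=.
have -> : (1 - 'X^2) * (y *: F1 * (1 - 'X^2) ^+ k.+1 +
     F0 * (- (2 * k.+1)%:R *: ('X * (1 - 'X^2) ^+ k))) =
   y *: (F1 * (1 - 'X^2) ^+ k.+2) +
     - (2 * k.+1)%:R *: (F0 * ('X * (1 - 'X^2) ^+ k.+1)).
  rewrite [_ ^+ k.+2]exprS [_ ^+ k.+1]exprS -!mul_polyC.
  by set c := (_%:P : {poly R}); clearbody c; ring.
rewrite derivD !derivZ (derivM F1) (derivM F0) (derivM 'X) dF1 dF0 derivX.
rewrite !deriv_oneBX2.
have -> : (2 * k.+2)%:R = 2 * k.+1%:R + 2 :> R by ring.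
have -> : (2 * (2 * k.+1).+1)%:R = 4 * k.+1%:R + 2 :> R by ring.
have -> : (2 * k.+1 * (2 * k.+1).+1)%:R = 2 * k.+1%:R * (2 * k.+1%:R + 1) :> R by ring.
have -> : (2 * k.+1)%:R = 2 * k.+1%:R :> R by ring.
set K : R := k.+1%:R; clearbody K.
have pE : ((- (2 * K + 2))%:P = - (2 * K%:P + 2) :> {poly R}) *
    ((4 * K + 2)%:P = 4 * K%:P + 2 :> {poly R}) *
    ((2 * K * (2 * K + 1))%:P = 2 * K%:P * (2 * K%:P + 1) :> {poly R}) *
    ((- (2 * K))%:P = - (2 * K%:P) :> {poly R}) *
    ((4 * K ^+ 2)%:P = 4 * K%:P ^+ 2 :> {poly R}) *
    ((1 - y ^+ 2)%:P = 1 - y%:P ^+ 2 :> {poly R}).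
  have c4 : (4%:P = 4 :> {poly R}) by rewrite polyC_natr.
  have c2 : (2%:P = 2 :> {poly R}) by rewrite polyC_natr.
  by do !split; rewrite ?polyCN ?polyCB ?(polyCD (2 * _)) ?(polyCD (4 * _)) ?polyCM
    ?polyC_exp ?(polyCD (2 * _)) ?polyCM ?c2 ?c4.
rewrite -!mul_polyC !pE [_ ^+ k.+2]exprS [_ ^+ k.+1]exprS.
by set a := (1 - 'X^2) ^+ k; ring.
Qed.

Lemma legL_ptrans f y m : (size f <= 2 * m)%N ->
  legL (ptrans f y m) = ptrans (legL f) y m.
Proof.
move=> fm.
(* [G 0] vanishes through the factor k^2, which also makes [k.-1] harmless; [G m] vanishes because
   the derivative of f of order 2m is 0. *)
pose G k := (pc k * (4 * k%:R ^+ 2) * (1 - y ^+ 2) ^+ k) *: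
  ((f^`(2 * k) \Po (y *: 'X)) * (1 - 'X^2) ^+ k.-1).
have step k : legL ((pc k * (1 - y ^+ 2) ^+ k) *:
    ((f^`(2 * k) \Po (y *: 'X)) * (1 - 'X^2) ^+ k)) =
  (pc k * (1 - y ^+ 2) ^+ k) *:
    (((legL f)^`(2 * k) \Po (y *: 'X)) * (1 - 'X^2) ^+ k) - (G k.+1 - G k).
  have GS : G k.+1 = (pc k * (1 - y ^+ 2) ^+ k) *: ((1 - y ^+ 2) *:
      ((f^`((2 * k).+2) \Po (y *: 'X)) * (1 - 'X^2) ^+ k)).
    by rewrite /G pcS exprSr scalerA mulrA mulnS.
  rewrite [LHS]linearZ /= GS.
  have -> : G k = (pc k * (1 - y ^+ 2) ^+ k) *:
      ((4 * k%:R ^+ 2) *: ((f^`(2 * k) \Po (y *: 'X)) * (1 - 'X^2) ^+ k.-1)).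
    by rewrite /G scalerA; congr (_ *: _); ring.
  rewrite -scalerBr -scalerBr; congr (_ *: _).
  rewrite (@legL_dilate _ (f^`((2 * k).+1) \Po (y *: 'X))
     (f^`((2 * k).+2) \Po (y *: 'X)) y) ?deriv_comp_scale -?derivnS//.
  rewrite opprB; congr (_ * _ + _).
  rewrite derivn_legL !(comp_polyB, comp_polyM, comp_polyZ, comp_polyX).
  by rewrite -[in RHS]polyC1 comp_polyC.
rewrite /ptrans linear_sum /=.
under eq_bigr do rewrite step.
rewrite big_split/= sumrN -(big_mkord xpredT (fun k => G k.+1 - G k)).
rewrite telescope_sumr// /G derivn_poly0// comp_poly0 mul0r scaler0.
by rewrite expr0n/= !mulr0 mul0r scale0r subrr oppr0 addr0.
Qed.

(** The translation commutes with [legL], so it maps [leg n] into the same eigenspace, which is a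
    line. The factor is read off at 1, where only the term k = 0 survives. *)
Lemma leg_ptrans n y m : (n < 2 * m)%N -> ptrans (leg n) y m = (leg n).[y] *: leg n.
Proof.
move=> nm; have Lm : (size (leg n) <= 2 * m)%N by rewrite size_leg.
have eig : legL (ptrans (leg n) y m) = - (n%:R * (n%:R + 1)) *: ptrans (leg n) y m.
  rewrite legL_ptrans// legL_leg /ptrans [in RHS]scaler_sumr; apply: eq_bigr => k _.
  by rewrite derivnZ comp_polyZ -scalerAl !scalerA [in RHS]mulrC.
have e := legL_eigen eig.
rewrite [LHS]e; congr (_ *: _).
have := congr1 (fun p : {poly R} => p.[1]) e.
rewrite hornerZ leg_horner1 mulr1 => <-.
rewrite /ptrans horner_sum; case: m {Lm eig e} nm => [|m _]; first by rewrite muln0.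
rewrite big_ord_recl big1 ?addr0 => [|i _].
  rewrite /= !expr0 !mulr1 /pc fact0 expr1n expr0 mul1r invr1 scale1r.
  by rewrite horner_comp !hornerE.
by rewrite hornerZ hornerM horner_exp !hornerE/= expr1n subrr expr0n/= !mulr0.
Qed.

(** The translation of P_n in symmetric coordinates b = - (z + w) and c = z w, c being the
    polynomial variable: (1 - z^2)(1 - w^2) = (1 + c)^2 - b^2. The terms with 2k > n are 0. *)
Definition legN n (b : R) : {poly R} := \sum_(k < n.+1) pc k *:
  ((leg n)^`(2 * k) * (('X + 1) ^+ 2 - (b ^+ 2)%:P) ^+ k).

Lemma legN_prod n z w : (legN n (- (z + w))).[z * w] = (leg n).[z] * (leg n).[w].
Proof.
rewrite [RHS]mulrC -hornerZ -(@leg_ptrans n w n.+1); last by lia.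
rewrite /legN /ptrans !horner_sum; apply: eq_bigr => k _.
rewrite !hornerZ !hornerM horner_comp !hornerE/= -!mulrA; congr (_ * _).
rewrite [RHS]mulrCA [z * w]mulrC; congr (_ * _).
by rewrite -exprMn sqrrN; congr (_ ^+ k); ring.
Qed.

(** For fixed b the product formula reads N(b, x (- b - x)) = P(- b - x) P(x). Differentiating in x
    at w brings out the inner derivative - b - 2 w = z - w. *)
Lemma deriv_legN n z w : (z - w) * (legN n (- (z + w)))^`().[z * w] =
  (leg n).[z] * (leg n)^`().[w] - (leg n)^`().[z] * (leg n).[w].
Proof.
set b := - (z + w).
have e : legN n b \Po ((- b)%:P * 'X - 'X^2) =
   (leg n \Po ((- b)%:P - 'X)) * leg n.
  apply: poly_ext => x; rewrite hornerM !horner_comp !hornerE -legN_prod.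
  by congr (legN _ _).[_]; ring.
have := congr1 (fun p : {poly R} => p^`().[w]) e.
rewrite derivM !deriv_comp !derivB derivM derivC derivX derivXn.
rewrite !(hornerM, horner_comp, hornerD, hornerN, hornerC, hornerX, hornerXn, hornerMn)/=.
have -> : - b * w - w ^+ 2 = z * w by rewrite /b; ring.
have -> : - b - w = z by rewrite /b; ring.
move=> h; rewrite mulrC; have -> : z - w = - b - w *+ 2 by rewrite /b -mulr_natl; ring.
by rewrite expr1 in h; move: h; rewrite !(mul0r, mulr1, add0r, derivC, hornerC) => ->; ring.
Qed.

Lemma legN_sqr n b : (legN n b).[b ^+ 2 / 4] = (leg n).[- b / 2] ^+ 2.
Proof.
rewrite [RHS]expr2 -legN_prod.
have -> : - (- b / 2 + - b / 2) = b by field.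
by congr (_.[_]); field.
Qed.

Definition legN1 n : {poly R} :=
  \sum_(k < n.+1) (pc k * (leg n)^`(2 * k).[1]) *: (4%:P - 'X^2) ^+ k.

Lemma legN1E n b : (legN n b).[1] = (legN1 n).[b].
Proof.
rewrite /legN /legN1 !horner_sum; apply: eq_bigr => k _.
rewrite !hornerZ hornerM !horner_exp !hornerE/= -!mulrA; congr (_ * (_ * _ ^+ k)).
by ring.
Qed.

(** A beta integral: integrating the derivative of X (4 - X^2)^(k+1) over [-2, 2] gives (2k+3)
    I_(k+1) = 8 (k+1) I_k. *)
Lemma intg_fourBX2 k :
  intg (-2) 2 ((4%:P - 'X^2) ^+ k) = 4 * 16 ^+ k * k`!%:R ^+ 2 / (2 * k).+1`!%:R.
Proof.
elim: k => [|k IH].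
  by rewrite expr0 -(derivX R) intg_deriv !hornerX muln0 fact0 !mulr1 divr1; ring.
have e : ('X * (4%:P - 'X^2) ^+ k.+1)^`() =
    (2 * k + 3)%:R *: (4%:P - 'X^2) ^+ k.+1 -
    (8 * k.+1)%:R *: (4%:P - 'X^2) ^+ k :> {poly R}.
  rewrite derivM derivX deriv_exp /= derivB derivXn derivC exprS -!mul_polyC.
  by rewrite !polyC_natr; ring.
have := @intg_deriv R (-2) 2 ('X * (4%:P - 'X^2) ^+ k.+1).
rewrite e linearB [X in X - _]linearZ [X in _ - X]linearZ /= IH.
rewrite !hornerM !horner_exp !hornerE/= sqrrN.
have -> : (4 - 2 ^+ 2 : R) = 0 by ring.
rewrite expr0n/= !mulr0 subrr => /eqP; rewrite subr_eq0 => /eqP h.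
have k3 : (2 * k + 3)%:R != 0 :> R by rewrite pnatr_eq0; lia.
apply: (mulfI k3); rewrite h (_ : (2 * k.+1)%N = (2 * k).+2); last by lia.
rewrite exprS !factS !natrM.
have f0 : (2 * k)`!%:R != 0 :> R by rewrite pnatr_eq0 -lt0n fact_gt0.
have k1 : (2 * k).+1%:R != 0 :> R by rewrite pnatr_eq0.
rewrite (_ : (2 * k).+2%:R = 2 * k.+1%:R); last by rewrite -natrM; congr _%:R; lia.
rewrite (_ : (2 * k).+3 = (2 * k + 3)%N); last by lia.
have k2 : k.+1%:R != 0 :> R by rewrite pnatr_eq0.
move: k3 f0 k1 k2; set a := (2 * k + 3)%:R; set b := (2 * k)`!%:R.
set c := (2 * k).+1%:R; set e' := k.+1%:R; clearbody a b c e' => k3 f0 k1 k2.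
by field; rewrite k3 k2 k1 f0.
Qed.

(** By [intg_fourBX2] the left side is a series in the even derivatives of P_n at 1. The point 1 is
    the midpoint of [-1, 3]: expanding the antiderivative about it, the values at 1 + 2 and 1 - 2
    differ by twice the odd orders, which are the same even derivatives. *)
Lemma intg_legN1 n : intg (-2) 2 (legN1 n) = intg (-1) 3 (leg n).
Proof.
transitivity (\sum_(k < n.+1) (leg n)^`(2 * k).[1] * (4 * 4 ^+ k / (2 * k).+1`!%:R)).
  rewrite /legN1 linear_sum /=; apply: eq_bigr => k _.
  rewrite linearZ /= intg_fourBX2 mulrC mulrA mulrC; congr (_ * _).
  rewrite /pc (_ : 16 = 4 * 4) ?exprMn; last by ring.
  have h : k`!%:R != 0 :> R by rewrite pnatr_eq0 -lt0n fact_gt0.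
  have h1 : (2 * k).+1`!%:R != 0 :> R by rewrite pnatr_eq0 -lt0n fact_gt0.
  have h4 : 4 ^+ k != 0 :> R by rewrite expf_neq0// pnatr_eq0.
  by field; rewrite h h1 h4.
rewrite /intg.
have sq : (size (prim (leg n)) <= 2 * n.+1)%N.
  by apply: leq_trans (size_prim _) _; rewrite size_leg; lia.
have -> : (3 : R) = 1 + 2 by ring.
have -> : (-1 : R) = 1 + (-2) by ring.

rewrite !(nderiv_taylor_wide (mulrC _ _) sq) -sumrB.
rewrite -(big_mkord xpredT (fun i => (prim (leg n))^`N(i).[1] * 2 ^+ i
   - (prim (leg n))^`N(i).[1] * (-2) ^+ i)).
have dbl (F : nat -> R) m : \sum_(0 <= i < 2 * m) F i =
    \sum_(i < m) (F (2 * i)%N + F (2 * i).+1).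
  elim: m => [|m IH]; first by rewrite muln0 big_geq// big_ord0.
  by rewrite mulnS !addSn add0n big_nat_recr//= big_nat_recr//= IH big_ord_recr/= addrA.
rewrite dbl; apply: eq_bigr => k _.
rewrite [(-2) ^+ (2 * k).+1]exprS exprM (exprM (-2)) sqrrN subrr add0r.
have d : (prim (leg n))^`((2 * k).+1) = (leg n)^`(2 * k).
  by rewrite derivSn deriv_prim.
have := nderivn_def (2 * k).+1 (prim (leg n)); rewrite d => ->.
have h1 : (2 * k).+1`!%:R != 0 :> R by rewrite pnatr_eq0 -lt0n fact_gt0.
rewrite hornerMn -[_ *+ _]mulr_natr exprS exprM (_ : 2 ^+ 2 = 4); last by ring.
by field.
Qed.

(** The contributions of the endpoint -1 cancel, since P_(n+2) and P_n agree there. *)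
Lemma intg_leg3 n : (2 * n.+1 + 1)%:R * intg (-1) 3 (leg n.+1) =
  (leg n.+2).[3] - (leg n).[3].
Proof.
have := congr1 (intg (-1) 3) (deriv_leg R n).
rewrite linearB linearZ /= !intg_deriv => <-.
by rewrite !leg_hornerN1 !exprS; ring.
Qed.

Lemma intg_dilate p : intg (-2) 2 (p \Po ((- 2^-1) *: 'X)) = 2 * intg (-1) 1 p.
Proof.
have := intg_deriv (-2) 2 ((-2) *: (prim p \Po ((- 2^-1) *: 'X))).
rewrite derivZ deriv_comp_scale scalerA deriv_prim.
have -> : (-2 * - 2^-1 : R) = 1 by field.
rewrite scale1r => ->; rewrite /intg !hornerZ !horner_comp !hornerE.
have -> : (- 2^-1 * 2 : R) = - 1 by field.
have -> : (- 2^-1 * - 2 : R) = 1 by field.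
by ring.
Qed.

(** One summand of the volume: integrating dN/dc leaves N at c = 1 minus N on the parabola c = b^2 /
    4 of double roots, where it equals P(-b/2)^2. The square integrates to 4 / (2n+3), whence the -
    1. *)
Lemma legN_area n : (2 * n.+1 + 1)%:R / 4 * (intg (-2) 2 (legN1 n.+1) -
   intg (-2) 2 ((leg n.+1 ^+ 2) \Po ((- 2^-1) *: 'X))) =
  ((leg n.+2).[3] - (leg n).[3]) / 4 - 1.
Proof.
rewrite intg_dilate intg_legN1 -intg_leg3 expr2 intg_leg_sqr.
have h : (2 * n.+1 + 1)%:R != 0 :> R by rewrite pnatr_eq0; lia.
by move: h; set c := (2 * n.+1 + 1)%:R; clearbody c => h; field.
Qed.

(** * The value at 3 modulo 4 *)

Lemma leg3E n : (leg n).[3] = (\sum_(k < n.+1) 'C(n, k) * 'C(n + k, k))%:R.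
Proof.
rewrite /leg horner_sum natr_sum; apply: eq_bigr => k _.
rewrite hornerZ horner_exp /leg_u !hornerE (_ : 2^-1 * (3 - 1) = 1); last by field.
by rewrite expr1n mulr1.
Qed.

Lemma sum_bin_bin n j :
  (\sum_(k < n.+1) 'C(n, k) * 'C(k, j) = 'C(n, j) * 2 ^ (n - j))%N.
Proof.
elim: n j => [|n IH] j.
  by rewrite big_ord1 bin0 mul1n sub0n muln1.
rewrite big_ord_recl /= bin0 mul1n.
under eq_bigr do rewrite /bump/= add1n binS mulnDl.
rewrite big_split /=.
have -> : (\sum_(i < n.+1) 'C(n, i.+1) * 'C(i.+1, j) =
   'C(n, j) * 2 ^ (n - j) - 'C(0, j))%N.
  rewrite -IH [in RHS]big_ord_recl /= bin0 mul1n addKn big_ord_recr /= bin_small//.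
  by rewrite mul0n addn0; apply: eq_bigr => i _; rewrite /bump /= add1n.
have le0 : ('C(0, j) <= 'C(n, j) * 2 ^ (n - j))%N.
  by case: j => [|j]; rewrite ?bin0n// bin0 subn0 mul1n expn_gt0.
rewrite addnA subnKC//; case: j {le0} => [|j].
  under [in LHS]eq_bigr do rewrite bin0 muln1.
  have -> : (\sum_(i < n.+1) 'C(n, i) = 2 ^ n)%N.
    have := IH 0%N; rewrite bin0 mul1n subn0 => <-.
    by apply: eq_bigr => k _; rewrite bin0 muln1.
  by rewrite !bin0 !mul1n !subn0 expnS; lia.
under eq_bigr do rewrite binS mulnDr.
rewrite big_split /= !IH binS subSS.
have [jn|nj] := ltnP j n; last first.
  by rewrite (@bin_small n j.+1)// !mul0n.
have -> : (n - j = (n - j.+1).+1)%N by lia.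
by rewrite expnS; lia.
Qed.

(** Both sides are the central Delannoy number. Vandermonde expands C(n+k, k) into the sum of C(n,
    j) C(k, j), and the sum over k then produces the powers of 2. *)
Lemma sum_bin_square n : (\sum_(k < n.+1) 'C(n, k) * 'C(n + k, k) =
  \sum_(j < n.+1) 'C(n, j) ^ 2 * 2 ^ (n - j))%N.
Proof.
transitivity (\sum_(k < n.+1) \sum_(j < n.+1) 'C(n, k) * ('C(n, j) * 'C(k, j)))%N.
  apply: eq_bigr => k _; rewrite -big_distrr /=; congr muln.
  rewrite -binomial.Vandermonde.
  rewrite -(big_mkord xpredT (fun j => 'C(n, j) * 'C(k, j)))%N.
  rewrite (@big_cat_nat _ _ _ k.+1)//= [X in (_ + X)%N]big_nat.
  rewrite [X in (_ + X)%N]big1 ?addn0 => [|j /andP[kj _]]; last by rewrite (@bin_small k) ?muln0.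
  by rewrite big_mkord; apply: eq_bigr => j _; rewrite bin_sub// -ltnS.
rewrite exchange_big /=; apply: eq_bigr => j _.
under eq_bigr do rewrite mulnCA.
by rewrite -big_distrr /= sum_bin_bin mulnA mulnn.
Qed.

(** In the form with powers of 2 only j = n and j = n - 1 survive modulo 4. They contribute 1 and 2
    n^2, and n^2 has the parity of n. *)
Lemma leg3_int n : exists m, (leg n).[3] = (2 * n + 1 + 4 * m)%:R.
Proof.
suff [m hm] : exists m, (\sum_(k < n.+1) 'C(n, k) * 'C(n + k, k) = 2 * n + 1 + 4 * m)%N.
  by exists m; rewrite leg3E hm.
rewrite sum_bin_square; case: n => [|n].
  by exists 0%N; rewrite big_ord1 bin0.
rewrite 2!big_ord_recr /= binn subnn -(bin_sub (leqnSn n)) subSnn bin1.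
have [m ->] : exists m, (\sum_(i < n) 'C(n.+1, i) ^ 2 * 2 ^ (n.+1 - i) = 4 * m)%N.
  exists (\sum_(i < n) 'C(n.+1, i) ^ 2 * 2 ^ (n - i).-1)%N.
  rewrite big_distrr /=; apply: eq_bigr => i _.
  have -> : (n.+1 - i = (n - i).-1.+2)%N by have := ltn_ord i; lia.
  by rewrite !expnS; lia.
have [h ->] : exists h, (n.+1 ^ 2 * 2 ^ 1 = 2 * n.+1 + 4 * h)%N.
  exists ('C(n.+1, 2))%N.
  have := bin2odd; have := @bin_ffact n.+1 2; rewrite /= => + _.
  rewrite (_ : n.+1 ^_ 2 = n.+1 * n)%N; last by rewrite ffactnS ffactn1.
  by rewrite (_ : 2`! = 2)%N//; nia.
by exists (m + h)%N; lia.
Qed.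

Lemma legE_bin n : leg n =
  \sum_(0 <= k < n.+1) ('C(n + k, 2 * k)%:R * 'C(2 * k, k)%:R) *: (2^-1 *: ('X - 1)) ^+ k.
Proof.
rewrite big_mkord; apply: eq_bigr => k _.
by rewrite -natrM bin_trinomial.
Qed.

(** * The expansion in powers of X *)

Lemma legL_Xn m : legL 'X^m =
  (m%:R * (m%:R - 1)) *: 'X^(m - 2) - (m%:R * (m%:R + 1)) *: 'X^m.
Proof.
apply/polyP => i; rewrite legL_coef coefB !coefZ !coefXn.
case: m => [|[|m]].
- by case: i => [|i] /=; ring.
- by case: i => [|[|i]] /=; ring.
have -> : (m.+2 - 2 = m)%N by rewrite -addn2 addnK.
rewrite !eqSS; have [->|im] := eqVneq i m.
  rewrite (_ : (m == m.+2) = false)%N; last by lia.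
  by rewrite /=; ring.
by have [->|_] := eqVneq i m.+2; rewrite /=; ring.
Qed.

Definition legendre_coef d k : R :=
  (-1) ^+ k * 'C(d - k, k)%:R * 'C(2 * d - 2 * k, d - k)%:R.

(** Legendre's equation read on the coefficient of X^(m - 2). *)
Lemma legendre_coefS d k : (2 * k.+1 <= d)%N ->
  let m := (d - 2 * k)%:R in
  legendre_coef d k * (m * (m - 1)) =
  - legendre_coef d k.+1 * (d%:R * (d%:R + 1) - (m - 2) * (m - 1)).
Proof.
move=> kd m; pose e := (d - k.+1)%N.
have dk : (d - k = e.+1)%N by rewrite /e; lia.
have de : (d = e + k.+1)%N by rewrite /e; lia.
have ke : (k < e)%N by rewrite /e; lia.
have mE : m = e%:R + 1 - k%:R.
  by rewrite /m natr1 -natrB; [congr _%:R; rewrite /e; lia|rewrite leqW// ltnW].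
rewrite /legendre_coef dk (_ : d - k.+1 = e)%N//.
rewrite (_ : 2 * d - 2 * k = 2 * e + 2)%N; last by lia.
rewrite (_ : 2 * d - 2 * k.+1 = 2 * e)%N; last by lia.
rewrite exprS.
have h1 : k.+1%:R * 'C(e, k.+1)%:R = (e%:R - k%:R) * 'C(e, k)%:R :> R.
  by rewrite -natrB 1?ltnW// -!natrM mul_bin_left.
have h2 : (e%:R + 1 - k%:R) * 'C(e.+1, k)%:R = (e%:R + 1) * 'C(e, k)%:R :> R.
  have := mul_bin_down e.+1 k; rewrite /= => h.
  by rewrite natr1 -natrB; [rewrite -!natrM h|lia].
have h3 : (e%:R + 1) * 'C(2 * e + 2, e.+1)%:R = 2 * (2 * e%:R + 1) * 'C(2 * e, e)%:R :> R.
  have a1 := mul_bin_diag (2 * e + 2) e; have a2 := mul_bin_down (2 * e + 1) e.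
  rewrite addn2 /= in a1; rewrite addn1 /= in a2.
  rewrite (_ : (2 * e).+1 - e = e.+1)%N in a2; last by lia.
  rewrite natr1 -[(2 * e%:R + 1)](_ : (2 * e).+1%:R = _); last by rewrite -natr1 natrM.
  rewrite addn2 -natrM -a1 -!natrM -mulnA a2; congr _%:R; lia.
have dR : d%:R = e%:R + (k%:R + 1) :> R by rewrite de natrD natr1.
rewrite dR mE; have k1 : k.+1%:R = k%:R + 1 :> R by rewrite natr1.
set s := (-1) ^+ k; rewrite k1 in h1.
have e1 : e%:R + 1 != 0 :> R by rewrite natr1 pnatr_eq0.
apply: (mulfI e1).
transitivity (s * ((e%:R + 1 - k%:R) * 'C(e.+1, k)%:R) *
   ((e%:R + 1) * 'C(2 * e + 2, e.+1)%:R) * (e%:R - k%:R)); first by ring.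
rewrite h2 h3.
transitivity ((e%:R + 1) * s * ((e%:R - k%:R) * 'C(e, k)%:R) *
  (2 * (2 * e%:R + 1) * 'C(2 * e, e)%:R)); first by ring.
by rewrite -h1; ring.
Qed.

Lemma leg_legendre d : leg d =
  2 ^- d *: \sum_(0 <= k < d./2.+1) legendre_coef d k *: 'X^(d - 2 * k).
Proof.
set S := \sum_(_ <= _ < _) _.
have dh : (d - 2 * d./2 <= 1)%N by rewrite -[X in (X - _)%N]odd_double_half mul2n addnK; case: odd.
have eig : legL S = - (d%:R * (d%:R + 1)) *: S.
  pose g k := (legendre_coef d k * (d%:R * (d%:R + 1) -
     ((d - 2 * k)%:R * ((d - 2 * k)%:R + 1)))) *: 'X^(d - 2 * k) : {poly R}.
  (* Beyond [d./2] the truncated exponent [d - 2 * k] stays 0, so [g] is cut off there for the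
     telescoping sum to end at 0. *)
  pose g' k := if (k <= d./2)%N then g k else 0.
  apply/eqP; rewrite -subr_eq0 scaleNr opprK; apply/eqP.
  rewrite /S linear_sum scaler_sumr -big_split /= big_nat.
  rewrite (eq_bigr (fun k => g' k - g' k.+1)); last first.
    move=> k /andP[_ kd]; rewrite ltnS in kd.
    rewrite [X in X + _]linearZ /= legL_Xn /g' kd scalerBr scalerA.
    have [k1|k1] := leqP k.+1 d./2.
      have kd' : (2 * k.+1 <= d)%N.
        by rewrite -[X in (_ <= X)%N]odd_double_half -mul2n; lia.
      rewrite (legendre_coefS kd') /g.
      have -> : (d - 2 * k.+1 = d - 2 * k - 2)%N by lia.
      rewrite mulNr scaleNr.
      have -> : (d - 2 * k - 2)%:R = (d - 2 * k)%:R - 2 :> R by rewrite natrB//; lia.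
      rewrite (_ : _ - 2 + 1 = (d - 2 * k)%:R - 1); last by ring.
      rewrite [RHS]addrC -addrA; congr (_ + _).
      by rewrite !scalerA -scaleNr -scalerDl; congr (_ *: _); ring.
    (* For the last k the exponent is 0 or 1, and m (m - 1) = 0: no lower power appears. *)
    have dk : k = d./2 by lia.
    rewrite subr0 /g; move: dh; rewrite -dk.
    case: (d - 2 * k)%N => [|[|//]] _ /=;
      rewrite -!mul_polyC !(polyCM, polyCB, polyCD, polyC_natr);
      by set c := (_%:P : {poly R}); clearbody c; ring.
  rewrite -big_nat (eq_bigr (fun k => - (g' k.+1 - g' k))); last by move=> k _; rewrite opprB.
  rewrite sumrN telescope_sumr// {1}/g' ltnn /g' leq0n /g muln0 subn0 subrr.
  by rewrite mulr0 scale0r subrr oppr0.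
have Sd : S`_d = 'C(2 * d, d)%:R.
  rewrite /S coef_sum big_nat_recl//= coefZ coefXn muln0 subn0 eqxx mulr1 big_nat big1.
    by rewrite addr0 /legendre_coef expr0 subn0 bin0 !mul1r muln0 subn0.
  move=> k /andP[_ kd]; rewrite coefZ coefXn (_ : (d == _) = false) ?mulr0//.
  apply/negP => /eqP; have : (0 < d)%N by case: d kd {dh S eig}.
  by lia.
rewrite (legL_eigen eig) Sd leg_coefn scalerA invf_div mulrCA.
have h0 : 'C(2 * d, d)%:R != 0 :> R by rewrite pnatr_eq0 -lt0n bin_gt0; lia.
by rewrite (mulrA (2 ^- d)) mulVf ?expf_neq0 ?pnatr_eq0// mul1r divff// scale1r.
Qed.

End product_formula.

(** * Lebesgue integration over tuples *)

Section tuple_integral.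
Context {R : realType}.
Local Notation mR := (measurableTypeR R).
Local Notation mu := (@lebesgue_measure R).
Local Open Scope ereal_scope.

Lemma lamT_subproof :
  exists lam : forall n, {sigma_finite_measure set (n.-tuple mR) -> \bar R},
    forall n, lam n = @lebesgue_tuple R n :> (_ -> _).
Proof. by exists (fun n => @lebesgue_tuple R n). Qed.

(* An opaque copy of [lebesgue_tuple], which keeps unification from unfolding the recursion. *)
Definition lamT := sval (cid lamT_subproof).

Lemma lamTE n : lamT n = @lebesgue_tuple R n :> (_ -> _).
Proof. by rewrite /lamT; case: cid => lam /= ->. Qed.

Local Notation lam := lamT.

Lemma integral_lamT n (f : n.-tuple mR -> \bar R) :
  \int[lam n]_t f t = \int[@lebesgue_tuple R n]_t f t.
Proof.
apply: eq_measure_integral => A mA sA.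
exact: (f_equal (fun h => h A) (lamTE n)).
Qed.

Lemma measurable_integral_lamT d (T : measurableType d) n
    (g : T * n.-tuple mR -> \bar R) :
  measurable_fun setT g -> (forall p, 0 <= g p) ->
  measurable_fun setT (fun x => \int[lam n]_t g (x, t)).
Proof. by move=> mg g0; exact: measurable_fun_fubini_tonelli_F. Qed.

Lemma measurable_tcons n : measurable_fun setT (@tcons mR n).
Proof. exact: measurable_cons. Qed.

Lemma ge0_integral_tcons n (f : n.+1.-tuple mR -> \bar R) :
  measurable_fun setT f -> (forall t, 0 <= f t) ->
  \int[lam n.+1]_t f t = \int[mu]_x \int[lam n]_t f (tcons (x, t)).
Proof.
move=> mf f0.
rewrite integral_lamT.
transitivity (\int[pushforward (mu \x (@lebesgue_tuple R n)) (@tcons mR n)]_t f t).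
  by apply: eq_measure_integral => [|A mA sA]; first exact: measurable_tcons.
rewrite (ge0_integral_pushforward (@measurable_tcons n))//.
rewrite preimage_setT (@fubini_tonelli1 _ _ _ _ _ _ _ (f \o @tcons mR n)).
- by apply: eq_integral => x _; rewrite integral_lamT.
- exact: (measurableT_comp mf (@measurable_tcons n)).
- by move=> p; exact: f0.
Qed.

Lemma integral_tuple0 (f : 0.-tuple mR -> \bar R) : measurable_fun setT f ->
  \int[lam 0]_t f t = f [tuple].
Proof.
move=> mf; rewrite integral_lamT.
transitivity (\int[dirac ([tuple] : 0.-tuple mR)]_t f t).
  exact: eq_measure_integral.
by rewrite integral_dirac// diracT mul1e.
Qed.

Definition tins n j (p : mR * n.-tuple mR) : n.+1.-tuple mR :=
  [tuple (if i < j then nth 0%R p.2 i else if i == j :> nat then p.1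
          else nth 0%R p.2 i.-1)%N | i < n.+1].

Lemma tins0 n (p : mR * n.-tuple mR) : tins 0 p = tcons p.
Proof.
apply: eq_from_tnth => i; rewrite tnth_mktuple /=.
rewrite (tnth_nth 0%R) /=; case: i => [[|i] ?] //=.
Qed.

Lemma tinsS n j x (y : mR) (t : n.-tuple mR) :
  tins j.+1 (x, tcons (y, t)) = tcons (y, tins j (x, t)).
Proof.
apply: eq_from_tnth => i; rewrite tnth_mktuple /= !(tnth_nth 0%R) /=.
case: i => [[|i] /= ni]//; rewrite ltnS in ni; rewrite ltnS eqSS.
rewrite -[RHS]/(nth 0%R (tins j (x, t)) (Ordinal ni)) -tnth_nth tnth_mktuple /=.
by case: ltngtP => //; case: i ni.
Qed.

Lemma measurable_nth_tuple n i : measurable_fun setT (fun t : n.-tuple mR => nth 0%R t i : mR).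
Proof.
have [ni|ni] := leqP n i.
  rewrite (_ : (fun _ => _) = cst (0%R : mR)); first exact: measurable_cst.
  by apply/funext => t; rewrite nth_default// size_tuple.
rewrite (_ : (fun _ => _) = (@tnth _ mR ^~ (Ordinal ni))); first exact: measurable_tnth.
by apply/funext => t; rewrite (tnth_nth 0%R).
Qed.

Lemma measurable_tins n j : measurable_fun setT (@tins n j).
Proof.
apply/measurable_fun_tnthP => i.
rewrite (_ : _ \o _ = fun p : mR * n.-tuple mR => (if i < j then nth 0%R p.2 i else
    if i == j :> nat then p.1 else nth 0%R p.2 i.-1)%N); last first.
  by apply/funext => p; rewrite /= tnth_mktuple.
have h k : measurable_fun setT (fun p : mR * n.-tuple mR => nth 0%R p.2 k : mR).
  exact: (measurableT_comp (measurable_nth_tuple _)).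
case: (i < j)%N; first exact: h.
by case: (i == j :> nat); [exact: measurable_fst|exact: h].
Qed.

(** Any coordinate can be isolated, in particular the last, which is the constant term of the
    polynomial. In the induction, Tonelli exchanges the head with the coordinate inserted behind
    it. *)
Lemma ge0_integral_tins n j (f : n.+1.-tuple mR -> \bar R) : (j <= n)%N ->
  measurable_fun setT f -> (forall t, 0 <= f t) ->
  \int[lam n.+1]_t f t = \int[mu]_x \int[lam n]_t f (tins j (x, t)).
Proof.
elim: j n f => [|j IH] n f jn mf f0.
  rewrite (ge0_integral_tcons mf f0); apply: eq_integral => x _.
  by apply: eq_integral => t _; rewrite tins0.
case: n jn f mf f0 => // n jn f mf f0.
rewrite (ge0_integral_tcons mf f0).
have mfc : measurable_fun setT (f \o @tcons mR n.+1).
  by apply: measurableT_comp => //; exact: measurable_tcons.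
transitivity (\int[mu]_y \int[mu]_x \int[lam n]_t f (tcons (y, tins j (x, t)))).
  apply: eq_integral => y _; rewrite (IH n (fun t => f (tcons (y, t))))//.
  exact: (measurable_fun_pair2 y mfc).
pose g (p : (mR * mR) * n.-tuple mR) := f (tcons (p.1.1, tins j (p.1.2, p.2))).
have mg : measurable_fun setT g.
  apply: (measurableT_comp mfc).
  have m1 : measurable_fun setT (fst : (mR * mR) * n.-tuple mR -> _).
    exact: measurable_fst.
  have m11 := measurableT_comp (@measurable_fst _ _ mR mR) m1.
  have m12 := measurableT_comp (@measurable_snd _ _ mR mR) m1.
  apply: (measurable_fun_pair m11).
  apply: (measurableT_comp (@measurable_tins n j)).
  exact: (measurable_fun_pair m12 (@measurable_snd _ _ (mR * mR)%type (n.-tuple mR))).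
pose G := fun p : mR * mR => \int[lam n]_t g (p, t).
have mG : measurable_fun setT G.
  by apply: measurable_integral_lamT => // p; exact: f0.
have G0 p : 0 <= G p by apply: integral_ge0 => t _; exact: f0.
rewrite (@fubini_tonelli _ _ _ _ R mu mu G mG G0).
apply: eq_integral => x _.
have mx : measurable_fun setT (fun t => f (tins j.+1 (x, t))).
  exact: (measurableT_comp mf (measurable_fun_pair2 x (@measurable_tins n.+1 j.+1))).
rewrite (ge0_integral_tcons mx (fun _ => f0 _)).
by apply: eq_integral => y _; apply: eq_integral => t _; rewrite /g/= tinsS.
Qed.

Lemma integral_shift (f : mR -> \bar R) (c : R) : measurable_fun setT f ->
  (forall x, 0 <= f x) -> \int[mu]_x f (x + c)%R = \int[mu]_x f x.
Proof.
move=> mf f0; pose s (x : mR) : mR := (x + c)%R.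
have ms : measurable_fun setT s.
  by apply: measurable_funD => //; exact: measurable_cst.
transitivity (\int[pushforward mu s]_x f x).
  by rewrite ge0_integral_pushforward// preimage_setT.
apply: eq_measure_integral => A mA _; apply/esym.
apply: (lebesgue_measure_unique (mu := pushforward mu s)) => //= _ [[a b]] _ <-.
rewrite /pushforward.
have -> : s @^-1` `]a, b] = `](a - c)%R, (b - c)%R]%classic.
  apply/seteqP; split => x; rewrite /s /= !in_itv/=.
    by move=> /andP[? ?]; apply/andP; split; lra.
  by move=> /andP[? ?]; apply/andP; split; lra.
rewrite !lebesgue_measure_itv/= !lte_fin ltrD2r; case: ifP => // _.
by rewrite -!EFinD; congr _%:E; ring.
Qed.

(** Horner's scheme. For c = 1 it lists the coefficients of the quotient of X * [monic_of t] + y by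
    X - x, whatever y. For fixed x it is triangular with unit diagonal, up to a translation. *)
Fixpoint thorner n (c x : R) : n.-tuple mR -> n.-tuple mR :=
  match n with
  | 0 => fun t => t
  | m.+1 => fun t => let b := (thead t + x * c)%R in
      [tuple of b :: @thorner m b x [tuple of behead t]]
  end.

Lemma measurable_thorner n :
  measurable_fun setT (fun p : (mR * mR) * n.-tuple mR => thorner p.1.1 p.1.2 p.2).
Proof.
elim: n => [|n IH]; first exact: measurable_snd.
have m1 : measurable_fun setT (fun p : (mR * mR) * n.+1.-tuple mR => p.1.1).
  by apply: (measurableT_comp measurable_fst); exact: measurable_fst.
have m2 : measurable_fun setT (fun p : (mR * mR) * n.+1.-tuple mR => p.1.2).
  by apply: (measurableT_comp measurable_snd); exact: measurable_fst.
have m3 : measurable_fun setT (fun p : (mR * mR) * n.+1.-tuple mR => p.2).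
  exact: measurable_snd.
have mb : measurable_fun setT (fun p : (mR * mR) * n.+1.-tuple mR =>
    thead p.2 + p.1.2 * p.1.1 : mR)%R.
  apply: (@measurable_funD _ _ R); last exact: (@measurable_funM _ _ R).
  exact: (measurableT_comp (measurable_tnth _) m3).
apply: measurable_cons => //.
apply: (measurableT_comp IH (g := fun p : (mR * mR) * n.+1.-tuple mR =>
   ((thead p.2 + p.1.2 * p.1.1 : mR, p.1.2), [tuple of behead p.2]))%R).
apply: measurable_fun_pair; first exact: measurable_fun_pair.
exact: (measurableT_comp (@measurable_behead _ _ _) m3).
Qed.

(** A shear: the head is translated by x c, and for a given head the tail undergoes the same map
    with another constant. *)
Lemma ge0_integral_thorner n (c x : R) (g : n.-tuple mR -> \bar R) :
  measurable_fun setT g -> (forall t, 0 <= g t) ->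
  \int[lam n]_t g (thorner c x t) = \int[lam n]_t g t.
Proof.
elim: n c g => [//|n IH] c g mg g0.
have mgc : measurable_fun setT (g \o @tcons mR n).
  by apply: measurableT_comp => //; exact: measurable_tcons.
have mx : measurable_fun setT (fun t => g (thorner c x t)).
  apply: (measurableT_comp mg).
  exact: (measurable_fun_pair2 ((c, x) : mR * mR) (@measurable_thorner n.+1)).
rewrite (ge0_integral_tcons mx (fun _ => g0 _)) (ge0_integral_tcons mg g0).
pose G y := \int[lam n]_t g (tcons (y, t)).
have mG : measurable_fun setT G.
  by apply: (measurable_integral_lamT mgc) => p; exact: g0.
transitivity (\int[mu]_y G (y + x * c)%R); last first.
  by rewrite integral_shift// => y; exact: integral_ge0.
apply: eq_integral => y _.
rewrite /G -[RHS](IH (y + x * c)%R (fun t => g (tcons (y + x * c, t)%R))) //; last first.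
  exact: (measurable_fun_pair2 _ mgc).
apply: eq_integral => t _ /=; congr g; rewrite /tcons theadE /=.
apply/val_inj => /=; congr (_ :: tval (thorner _ _ _)).
by apply/val_inj.
Qed.

End tuple_integral.

(** * The area formula for polynomials *)

Section density.
Context d (T : measurableType d) (R : realType).
Variable mu : {measure set T -> \bar R}.
Variables (k : T -> R) (mk : measurable_fun setT k) (k0 : forall x, 0 <= k x).
Local Open Scope ereal_scope.

(** The two proofs are arguments so that the measure structure can be attached to [dens mk k0]. *)
Definition dens (_ : measurable_fun setT k) (_ : forall x, (0 <= k x)%R) (A : set T) :
  \bar R := \int[mu]_(x in A) (k x)%:E.
Local Notation nu := (dens mk k0).

Let nu0 : nu set0 = 0. Proof. by rewrite /dens integral_set0. Qed.

Let nu_ge0 A : 0 <= nu A.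
Proof. by apply: integral_ge0 => x _; rewrite lee_fin. Qed.

Let nu_sigma_additive : semi_sigma_additive nu.
Proof.
move=> F mF tF mU; rewrite /dens ge0_integral_bigcup//.
- by apply: is_cvg_nneseries => n _ _; exact: nu_ge0.
- exact/measurable_EFinP/measurable_funTS.
- by move=> x _; rewrite lee_fin.
Qed.

HB.instance Definition _ := isMeasure.Build _ _ _ nu nu0 nu_ge0 nu_sigma_additive.

Import HBNNSimple.

Lemma ge0_integral_dens (g : T -> \bar R) :
  measurable_fun setT g -> (forall x, 0 <= g x) ->
  \int[nu]_x g x = \int[mu]_x (g x * (k x)%:E).
Proof.
move=> mg g0; pose f_ := nnsfun_approx measurableT mg.
have cf x : (f_ n x)%:E @[n --> \oo] --> g x.
  by apply: cvg_nnsfun_approx => // *; exact: g0.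
have ndf x : {homo (fun n => f_ n x) : m n / (m <= n)%N >-> (m <= n)%R}.
  by move=> m n mn; exact/lefP/nd_nnsfun_approx.
have mkE : measurable_fun setT (EFin \o k) by exact/measurable_EFinP.
transitivity (limn (fun n => \int[nu]_x (f_ n x)%:E)).
  rewrite -monotone_convergence//.
  - by apply: eq_integral => y _; apply/esym/cvg_lim.
  - by move=> n; exact/measurable_EFinP.
  - by move=> n y _; rewrite lee_fin.
  - by move=> y _ m n mn; rewrite lee_fin; exact: ndf.
rewrite [X in limn X](_ : _ = (fun n => \int[mu]_x ((f_ n x)%:E * (k x)%:E))).
  rewrite -monotone_convergence//.
  - apply: eq_integral => x _; apply/cvg_lim => //.
    exact: (cvgeZr _ (cf x)).
  - by move=> n; apply: emeasurable_funM => //; exact/measurable_EFinP.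
  - by move=> n x _; rewrite -EFinM lee_fin mulr_ge0.
  - by move=> x _ m n mn; rewrite -!EFinM lee_fin ler_wpM2r//; exact: ndf.
apply/funext => n.
under [LHS]eq_integral do rewrite fimfunE -fsumEFin//.
rewrite ge0_integral_fsum//; last 2 first.
  - by move=> y; exact/measurable_EFinP/measurable_funM.
  - by move=> y x _; rewrite nnfun_muleindic_ge0.
under [RHS]eq_integral => x _.
  rewrite fimfunE -fsumEFin// ge0_mule_fsuml; last first.
    by move=> r; rewrite nnfun_muleindic_ge0.
  over.
rewrite ge0_integral_fsum//; last 2 first.
  - move=> y; apply: emeasurable_funM => //.
    by apply/measurable_EFinP/measurable_funM.
  - by move=> y x _; rewrite mule_ge0 ?nnfun_muleindic_ge0// lee_fin.
apply: eq_fsbigr => r _; rewrite integralZl_indic_nnsfun// integral_indic//=.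
rewrite setIT /dens integral_mkcond.
have [r0|r0] := leP 0%R r; last first.
  rewrite preimage_nnfun0// patch_set0 integral_cst// mul0e mule0.
  by rewrite integral0_eq// => x _; rewrite indic0 mulr0 mul0e.
rewrite -ge0_integralZl//.
- apply: eq_integral => x _; rewrite patchE EFinM -muleA; congr (_ * _).
  by rewrite indicE; case: ifP => _; rewrite ?mul1e ?mul0e.
- by apply/(measurable_restrictT _ _).1 => //; exact: measurable_funTS.
- by move=> x _; rewrite patchE; case: ifP => // _; rewrite lee_fin.
Qed.

End density.

Section area.
Context {R : realType}.
Local Notation mR := (measurableTypeR R).
Local Notation mu := (@lebesgue_measure R).
Implicit Types (p : {poly R}) (a b c : R).

Lemma measurable_horner p : measurable_fun setT (horner p : mR -> mR).
Proof.
have : measurable_fun [set: R] (horner p).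
  by apply: continuous_measurable_fun => x; exact: continuous_horner.
by [].
Qed.

Lemma measurable_EFin_horner p (D : set mR) :
  measurable_fun D (fun x : mR => (p.[x])%:E).
Proof.
apply: measurable_funTS; apply: (measurableT_comp (@EFin_measurable R setT)).
exact: measurable_horner.
Qed.

Lemma integral_deriv_horner p a b : a <= b ->
  (\int[mu]_(x in `]a, b[) (p^`().[x])%:E = (p.[b] - p.[a])%:E)%E.
Proof.
rewrite le_eqVlt => /predU1P[->|ab]; first by rewrite set_itvoo0// integral_set0 subrr.
have -> : (\int[mu]_(x in `]a, b[) (p^`().[x])%:E = \int[mu]_(x in `[a, b]) (p^`().[x])%:E)%E.
  rewrite [RHS]integral_itv_bndoo//.
  exact: measurable_EFin_horner.
rewrite (@continuous_FTC2 _ _ (horner p) _ _ ab) ?EFinB//.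
- by apply: continuous_subspaceT => x; exact: continuous_horner.
- split; first by move=> x _; exact: derivable_horner.
  + by apply: cvg_at_right_filter; exact: continuous_horner.
  + by apply: cvg_at_left_filter; exact: continuous_horner.
- by move=> x _; rewrite derivE.
Qed.

(** Both sides integrate [h] against a measure: the image under p of the density p' on ]a,
    b[, and Lebesgue measure on ]p(a), p(b)[. The two agree on the rays ]-oo, t[ by the fundamental
    theorem of calculus, and the rays generate. *)
Lemma ge0_substitution_horner p a b (h : mR -> \bar R) : a < b ->
  {in `]a, b[, forall x, 0 < p^`().[x]} ->
  measurable_fun setT h -> (forall y, 0 <= h y)%E ->
  (\int[mu]_(x in `]a, b[) (h p.[x] * (p^`().[x])%:E) =
   \int[mu]_(y in `]p.[a], p.[b][) h y)%E.
Proof.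
move=> ab dp mh h0.
pose k : mR -> R := (fun x => p^`().[x]) \_ `]a, b[.
have mI : measurable (`]a, b[%classic : set mR) by exact: measurable_itv.
have mk : measurable_fun setT k.
  apply/(measurable_restrictT _ _).1 => //.
  exact: (measurable_funTS (@measurable_horner _)).
have k0 x : 0 <= k x.
  by rewrite /k patchE; case: ifPn => // /set_mem xI; exact/ltW/dp.
have mph := @measurable_horner p.
have mhp : measurable_fun setT (h \o horner p) by exact: (measurableT_comp mh mph).
transitivity (\int[dens mu mk k0]_x h p.[x])%E.
  rewrite ge0_integral_dens// [LHS]integral_mkcond; apply: eq_integral => x _.
  by rewrite /k !patchE; case: ifP; rewrite ?mule0.
have mJ : measurable (`]p.[a], p.[b][%classic : set mR) by exact: measurable_itv.
have mj : measurable_fun setT (\1_(`]p.[a], p.[b][%classic : set mR) : mR -> R).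
  exact: measurable_indic.
have j0 x : 0 <= \1_(`]p.[a], p.[b][%classic : set mR) x :> R by [].
have djE A : measurable A -> dens mu mj j0 A = mu (A `&` `]p.[a], p.[b][).
  by move=> mA; rewrite /dens integral_indic// setIC.
transitivity (\int[dens mu mj j0]_y h y)%E; last first.
  rewrite ge0_integral_dens// [RHS]integral_mkcond; apply: eq_integral => x _.
  by rewrite patchE indicE; case: ifP => _; rewrite ?mule1 ?mule0.
rewrite -(ge0_integral_pushforward mph (dens mu mk k0) measurableT)//.
have homo := ltr_hornerW dp.
(* [c] is where p reaches the level t, clamped to a or b when t is out of range. *)
have key t : exists c, [/\ a <= c <= b,
    `]a, b[ `&` [set x | p.[x] < t] = `]a, c[%classic &
    `]-oo, t[ `&` `]p.[a], p.[b][ = `]p.[a], p.[c][%classic].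
  have [ta|at_] := leP t p.[a].
    exists a; split; first by rewrite lexx ltW.
      rewrite [RHS]set_itvoo0//; apply/seteqP; split => x //= [].
      rewrite in_itv/= => /andP[ax xb] xt; have := homo a x.
      by rewrite !in_itv/= lexx !ltW// => /(_ isT isT ax); lra.
    rewrite [RHS]set_itvoo0//; apply/seteqP; split => x //= [].
    by rewrite !in_itv/= => xt /andP[? ?]; lra.
  have [bt|tb] := leP p.[b] t.
    exists b; split; first by rewrite lexx ltW.
      apply/seteqP; split => x /=; first by case.
      move=> xI; split => //; move: xI; rewrite in_itv/= => /andP[ax xb].
      by have := homo x b; rewrite !in_itv/= lexx !ltW// => /(_ isT isT xb); lra.
    apply/seteqP; split => x /=; rewrite !in_itv/=; first by case.
    by move=> /andP[? ?]; split; [lra|apply/andP].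
  have [|c cI] := @poly_ivt R (p - t%:P) a b (ltW ab).
    by rewrite !hornerE; apply/andP; split; lra.
  rewrite rootE !hornerE subr_eq0 => /eqP pc.
  have ac : a < c.
    move: cI => /andP[]; rewrite le_eqVlt => /predU1P[ca|//] _.
    by move: at_; rewrite -pc ca !ltxx.
  have cb : c < b.
    move: cI => /andP[_]; rewrite le_eqVlt => /predU1P[ca|//].
    by move: tb; rewrite -pc ca !ltxx.
  exists c; split; first by rewrite !ltW.
    apply/seteqP; split => x /=; rewrite !in_itv/=.
      move=> [/andP[ax xb] xt]; rewrite ax /= ltNge; apply/negP.
      rewrite le_eqVlt => /predU1P[xc|cx]; first by move: xt; rewrite -xc pc ltxx.
      have := homo c x; rewrite !in_itv/= !ltW// => /(_ isT isT cx); lra.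
    move=> /andP[ax xc]; have xb := lt_trans xc cb; split; first by rewrite ax xb.
    by have := homo x c; rewrite !in_itv/= !ltW// => /(_ isT isT xc); lra.
  rewrite pc; apply/seteqP; split => x /=; rewrite !in_itv/=.
    by move=> [xt /andP[ax xb]]; rewrite ax.
  by move=> /andP[ax xt]; rewrite ax xt; split => //; lra.
apply: eq_measure_integral => // A mA _.
have eqG (t : R) : (pushforward (dens mu mk k0) (horner p) `]-oo, t[ =
    dens mu mj j0 `]-oo, t[)%E.
  have [c [/andP[ac cb] e1 e2]] := key t.
  have pac : p.[a] <= p.[c].
    move: ac; rewrite le_eqVlt => /predU1P[->//|ac].
    by apply/ltW/homo => //; rewrite in_itv/= ?lexx ?(ltW ac) ?(ltW ab) ?cb.
  rewrite djE; last exact: measurable_itv.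
  rewrite /pushforward e2 lebesgue_measure_itv/= lte_fin.
  transitivity ((p.[c] - p.[a])%:E); last first.
    case: ltP => // pca; rewrite (_ : p.[c] = p.[a]) ?subrr//.
    by apply/eqP; rewrite eq_le pca pac.
  rewrite -integral_deriv_horner// /dens integral_mkcond -e1.
  rewrite [RHS]integral_mkcond; apply: eq_integral => x _.
  have -> : horner p @^-1` `]-oo, t[ = [set x | p.[x] < t].
    by apply/seteqP; split => z; rewrite /preimage /= in_itv.
  by rewrite /k !patchE in_setI; case: (x \in `]a, b[%classic);
     case: (x \in [set x | p.[x] < t]).
apply: (@measure_unique _ R mR (@RGenInftyO.G R)
  (fun n => `]-oo, (n%:R : R)[%classic)) => //.
- exact: RGenInftyO.measurableE.
- move=> _ _ [x ->] [y ->]; exists (Num.min x y).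
  apply/seteqP; split => z /=; rewrite !in_itv/= lt_min; first by case=> -> ->.
  by move=> /andP[].
- by move=> n; exists n%:R.
- apply/seteqP; split => // x _; exists (Num.truncn `|x|).+1 => //=.
  rewrite in_itv/= (le_lt_trans (ler_norm x))//.
  exact: truncnS_gt.
- by move=> _ [t ->]; exact: eqG.
- move=> n; rewrite [X in (X < _)%E]eqG djE; last exact: measurable_itv.
  have [c [_ _ ->]] := key n%:R.
  by rewrite lebesgue_measure_itv/=; case: ifP => _; rewrite -?EFinD ltry.
Qed.

(** [K] is the number of preimages in ]a, b[. It is prescribed only off the finite list [Z], so that
    the values at endpoints and critical points, a null set, need no care. *)
Definition area_formula p a b : Prop := exists (K : mR -> R) (Z : seq R),
  [/\ measurable_fun setT K, (forall y, 0 <= K y),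
    (forall h : mR -> \bar R, measurable_fun setT h -> (forall y, 0 <= h y)%E ->
      \int[mu]_(x in `]a, b[) (h p.[x] * `|p^`().[x]|%:E) =
      \int[mu]_y (h y * (K y)%:E))%E &
    forall y, y \notin Z -> exists s : seq R, [/\ uniq s, K y = (size s)%:R &
      forall x, (x \in s) = (x \in `]a, b[) && (p.[x] == y)]].

Lemma area_formula_inc p a b : a < b ->
  {in `]a, b[, forall x, 0 < p^`().[x]} -> area_formula p a b.
Proof.
move=> ab inc.
have homo := ltr_hornerW inc.
  pose J := (`]p.[a], p.[b][%classic : set mR).
  have mJ : measurable J by exact: measurable_itv.
  exists (\1_J : mR -> R), [:: p.[a]; p.[b]]; split => //.
  + move=> h mh h0; rewrite -[RHS]/(\int[mu]_y (h y * (\1_J y)%:E))%E.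
    transitivity (\int[mu]_(y in J) h y)%E; last first.
      rewrite [LHS]integral_mkcond; apply: eq_integral => y _.
      by rewrite patchE indicE; case: ifP => _; rewrite ?mule1 ?mule0.
    rewrite -ge0_substitution_horner//; apply: eq_integral => x /set_mem xI.
    by rewrite ger0_norm//; exact/ltW/inc.
  + move=> y; rewrite !inE negb_or => /andP[ya yb].
    have [/andP[ay yb']|nI] := boolP (p.[a] < y < p.[b]).
      have [|c cI] := @poly_ivt R (p - y%:P) a b (ltW ab).
        by rewrite !hornerE; apply/andP; split; lra.
      rewrite rootE !hornerE subr_eq0 => /eqP pc.
      have cab : c \in `]a, b[.
        move: cI; rewrite !in_itv/= !le_eqVlt => /andP[/predU1P[ca|->] /predU1P[cb|->]]//.
        * by move: ya; rewrite -pc ca eqxx.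
        * by move: ya; rewrite -pc ca eqxx.
        * by move: yb; rewrite -pc cb eqxx.
      exists [:: c]; split => //.
        by rewrite /= indicE mem_set// /J /= in_itv/= ay.
      move=> x; rewrite inE; apply/idP/andP => [/eqP->|[xI /eqP px]].
        by rewrite cab pc eqxx.
      apply/eqP/le_anti/andP; split; rewrite leNgt; apply/negP => h.
      * have := homo c x; rewrite (subset_itv_oo_cc cab) (subset_itv_oo_cc xI) => /(_ isT isT h).
        by rewrite px pc ltxx.
      * have := homo x c; rewrite (subset_itv_oo_cc cab) (subset_itv_oo_cc xI) => /(_ isT isT h).
        by rewrite px pc ltxx.
    exists [::]; split => //.
      by rewrite /= indicE memNset// /J /= in_itv/=; exact/negP.
    move=> x; rewrite in_nil; apply/esym/negbTE/negP => /andP[xI /eqP px].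
    move/negP : nI; apply; rewrite -px; apply/andP; split; apply: homo.
    * by rewrite in_itv/= lexx ltW.
    * exact: subset_itv_oo_cc.
    * by move: xI; rewrite in_itv/= => /andP[].
    * exact: subset_itv_oo_cc.
    * by rewrite in_itv/= lexx ltW.
    * by move: xI; rewrite in_itv/= => /andP[].
Qed.

Lemma area_formulaN p a b : area_formula (- p) a b -> area_formula p a b.
Proof.
move=> [K [Z [mK K0 I C]]].
have mN : measurable_fun setT (-%R : mR -> mR) by exact: oppr_measurable.
have mKN : measurable_fun setT (K \o -%R) by exact: (measurableT_comp mK mN).
exists (K \o -%R), [seq - z | z <- Z]; split => //.
- by move=> y; exact: K0.
- move=> h mh h0; have mhN : measurable_fun setT (h \o -%R) by exact: (measurableT_comp mh mN).
  have := I (h \o -%R) mhN (fun _ => h0 _).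
  under eq_integral do rewrite /= derivN !hornerN opprK normrN.
  move=> ->.
  transitivity (\int[pushforward mu (-%R : mR -> mR)]_y (h y * (K (- y))%:E))%E.
    rewrite (ge0_integral_pushforward mN mu measurableT).
    + by rewrite preimage_setT; apply: eq_integral => y _ /=; rewrite opprK.
    + apply: emeasurable_funM => //.
      exact: (measurableT_comp (@EFin_measurable R setT) mKN).
    + by move=> y _; rewrite mule_ge0// lee_fin.
  by apply: eq_measure_integral => // A mA _; exact: lebesgue_measureN.
- move=> y yZ; have [|s [us ss ms]] := C (- y).
    by apply: contra yZ => yZ; apply/mapP; exists (- y); rewrite ?opprK.
  by exists s; split => // x; rewrite ms hornerN eqr_opp.
Qed.

Lemma area_formula_mono p a b : a < b ->
  {in `]a, b[, forall x, p^`().[x] != 0} -> area_formula p a b.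
Proof.
move=> ab dp.
pose m := (a + b) / 2.
have mI : m \in `]a, b[ by rewrite in_itv/= /m; apply/andP; split; lra.
have sg x : x \in `]a, b[ -> Num.sg p^`().[x] = Num.sg p^`().[m].
  by move=> xI; apply: (@polyrN0_itv _ `]a, b[) => // y yI; rewrite rootE dp.
have := dp m mI; rewrite neq_lt => /orP[m0|m0].
  apply: area_formulaN; apply: area_formula_inc => // x xI.
  by rewrite derivN hornerN oppr_gt0 -sgr_lt0 sg// sgr_lt0.
by apply: area_formula_inc => // x xI; rewrite -sgr_gt0 sg// sgr_gt0.
Qed.

(** Multiplicities add. The value at c joins the exceptional list, since c lies in neither half. *)
Lemma area_formula_cat p a c b : a < c -> c < b ->
  area_formula p a c -> area_formula p c b -> area_formula p a b.
Proof.
(* In this proof [quad_exh] is the multiplicity function of the left half and [itv_int] its counting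
   clause. *)
move=> ac cb [quad_exh [Z1 [mK1 K10 I1 itv_int]]] [K2 [Z2 [mK2 K20 I2 C2]]].
exists (quad_exh \+ K2), (p.[c] :: Z1 ++ Z2); split.
- exact: measurable_funD.
- by move=> y /=; rewrite addr_ge0.
- move=> h mh h0.
  have mhp : measurable_fun setT (fun x : mR => h p.[x] * `|p^`().[x]|%:E)%E.
    apply: emeasurable_funM; first exact: (measurableT_comp mh (measurable_horner p)).
    apply: (measurableT_comp (@EFin_measurable R setT)).
    apply: (measurableT_comp (@normr_measurable R setT)).
    exact: measurable_horner.
  have hp0 x : (0 <= h p.[x] * `|p^`().[x]|%:E)%E by rewrite mule_ge0// lee_fin.
  have -> : (\int[mu]_(x in `]a, b[) (h p.[x] * `|p^`().[x]|%:E) =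
     \int[mu]_(x in `]a, c]) (h p.[x] * `|p^`().[x]|%:E) +
     \int[mu]_(x in `]c, b[) (h p.[x] * `|p^`().[x]|%:E))%E.
    rewrite -ge0_integral_setU.
    - by rewrite (@itv_bndbnd_setU _ _ (BRight a) (BRight c) (BLeft b))// ?bnd_simp// ?ltW.
    - exact: measurable_itv.
    - exact: measurable_itv.
    - exact: measurable_funTS.
    - by move=> x _; exact: hp0.
    - apply/disj_setPRL => x /=; rewrite !in_itv/= => /andP[cx _].
      by move=> /andP[_ xc]; lra.
  rewrite -(integral_itv_bndo_bndc (a := BRight a)); last exact: measurable_funTS.
  rewrite I1// I2// -ge0_integralD//.
  - by apply: eq_integral => y _; rewrite /= EFinD ge0_muleDr ?lee_fin.
  - by move=> y _; rewrite mule_ge0// lee_fin.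
  - by apply: emeasurable_funM => //; exact: (measurableT_comp (@EFin_measurable R setT)).
  - by move=> y _; rewrite mule_ge0// lee_fin.
  - by apply: emeasurable_funM => //; exact: (measurableT_comp (@EFin_measurable R setT)).
- move=> y; rewrite inE mem_cat !negb_or => /and3P[yc y1 y2].
  have [s1 [u1 e1 m1]] := itv_int _ y1; have [s2 [u2 e2 m2]] := C2 _ y2.
  exists (s1 ++ s2); split.
  + rewrite cat_uniq u1 u2 andbT /=; apply/hasPn => x; rewrite m1 m2 !in_itv/=.
    by move=> /andP[/andP[cx _] _]; apply/negP => /andP[/andP[_ xc] _]; lra.
  + by rewrite /= e1 e2 size_cat natrD.
  + move=> x; rewrite mem_cat m1 m2 -andb_orl !in_itv/=.
    have [->|xc] := eqVneq x c; first by rewrite eq_sym (negbTE yc) !andbF.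
    congr (_ && _); apply/orP/andP => [[|]/andP[? ?]|[ax xb]].
    * by split=> //; lra.
    * by split=> //; lra.
    * by move: xc; rewrite neq_lt => /orP[|] h; [left|right]; apply/andP.
Qed.

(** The interval is cut at the zeros of p', between which p is strictly monotone. The induction is
    on the length of a list containing the critical points of the current interval. *)
Lemma area_formulaP p a b : a < b -> p^`() != 0 -> area_formula p a b.
Proof.
move=> ab dp0.
suff main n (L : seq R) a' b' : (size L <= n)%N -> a' < b' ->
    {in `]a', b'[, forall x, root p^`() x -> x \in L} -> area_formula p a' b'.
  apply: (main _ (roots p^`() a b) a b (leqnn _) ab) => x xI rx.
  by rewrite in_roots rx xI.
elim: n L a' b' => [|n IH] L a' b' sL ab' hL.
  apply: area_formula_mono => // x xI; rewrite -rootE; apply/negP => /(hL x xI).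
  by move: sL; case: L {hL}.
have [/hasP[c cL cI]|/hasPn nL] := boolP (has [in `]a', b'[] L); last first.
  apply: area_formula_mono => // x xI; rewrite -rootE; apply/negP => /(hL x xI) xL.
  by have := nL x xL; rewrite xI.
have /andP[ac cb] : a' < c < b' by move: cI; rewrite in_itv.
have sr : (size (rem c L) <= n)%N by rewrite size_rem// -ltnS prednK//; move: cL; case: (L).
apply: (area_formula_cat ac cb); apply: (IH (rem c L)) => // x xI rx.
- have xc : x != c by move: xI; rewrite in_itv/= => /andP[_ /lt_eqF->].
  have : x \in L by apply: hL rx; move: xI; rewrite !in_itv/= => /andP[-> xc']; exact: lt_trans cb.
  by rewrite (perm_mem (perm_to_rem cL)) inE (negbTE xc).
- have xc : x != c by move: xI; rewrite in_itv/= => /andP[/gt_eqF->].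
  have : x \in L by apply: hL rx; move: xI; rewrite !in_itv/= => /andP[cx ->];
    rewrite andbT; exact: lt_trans cx.
  by rewrite (perm_mem (perm_to_rem cL)) inE (negbTE xc).
Qed.

(** Only fibres over points where [h] is nonzero must be counted, and finitely many values may be
    left out. *)
Lemma area_count p a b (n : nat) (Z : seq R) (h : mR -> \bar R) : a < b -> p^`() != 0 ->
  measurable_fun setT h -> (forall y, 0 <= h y)%E ->
  (forall y, y \notin Z -> h y != 0%E -> exists s : seq R, [/\ uniq s, size s = n &
      forall x, (x \in s) = (x \in `]a, b[) && (p.[x] == y)]) ->
  (\int[mu]_(x in `]a, b[) (h p.[x] * `|p^`().[x]|%:E) = n%:R%:E * \int[mu]_y h y)%E.
Proof.
move=> ab dp mh h0 hn; have [K [Z' [mK K0 I C]]] := area_formulaP ab dp.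
rewrite I// -ge0_integralZl// ?lee_fin//.
apply: ae_eq_integral => //.
- by apply: emeasurable_funM => //; exact: (measurableT_comp (@EFin_measurable R setT)).
- by apply: emeasurable_funM => //; exact: measurable_cst.
exists [set` Z ++ Z']; split.
- by apply: (@countable_measurable _ mR); [exact: measurable_set1|exact/finite_set_countable/finite_seq].
- by apply: countable_lebesgue_measure0; exact/finite_set_countable/finite_seq.
move=> y /= hy; apply/negPn/negP => yZ; apply: hy => _.
move: yZ; rewrite mem_cat negb_or => /andP[yZ yZ'].
have [->|hy0] := eqVneq (h y) 0%E; first by rewrite mul0e mule0.
have [s [us ss ms]] := hn y yZ hy0; have [s' [us' -> ms']] := C y yZ'.
rewrite muleC (_ : size s' = n)// -ss; apply/perm_size/uniq_perm => // x.
by rewrite ms ms'.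
Qed.

End area.

(** * Splitting off a real root *)

Section monic_tuple.
Context {R : realType}.
Local Notation mR := (measurableTypeR R).

Lemma coef_monic_of d (a : d.-tuple R) j :
  (monic_of a)`_j = if (j <= d)%N then nth 0 (1 :: a) (d - j) else 0.
Proof.
rewrite /monic_of coefD coefXn coef_sum.
under eq_bigr do rewrite coefZ coefXn.
have [jd|dj] := leqP j d; last first.
  rewrite gtn_eqF// big1 ?addr0// => i _.
  by rewrite (_ : (j == _) = false) ?mulr0//; lia.
have [->|jd'] := eqVneq j d.
  rewrite subnn /= big1 ?addr0// => i _.
  by rewrite (_ : (d == _) = false) ?mulr0//; have := ltn_ord i; lia.
have lt : (d - j.+1 < d)%N by lia.
rewrite add0r (bigD1 (Ordinal lt))//= big1 ?addr0.
  rewrite (_ : (j == _) = true); last by apply/eqP; lia.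
  by rewrite mulr1 (tnth_nth 0) /= (_ : (d - j)%N = (d - j.+1).+1); last lia.
move=> i /eqP ij; rewrite (_ : (j == _) = false) ?mulr0//.
apply/eqP => h; apply: ij; apply/val_inj => /=; have := ltn_ord i; lia.
Qed.

Lemma monic_of_inj d : injective (@monic_of R d).
Proof.
move=> a b ab; apply: eq_from_tnth => i.
have := congr1 (fun p : {poly R} => p`_(d - i.+1)) ab.
rewrite !coef_monic_of leq_subr subKn; last exact: ltn_ord.
by rewrite !(tnth_nth 0).
Qed.

Lemma monic_of_monic d (a : d.-tuple R) : monic_of a \is monic.
Proof.
have sz : size (monic_of a) = d.+1.
  apply/eqP; rewrite eqn_leq; apply/andP; split.
    by apply/leq_sizeP => j dj; rewrite coef_monic_of leqNgt dj.
  rewrite ltnNge; apply/negP => h; have := coef_monic_of a d.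
  by rewrite nth_default// leqnn subnn /= => /eqP; rewrite eq_sym oner_eq0.
by rewrite monicE lead_coefE sz /= coef_monic_of leqnn subnn.
Qed.

Lemma size_monic_of d (a : d.-tuple R) : size (monic_of a) = d.+1.
Proof.
apply/eqP; rewrite eqn_leq; apply/andP; split.
  by apply/leq_sizeP => j dj; rewrite coef_monic_of leqNgt dj.
rewrite ltnNge; apply/negP => h; have := coef_monic_of a d.
by rewrite nth_default// leqnn subnn /= => /eqP; rewrite eq_sym oner_eq0.
Qed.

Lemma monic_of_surj d (p : {poly R}) : p \is monic -> size p = d.+1 ->
  exists a : d.-tuple R, monic_of a = p.
Proof.
move=> pm sp; pose a := [tuple p`_(d - i.+1) | i < d].
have aE i : tnth a i = p`_(d - i.+1) by rewrite tnth_mktuple.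
clearbody a; exists a; apply/polyP => j.
rewrite coef_monic_of; case: leqP => jd; last by rewrite nth_default// sp.
case E : (d - j)%N => [|m] /=.
  have -> : j = d by lia.
  by move: pm; rewrite monicE lead_coefE sp => /eqP.
have md : (m < d)%N by lia.
rewrite -[m]/(nat_of_ord (Ordinal md)) -tnth_nth aE /=.
by congr (p`_ _); lia.
Qed.

(** Multiplication by X - x on coefficients: [1 :: p.2] supplies the leading coefficient, and the
    default 0 of [nth] the missing entry at i = N. *)
Definition tmulX N (p : mR * N.-tuple mR) : N.+1.-tuple mR :=
  [tuple (nth 0 p.2 i - p.1 * nth 0 (1 :: p.2) i : R) | i < N.+1].

Lemma nth_tmulX N (p : mR * N.-tuple mR) i : (i < N.+1)%N ->
  nth 0 (tmulX p) i = nth 0 p.2 i - p.1 * nth 0 (1 :: p.2) i :> R.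
Proof.
by move=> iN; rewrite -[i in LHS]/(nat_of_ord (Ordinal iN)) -tnth_nth tnth_mktuple.
Qed.

Lemma monic_of_tmulX N (x : R) (q : N.-tuple R) :
  monic_of (tmulX (x, q)) = ('X - x%:P) * monic_of q.
Proof.
apply/polyP => j; rewrite mulrBl coefB coefXM mul_polyC coefZ !coef_monic_of.
case: leqP => jN; last first.
  rewrite (_ : (j == 0)%N = false); last by lia.
  rewrite (_ : (j.-1 <= N)%N = false); last by lia.
  by rewrite leqNgt ltnW// mulr0 subr0.
have [j0|j0] := eqVneq j 0%N.
  by rewrite j0 !subn0 [LHS]nth_tmulX// [nth 0 q N]nth_default ?size_tuple.
rewrite (_ : (j.-1 <= N)%N = true); last by lia.
case: leqP => jN'.
  rewrite subSn// [LHS]nth_tmulX; last by lia.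
  by rewrite (_ : (N - j.-1)%N = (N - j).+1)//; lia.
have -> : j = N.+1 by lia.
by rewrite subnn /= subnn /= mulr0 subr0.
Qed.

Lemma monic_of_tins N (y : R) (t : N.-tuple R) :
  monic_of (tins N ((y : mR), t)) = 'X * monic_of t + y%:P.
Proof.
apply/polyP => j; rewrite [in RHS]coefD coefXM coefC !coef_monic_of.
have nt i : (i < N.+1)%N -> nth 0 (tins N (y : mR, t)) i =
    if (i < N)%N then nth 0 t i else y.
  move=> iN; rewrite -[i in LHS]/(nat_of_ord (Ordinal iN)) -tnth_nth tnth_mktuple /=.
  by case: ltngtP => //; lia.
case: leqP => jN; last first.
  rewrite (_ : (j == 0)%N = false); last by lia.
  by rewrite (_ : (j.-1 <= N)%N = false) ?addr0//; lia.
have [->|j0] := eqVneq j 0%N; first by rewrite subn0 /= nt// ltnn add0r.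
rewrite addr0 (_ : (j.-1 <= N)%N = true); last by lia.
case E : (N.+1 - j)%N => [|m].
  by rewrite (_ : (N - j.-1)%N = 0%N)//; lia.
rewrite (_ : (N - j.-1)%N = m.+1) /=; last by lia.
by rewrite nt; [case: ltnP => //; lia|lia].
Qed.

Lemma nth_thorner N (c x : R) (t : N.-tuple R) i : (i < N)%N ->
  nth 0 (thorner c x t) i = nth 0 t i + x * nth 0 (c :: thorner c x t) i.
Proof.
elim: N c t i => // N IH c t [|i] iN; first by rewrite /= /thead (tnth_nth 0).
by rewrite [LHS]/= IH//= nth_behead.
Qed.

(** Its value at x is the constant term y for which x is a root of X * [monic_of t] + y. The fibre
    over y is thus the set of real roots of that polynomial. *)
Definition tphi N (t : N.-tuple R) : {poly R} := - ('X * monic_of t).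

Lemma tmulX_thorner N (x : R) (t : N.-tuple R) :
  tmulX (x, thorner 1 x t) = tins N ((tphi t).[x] : mR, t).
Proof.
have key : tmulX (x, thorner 1 x t) =
    tins N ((- x * nth 0 (1 :: thorner 1 x t) N : R) : mR, t).
  apply: eq_from_tnth => i; rewrite [RHS]tnth_mktuple (tnth_nth 0) nth_tmulX//=.
  case: ltngtP => [iN|Ni|->].
  - by rewrite nth_thorner// addrK.
  - by have := ltn_ord i; lia.
  - by rewrite nth_default ?size_tuple// sub0r mulNr.
have := congr1 (fun a => (monic_of a).[x]) key.
rewrite monic_of_tmulX monic_of_tins hornerM !hornerXsubC subrr mul0r hornerD hornerC.
rewrite key => /eqP; rewrite eq_sym addrC addr_eq0 => /eqP ->.
by rewrite /tphi hornerN.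
Qed.

(** The Jacobian for trading the constant term for a root: the derivative of (X - x) q at x is
    q(x). *)
Lemma deriv_tphi N (x : R) (t : N.-tuple R) :
  (tphi t)^`().[x] = - (monic_of (thorner 1 x t)).[x].
Proof.
have := congr1 (fun a => (monic_of a)^`().[x]) (tmulX_thorner x t).
rewrite monic_of_tmulX monic_of_tins derivM derivXsubC mul1r (derivD ('X * _)) derivC addr0.
rewrite (hornerD (monic_of (thorner _ _ _))) hornerM hornerXsubC subrr mul0r addr0 => ->.
by rewrite /tphi derivN hornerN.
Qed.

Lemma measurable_fun_sum_ord d (T : measurableType d) n (f : 'I_n -> T -> R) :
  (forall i, measurable_fun setT (f i)) ->
  measurable_fun setT (fun x => \sum_(i < n) f i x).
Proof. by move=> mf; apply: measurable_sum. Qed.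

Lemma measurable_monic_eval N :
  measurable_fun setT (fun p : mR * N.-tuple mR => (monic_of p.2).[p.1] : R).
Proof.
rewrite (_ : (fun _ => _) = fun p : mR * N.-tuple mR =>
    p.1 ^+ N + \sum_(i < N) tnth p.2 i * p.1 ^+ (N - i.+1)); last first.
  apply/funext => p; rewrite /monic_of hornerD hornerXn horner_sum; congr (_ + _).
  by apply: eq_bigr => i _; rewrite hornerZ hornerXn.
have m1 : measurable_fun setT (fun p : mR * N.-tuple mR => p.1 : R) by exact: measurable_fst.
apply: measurable_funD; first exact: measurable_funX.
apply: measurable_fun_sum_ord => i; apply: measurable_funM; last exact: measurable_funX.
exact: (measurableT_comp (measurable_tnth i) measurable_snd).
Qed.

Lemma measurable_tmulX N : measurable_fun setT (@tmulX N).
Proof.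
apply/measurable_fun_tnthP => i.
rewrite (_ : _ \o _ = fun p : mR * N.-tuple mR =>
    (nth 0 p.2 i - p.1 * nth 0 (1 :: p.2) i : R)); last first.
  by apply/funext => p; rewrite /= tnth_mktuple.
have m1 : measurable_fun setT (fun p : mR * N.-tuple mR => p.1 : R) by exact: measurable_fst.
have mn j : measurable_fun setT (fun p : mR * N.-tuple mR => nth 0 p.2 j : R).
  exact: (measurableT_comp (@measurable_nth_tuple R N j) measurable_snd).
apply: (@measurable_funB _ _ R) => //; apply: measurable_funM => //.
by case: (nat_of_ord i) => [|j]; [exact: measurable_cst|exact: mn].
Qed.

End monic_tuple.

(** * Trading the constant term for a real root *)

Section peel.
Context {R : realType}.
Local Notation mR := (measurableTypeR R).
Local Notation mu := (@lebesgue_measure R).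

Definition Eset k (S : set (k.-tuple R)) n : set ((n + k).-tuple R) :=
  [set a | exists (c : k.-tuple R) (xs : n.-tuple R),
     [/\ S c, {in xs, forall x, x \in `](-1 : R), 1[} &
        monic_of a = \prod_(x <- xs) ('X - x%:P) * monic_of c]].

Arguments Eset {k} S n.

Lemma not_uniq_root_deriv (s : seq R) : ~~ uniq s ->
  exists2 x, x \in s & root (\prod_(y <- s) ('X - y%:P))^`() x.
Proof.
elim: s => //= a s IH; rewrite negb_and negbK big_cons.
have [as_ _|as_ /= /IH[x xs rx]] := boolP (a \in s).
  exists a; first by rewrite inE eqxx.
  rewrite rootE derivM derivXsubC mul1r hornerD hornerM hornerXsubC subrr mul0r addr0.
  by rewrite -rootE root_prod_XsubC.
exists x; first by rewrite inE xs orbT.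
rewrite rootE derivM derivXsubC mul1r hornerD hornerM (rootP rx) mulr0 addr0.
by rewrite -rootE root_prod_XsubC.
Qed.

Lemma Eset_tmulX k (S : set (k.-tuple R)) n (x : R) (q : (n + k).-tuple R) :
  (forall c, S c -> forall z, ~~ root (monic_of c) z) -> x \in `](-1 : R), 1[ ->
  Eset S n.+1 (tmulX (x, q)) <-> Eset S n q.
Proof.
move=> Sroot xI; split=> [[c [xs [Sc xsI]]]|[c [xs [Sc xsI e]]]]; last first.
  exists c, [tuple of x :: xs]; split => //.
    by move=> z; rewrite inE => /predU1P[->//|]; exact: xsI.
  by rewrite [LHS]monic_of_tmulX big_cons -mulrA e.
rewrite [monic_of _]monic_of_tmulX => e.
have xxs : x \in xs.
  have : root (\prod_(y <- xs) ('X - y%:P) * monic_of c) x by rewrite -e rootM root_XsubC eqxx.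
  by rewrite rootM (negbTE (Sroot c Sc x)) orbF root_prod_XsubC.
have srem : size (rem x xs) == n by rewrite size_rem// size_tuple.
exists c, (Tuple srem); split => //.
  by move=> z /mem_rem; exact: xsI.
have X0 : 'X - x%:P != 0 :> {poly R} by rewrite polyXsubC_eq0.
apply: (mulfI X0); rewrite e mulrA; congr (_ * _).
by rewrite (perm_big _ (perm_to_rem xxs)) big_cons.
Qed.

(** With the other coefficients t fixed, a polynomial of [Eset S n.+1] with simple real roots comes
    from exactly n + 1 points x of ]-1, 1[, because its core has no real root. [area_count] thus
    replaces the constant term by x; then, for fixed x, the shear [thorner] replaces t by the
    quotient q. *)
Lemma peel_root k (S : set (k.-tuple R)) n (H : (n.+1 + k).-tuple mR -> \bar R) :
  (forall c, S c -> forall z, ~~ root (monic_of c) z) ->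
  measurable (Eset S n.+1 : set ((n.+1 + k).-tuple mR)) ->
  measurable_fun setT H -> (forall a, 0 <= H a)%E ->
  (n.+1%:R%:E * \int[lamT (n.+1 + k)]_a (H a * (\1_(Eset S n.+1) a)%:E) =
   \int[mu]_(x in `](-1)%R, 1%R[) \int[lamT (n + k)]_q
     (H (tmulX (x, q)) * `|(monic_of q).[x]|%:E * (\1_(Eset S n) q)%:E))%E.
Proof.
move=> Sroot mE mH H0; set N := (n + k)%N.
pose f (a : N.+1.-tuple mR) := (H a * (\1_(Eset S n.+1) a)%:E)%E.
have mf : measurable_fun setT f.
  apply: emeasurable_funM => //.
  apply: (measurableT_comp (@EFin_measurable R setT)); exact: measurable_indic.
have f0 a : (0 <= f a)%E by rewrite mule_ge0// lee_fin.
have mft : measurable_fun setT (f \o @tins R N N).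
  exact: (measurableT_comp mf (@measurable_tins R N N)).
have mI : measurable (`](-1)%R, 1%R[%classic : set mR) by exact: measurable_itv.
(* [F] is the integrand in (x, t), with t the non-constant coefficients, and [G] the same integrand
   in (x, q), with q the quotient by X - x. *)
pose F (p : mR * N.-tuple mR) := ((f (tins N ((tphi p.2).[p.1] : mR, p.2)) *
   `|(tphi p.2)^`().[p.1]|%:E) * (\1_(`](-1)%R, 1%R[%classic : set mR) p.1)%:E)%E.
pose G (p : mR * N.-tuple mR) := (f (tmulX p) * `|(monic_of p.2).[p.1]|%:E *
  (\1_(`](-1)%R, 1%R[%classic : set mR) p.1)%:E)%E.
have G0 p : (0 <= G p)%E by rewrite !mule_ge0// lee_fin.
have FG p : F p = G (p.1, thorner 1 p.1 p.2).
  by rewrite /F /G /= [tmulX _]tmulX_thorner deriv_tphi normrN.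
have mi1 : measurable_fun setT (fun p : mR * N.-tuple mR =>
    (\1_(`](-1)%R, 1%R[%classic : set mR) p.1)%:E : \bar R).
  apply: (measurableT_comp (@EFin_measurable R setT)).
  have mi : measurable_fun setT (\1_(`](-1)%R, 1%R[%classic : set mR) : mR -> R).
    exact: measurable_indic.
  exact: (measurableT_comp mi measurable_fst).
have mG : measurable_fun setT G.
  apply: emeasurable_funM => //; apply: emeasurable_funM.
    exact: (measurableT_comp mf (@measurable_tmulX R N)).
  apply: (measurableT_comp (@EFin_measurable R setT)).
  apply: (measurableT_comp (@normr_measurable R setT)).
  exact: measurable_monic_eval.
have mF : measurable_fun setT F.
  rewrite (_ : F = G \o (fun p : mR * N.-tuple mR => (p.1, thorner 1 p.1 p.2))).
    apply: (measurableT_comp mG); apply: measurable_fun_pair => //.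
    apply: (measurableT_comp (@measurable_thorner R N)
       (g := fun p : mR * N.-tuple mR => (((1 : R) : mR, p.1), p.2))).
    by apply: measurable_fun_pair => //; apply: measurable_fun_pair => //; exact: measurable_cst.
  by apply/funext => p; exact: FG.
have F0 p : (0 <= F p)%E by rewrite FG.
rewrite (ge0_integral_tins (leqnn N) mf f0).
rewrite (@fubini_tonelli _ _ _ _ R mu (lamT N) (f \o @tins R N N) mft (fun _ => f0 _)).
rewrite -ge0_integralZl//; last 2 first.
- apply: (@measurable_fun_fubini_tonelli_G _ _ _ _ R mu (f \o @tins R N N)) => //.
  by move=> p; exact: f0.
- by move=> t _; apply: integral_ge0 => y _; exact: f0.
transitivity (\int[lamT N]_t \int[mu]_x F (x, t))%E.
  apply: eq_integral => t _.
  have dphi : (tphi t)^`() != 0.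
    rewrite /tphi derivN oppr_eq0; apply/negP => /eqP.
    move=> /(congr1 (fun p : {poly R} => p`_N)).
    rewrite coef_deriv coefXM /= coef_monic_of leqnn subnn /= coef0 => /eqP.
    by rewrite pnatr_eq0.
  have m1 : -1 < 1 :> R by lra.
  have mht : measurable_fun setT (fun y : mR => f (tins N (y, t))).
    exact: (measurable_fun_pair1 t mft).
  have := @area_count R (tphi t) (-1) 1 n.+1
    [seq (tphi t).[c] | c <- roots (tphi t)^`() (-1) 1] (fun y => f (tins N (y, t)))
    m1 dphi mht (fun _ => f0 _).
  move=> <-; first by rewrite integral_mkcond; apply: eq_integral => x _;
    rewrite patchE /F /= indicE; case: ifP => _; rewrite ?mule1 ?mule0.
  move=> y yZ hy.
  have [c [xs [Sc xsI e]]] : Eset S n.+1 (tins N (y, t)).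
    apply: contrapT => nE; move/eqP: hy; apply; rewrite /f indicE.
    by rewrite memNset// mule0.
  rewrite [LHS](monic_of_tins y t) in e.
  have ry x : (tphi t).[x] = y <-> root ('X * monic_of t + y%:P) x.
    rewrite rootE hornerD hornerC /tphi hornerN; split => [<-|/eqP h]; first by rewrite subrr.
    by apply/eqP; rewrite eq_sym -subr_eq0 opprK addrC; apply/eqP.
  exists xs; split; last 2 first.
  - by rewrite size_tuple.
  - move=> x; apply/idP/andP => [xxs|[xI /eqP/ry]].
      split; first exact: xsI.
      by apply/eqP/ry; rewrite e rootM root_prod_XsubC xxs.
    by rewrite e rootM (negbTE (Sroot c Sc x)) orbF root_prod_XsubC.
  (* A repeated root is a critical point of [tphi t], which would make y one of the exceptional
     values. *)
  apply/negPn/negP => nu.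
  have [x xxs rx] := not_uniq_root_deriv nu.
  move/negP: yZ; apply; apply/mapP; exists x; last first.
    by apply/esym/ry; rewrite e rootM root_prod_XsubC xxs.
  rewrite in_roots dphi xsI// andbT rootE /tphi derivN hornerN oppr_eq0.
  have := congr1 (fun p : {poly R} => p^`().[x]) e.
  rewrite (derivD ('X * _)) derivC addr0 => ->; rewrite derivM hornerD !hornerM.
  have Px0 : (\prod_(y <- xs) ('X - y%:P)).[x] = 0.
    by apply/rootP; rewrite root_prod_XsubC.
  by rewrite (rootP rx) Px0 !mul0r addr0 eqxx.
rewrite -(@fubini_tonelli _ _ _ _ R mu (lamT N) F mF F0).
rewrite [RHS]integral_mkcond; apply: eq_integral => x _.
rewrite patchE; case: ifPn => [/set_mem xI|xI]; last first.
  rewrite integral0_eq// => t _; rewrite /F /= indicE (negbTE xI) mule0//.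
transitivity (\int[lamT N]_t G (x, thorner 1 x t))%E.
  by apply: eq_integral => t _; rewrite FG.
rewrite (@ge0_integral_thorner R N 1 x (fun q => G (x, q)))//; last first.
  exact: (measurable_fun_pair2 x mG).
have i1 : \1_(`](-1)%R, 1%R[%classic : set mR) x = 1 :> R by rewrite indicE mem_set.
apply: eq_integral => q _; rewrite /G /f /= i1 mule1.
rewrite -!muleA; congr (_ * _)%E; rewrite muleC; congr (_ * _)%E.
have h := @Eset_tmulX k S n x q Sroot xI.
by rewrite !indicE; congr ((nat_of_bool _)%:R%:E); apply/idP/idP => /set_mem/h/mem_set.
Qed.

End peel.
Arguments Eset {R k} S n.

(** * Measurability of sets of polynomials *)

Section closed_measurable_tuple.
Context {R : realType}.
Local Notation mR := (measurableTypeR R).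

Definition rvt n (t : n.-tuple R) : 'rV[R]_n := \row_i tnth t i.
Definition tvr n (v : 'rV[R]_n) : n.-tuple R := [tuple v ord0 i | i < n].

Lemma rvtK n : cancel (@rvt n) (@tvr n).
Proof. by move=> t; apply: eq_from_tnth => i; rewrite tnth_mktuple mxE. Qed.

Lemma tvrK n : cancel (@tvr n) (@rvt n).
Proof. by move=> v; apply/rowP => i; rewrite mxE tnth_mktuple. Qed.

(** Tuples carry the product sigma-algebra, row vectors the topology. An open set is the union of
    the countably many rational cubes, of radii 1/(m+1), that it contains. *)
Lemma open_measurable_tuple n (O : set 'rV[R]_n) : open O ->
  measurable ([set t | O (rvt t)] : set (n.-tuple mR)).
Proof.
move=> oO.
pose c (r : n.-tuple rat * nat) : 'rV[R]_n := \row_i ratr (tnth r.1 i).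
pose e (r : n.-tuple rat * nat) : R := r.2.+1%:R^-1.
have e0 r : 0 < e r by rewrite /e invr_gt0 ltr0n.
pose B (r : n.-tuple rat * nat) : set (n.-tuple mR) :=
  [set t | ball (c r) (e r) `<=` O /\ forall i, ball (ratr (tnth r.1 i) : R) (e r) (tnth t i : R)].
have mB r : measurable (B r).
  have [sub|nsub] := pselect (ball (c r) (e r) `<=` O); last first.
    by rewrite (_ : B r = set0)//; apply/seteqP; split => // t [].
  rewrite (_ : B r = \bigcap_(i in [set: 'I_n])
      ((@tnth _ mR ^~ i) @^-1` (ball (ratr (tnth r.1 i) : R) (e r)))); last first.
    by apply/seteqP; split => [t [_ h] i _|t h]; [exact: h|split => // i; exact: h].
  apply: fin_bigcap_measurable => // i _; rewrite -[X in measurable X]setTI.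
  by apply: measurable_tnth => //; exact: measurable_ball.
rewrite (_ : [set t | _] = \bigcup_r B r); last first.
  apply/seteqP; split => [t /= Ot|t [r _ [sub h]]]; last first.
    by apply: sub; split => // i j; rewrite !mxE.
  have /nbhs_ballP[d /= d0 dO] : nbhs (rvt t) O by exact: open_nbhs_nbhs.
  (* Half the radius: a cube whose rational centre is within 1/(m+1) of the point then stays in the
     ball of radius d. *)
  have [m md] : exists m : nat, m.+1%:R^-1 < d / 2.
    have := near_infty_natSinv_lt (PosNum (divr_gt0 d0 (ltr0n R 2))).
    by case=> m _ /(_ m (leqnn m)) /= h; exists m.
  have hq i : exists q : rat, ball (ratr q : R) (m.+1%:R^-1) (tnth t i : R).
    have lt : (tnth t i : R) < (tnth t i : R) + m.+1%:R^-1 by rewrite ltrDl invr_gt0 ltr0n.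
    have [q] := rat_in_itvoo lt.
    rewrite in_itv/= => /andP[q1 q2]; exists q; rewrite -ball_normE /=.
    by rewrite ger0_norm ?subr_ge0 ?(ltW q1)// ltrBlDl.
  have [q hq'] := choice hq.
  exists ([tuple q i | i < n], m) => //; split; last first.
    by move=> i; rewrite /= tnth_mktuple; exact: hq'.
  move=> v [_ hv]; apply: dO; split => // i j.
  have := hv i j; rewrite !mxE /= tnth_mktuple => h1.
  have := hq' j => /ball_sym h2.
  have := ball_triangle h2 h1; apply: le_ball.
  by rewrite /e /= ltW// (splitr d) ltrD.
apply: countable_bigcupT_measurable => //.
Qed.

Lemma closed_measurable_tuple n (C : set 'rV[R]_n) : closed C ->
  measurable ([set t | C (rvt t)] : set (n.-tuple mR)).
Proof.
move=> cC; rewrite -[X in measurable X]setCK; apply: measurableC.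
exact: (@open_measurable_tuple n (~` C) (closed_openC cC)).
Qed.

Lemma continuous_rV (T : topologicalType) n (f : T -> 'rV[R]_n) :
  (forall i, continuous (fun x => f x ord0 i)) -> continuous f.
Proof.
move=> cf x; apply/cvg_ballP => e e0.
have h : \forall y \near x, forall i : 'I_n, ball (f x ord0 i) e (f y ord0 i).
  apply: filter_forall => i; have := cf i x => /cvg_ballP; exact.
near=> y; split => // i j; rewrite ord1.
by move: j; near: y.
Unshelve. all: by end_near. Qed.

Definition rmulX N (p : R * 'rV[R]_N) : 'rV[R]_N.+1 := rvt (tmulX (p.1, tvr p.2)).

Lemma continuous_rmulX N : continuous (@rmulX N).
Proof.
apply: continuous_rV => i.
have cn j : continuous (fun p : R * 'rV[R]_N => nth 0 (tvr p.2) j : R).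
  have [Nj|jN] := leqP N j.
    rewrite (_ : (fun _ => _) = cst 0); first exact: cst_continuous.
    by apply/funext => p; rewrite nth_default// size_tuple.
  rewrite (_ : (fun _ => _) = (fun v : 'rV[R]_N => v ord0 (Ordinal jN)) \o snd).
    move=> p; apply: continuous_comp; first exact: cvg_snd.
    exact: coord_continuous.
  apply/funext => p.
  by rewrite -[j in LHS]/(nat_of_ord (Ordinal jN)) -tnth_nth tnth_mktuple.
rewrite (_ : (fun _ => _) = fun p : R * 'rV[R]_N =>
    nth 0 (tvr p.2) i - p.1 * nth 0 (1 :: tvr p.2) i); last first.
  by apply/funext => p; rewrite /rmulX mxE tnth_mktuple.
move=> p; apply: cvgB; first exact: cn.
apply: cvgM; first exact: cvg_fst.
by case: (nat_of_ord i) => [|j]; [exact: cvg_cst|exact: cn].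
Qed.

Definition tcompact n (A : set (n.-tuple R)) := compact [set v | A (tvr v)].

Lemma tcompact_measurable n (A : set (n.-tuple mR)) : tcompact (A : set (n.-tuple R)) ->
  measurable A.
Proof.
move=> cA; rewrite (_ : A = [set t | [set v | A (tvr v)] (rvt t)]); last first.
  by apply/seteqP; split => t /=; rewrite rvtK.
by apply: closed_measurable_tuple; exact: compact_closed.
Qed.

Lemma tcompact_tmulX N (r : R) (A : set (N.-tuple R)) : tcompact A ->
  tcompact [set a | exists x q, [/\ x \in `[- r, r], A q & a = tmulX (x, q)]].
Proof.
move=> cA.
have := continuous_compact (continuous_subspaceT (@continuous_rmulX N))
   (compact_setX (@segment_compact R (- r) r) cA).
rewrite /tcompact; congr compact; apply/seteqP; split.
  move=> _ [[x v] /= [xI Av] <-]; exists x, (tvr v); split => //.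
  by rewrite /rmulX rvtK.
move=> v /= [x [q [xI Aq e]]]; exists (x, rvt q).
  by split => //=; rewrite rvtK.
by rewrite /rmulX /= rvtK -e tvrK.
Qed.

(** [Eset] is an image, so its measurability is not formal. Exhausting S by the compact sets K m and
    ]-1, 1[ by segments makes it a countable union of continuous images of compact sets; both
    exhaustions increase, so one index serves for both. *)
Lemma measurable_Eset k (S : set (k.-tuple R)) (K : nat -> set (k.-tuple R)) n :
  (forall m, tcompact (K m)) -> {homo K : m p / (m <= p)%N >-> m `<=` p} ->
  S = \bigcup_m K m ->
  measurable (Eset S n : set ((n + k).-tuple mR)).
Proof.
move=> cK ndK SK.
pose r m : R := 1 - m.+1%:R^-1.
have ler m p : (m <= p)%N -> r m <= r p.
  by move=> mp; rewrite /r lerD2l lerN2 lef_pV2 ?posrE ?ltr0n// ler_nat ltnS.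
have r1 m : r m < 1 by rewrite /r ltrBlDr ltrDl invr_gt0 ltr0n.
pose C := fix C n : nat -> set ((n + k).-tuple R) :=
  match n with
  | 0 => fun m => K m
  | n'.+1 => fun m => [set a | exists x q, [/\ x \in `[- r m, r m], C n' m q & a = tmulX (x, q)]]
  end.
have CE n' m a : C n' m a <-> exists (c : k.-tuple R) (xs : n'.-tuple R),
     [/\ K m c, {in xs, forall x, x \in `[- r m, r m]} &
        monic_of a = \prod_(x <- xs) ('X - x%:P) * monic_of c].
  elim: n' a => [|n' IH] a /=.
    split=> [Ka|[c [xs [Kc _]]]].
      by exists a, [tuple]; split => //; rewrite big_nil mul1r.
    by rewrite tuple0 big_nil mul1r => /monic_of_inj ->.
  split=> [[x [q [xI /IH[c [xs [Kc xsI e]]] ->]]]|[c [xs [Kc xsI e]]]].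
    exists c, [tuple of x :: xs]; split => //.
      by move=> z; rewrite inE => /predU1P[->//|]; exact: xsI.
    by rewrite [LHS]monic_of_tmulX big_cons -mulrA e.
  case/tupleP: xs xsI e => x xs xsI; rewrite big_cons -mulrA => e.
  have [q qe] : exists q : (n' + k).-tuple R,
      monic_of q = \prod_(y <- xs) ('X - y%:P) * monic_of c.
    apply: monic_of_surj.
      by rewrite rpredM ?monic_of_monic// rpred_prod// => y _; exact: monicXsubC.
    rewrite size_monicM ?monic_of_monic//; last first.
    - by rewrite monic_neq0// monic_of_monic.
    - by rewrite rpred_prod// => y _; exact: monicXsubC.
    by rewrite size_prod_XsubC size_monic_of size_tuple addSn /= addnS.
  exists x, q; split.
  - by apply: xsI; rewrite inE eqxx.
  - apply/IH; exists c, xs; split => // z zxs; apply: xsI.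
    by rewrite inE zxs orbT.
  - by apply: monic_of_inj; rewrite e monic_of_tmulX qe.
have cC n' m : tcompact (C n' m).
  by elim: n' => [|n' IH] /=; [exact: cK|exact: tcompact_tmulX].
rewrite (_ : Eset S n = \bigcup_m C n m).
  by apply: bigcupT_measurable => m; exact: tcompact_measurable.
apply/seteqP; split => [a [c [xs [Sc xsI e]]]|a [m _ /CE[c [xs [Kc xsI e]]]]]; last first.
  exists c, xs; split => //; first by rewrite SK; exists m.
  move=> x /xsI; rewrite !in_itv/= => /andP[h1 h2].
  by have := r1 m => h; apply/andP; split; lra.
move: Sc; rewrite SK => -[m0 _ Km0].
have [m1 hm1] : exists m, {in xs, forall x, x \in `[- r m, r m]}.
  have {}xsI x : x \in tval xs -> -1 < x < 1 by move=> /xsI; rewrite in_itv.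
  suff [m hm] : exists m, forall x, x \in tval xs -> x \in `[- r m, r m] by exists m.
  elim: (tval xs) xsI => [|x s IH] xsI; first by exists 0%N.
  have [|m hm] := IH; first by move=> z zs; apply: xsI; rewrite inE zs orbT.
  have x1 : 0 < 1 - `|x|.
    have := xsI x; rewrite inE eqxx => /(_ isT) /andP[? ?].
    by rewrite subr_gt0 ltr_norml; apply/andP.
  have [p hp] : exists p : nat, p.+1%:R^-1 < 1 - `|x|.
    have := near_infty_natSinv_lt (PosNum x1).
    by case=> p _ /(_ p (leqnn p)) /= h; exists p.
  exists (maxn m p) => z; rewrite inE => /predU1P[->|zs].
    have h := ler _ _ (leq_maxr m p).
    by rewrite in_itv/= -ler_norml (le_trans _ h)// /r lerBrDr -lerBrDl ltW.
  have h := ler _ _ (leq_maxl m p).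
  by have := hm z zs; rewrite !in_itv/= => /andP[? ?]; apply/andP; split; lra.
exists (maxn m0 m1) => //; apply/CE; exists c, xs; split => //.
  by apply: ndK Km0; exact: leq_maxl.
move=> x /hm1; have h := ler _ _ (leq_maxr m0 m1).
by rewrite !in_itv/= => /andP[? ?]; apply/andP; split; lra.
Qed.

End closed_measurable_tuple.

(** * Root coordinates *)

Section root_space.
Context {R : realType}.
Local Notation mR := (measurableTypeR R).
Local Notation mu := (@lebesgue_measure R).
Local Notation sym_itv := (`](-1)%R, 1%R[%classic : set mR).

Fixpoint tmulXs k n : n.-tuple mR -> k.-tuple mR -> (n + k).-tuple mR :=
  match n with
  | 0 => fun _ c => c
  | m.+1 => fun t c => tmulX (thead t, @tmulXs k m [tuple of behead t] c)
  end.

(** The Jacobian of root coordinates times the indicator of the cube, accumulated root by root as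
    [peel_root] delivers it. *)
Fixpoint rweight k n : n.-tuple mR -> k.-tuple mR -> R :=
  match n with
  | 0 => fun _ _ => 1
  | m.+1 => fun t c => @rweight k m [tuple of behead t] c *
      `|(monic_of (tmulXs [tuple of behead t] c)).[thead t]| * \1_sym_itv (thead t)
  end.

Lemma behead_tcons n (x : mR) (t : n.-tuple mR) : [tuple of behead (tcons (x, t))] = t.
Proof. exact/val_inj. Qed.

Lemma tmulXs_cons k n x (t : n.-tuple mR) (c : k.-tuple mR) :
  tmulXs (tcons (x, t)) c = tmulX (x, tmulXs t c).
Proof.
transitivity (tmulX (x, tmulXs [tuple of behead (tcons (x, t))] c)) => //.
by rewrite behead_tcons.
Qed.

Lemma rweight_cons k n x (t : n.-tuple mR) (c : k.-tuple mR) :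
  rweight (tcons (x, t)) c =
  rweight t c * `|(monic_of (tmulXs t c)).[x]| * \1_sym_itv x.
Proof.
transitivity (rweight [tuple of behead (tcons (x, t))] c *
  `|(monic_of (tmulXs [tuple of behead (tcons (x, t))] c)).[x]| * \1_sym_itv x) => //.
by rewrite behead_tcons.
Qed.

Lemma monic_of_tmulXs k n (t : n.-tuple mR) (c : k.-tuple mR) :
  monic_of (tmulXs t c : (n + k).-tuple R) =
  \prod_(x <- (t : seq R)) ('X - x%:P) * monic_of (c : k.-tuple R).
Proof.
elim: n t => [|n IH] t /=; first by rewrite tuple0 big_nil mul1r.
rewrite monic_of_tmulX IH mulrA; congr (_ * _).
by rewrite [in RHS](tuple_eta t) /= big_cons.
Qed.

Lemma rweight_ge0 k n (t : n.-tuple mR) (c : k.-tuple mR) : 0 <= rweight t c.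
Proof. by elim: n t => //= n IH t; rewrite !mulr_ge0. Qed.

Lemma measurable_tmulXs k n :
  measurable_fun setT (fun p : n.-tuple mR * k.-tuple mR => tmulXs p.1 p.2).
Proof.
elim: n => [|n IH]; first exact: measurable_snd.
have m1 : measurable_fun setT (fst : n.+1.-tuple mR * k.-tuple mR -> _).
  exact: measurable_fst.
apply: (measurableT_comp (@measurable_tmulX R (n + k))
  (g := fun p : n.+1.-tuple mR * k.-tuple mR =>
     (thead p.1, tmulXs [tuple of behead p.1] p.2))).
apply: measurable_fun_pair.
  exact: (measurableT_comp (measurable_tnth _) m1).
apply: (measurableT_comp IH (g := fun p : n.+1.-tuple mR * k.-tuple mR =>
   ([tuple of behead p.1], p.2))).
apply: measurable_fun_pair; last exact: measurable_snd.
exact: (measurableT_comp (@measurable_behead _ _ _) m1).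
Qed.

Lemma measurable_rweight k n :
  measurable_fun setT (fun p : n.-tuple mR * k.-tuple mR => rweight p.1 p.2).
Proof.
elim: n => [|n IH]; first exact: measurable_cst.
have m1 : measurable_fun setT (fst : n.+1.-tuple mR * k.-tuple mR -> _).
  exact: measurable_fst.
have mh : measurable_fun setT (fun p : n.+1.-tuple mR * k.-tuple mR => thead p.1).
  exact: (measurableT_comp (measurable_tnth _) m1).
have mb : measurable_fun setT (fun p : n.+1.-tuple mR * k.-tuple mR =>
   ([tuple of behead p.1], p.2)).
  apply: measurable_fun_pair; last exact: measurable_snd.
  exact: (measurableT_comp (@measurable_behead _ _ _) m1).
have mi : measurable_fun setT (\1_sym_itv : mR -> R).
  by apply: measurable_indic; exact: measurable_itv.
rewrite /=; apply: measurable_funM; last exact: (measurableT_comp mi mh).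
apply: measurable_funM; first exact: (measurableT_comp IH mb).
apply: (measurableT_comp (@normr_measurable R setT)).
apply: (measurableT_comp (@measurable_monic_eval R (n + k))
  (g := fun p : n.+1.-tuple mR * k.-tuple mR =>
     (thead p.1, tmulXs [tuple of behead p.1] p.2))).
apply: measurable_fun_pair => //.
exact: (measurableT_comp (@measurable_tmulXs k n) mb).
Qed.

Local Open Scope ereal_scope.

(** Iterates [peel_root]; n! counts the orderings of the roots. The newly split root comes out as
    the outer variable, so Tonelli moves it inside the integral over the core. *)
Lemma root_formula k (S : set (k.-tuple R)) n (H : (n + k).-tuple mR -> \bar R) :
  (forall c, S c -> forall z, ~~ root (monic_of c) z) ->
  measurable (S : set (k.-tuple mR)) ->
  (forall n, measurable (Eset S n : set ((n + k).-tuple mR))) ->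
  measurable_fun setT H -> (forall a, 0 <= H a) ->
  n`!%:R%:E * \int[lamT (n + k)]_a (H a * (\1_(Eset S n) a)%:E) =
  \int[lamT k]_c ((\1_(S : set (k.-tuple mR)) c)%:E *
    \int[lamT n]_t ((rweight t c)%:E * H (tmulXs t c))).
Proof.
move=> Sroot mS mE; elim: n H => [|n IH] H mH H0.
  rewrite fact0 mul1e; apply: eq_integral => c _.
  rewrite integral_tuple0 /=; last first.
    by rewrite (_ : (fun _ => _) = cst (1 * H c)); [exact: measurable_cst|apply/funext => ?; rewrite mul1e].
  rewrite mul1e muleC; congr (_ * _); rewrite !indicE; congr ((nat_of_bool _)%:R%:E).
  apply/idP/idP => /set_mem h; apply/mem_set.
    by case: h => c' [xs [Sc' _]]; rewrite tuple0 big_nil mul1r => /monic_of_inj ->.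
  by exists c, [tuple]; split => //; rewrite big_nil mul1r.
pose N := (n + k)%N.
pose f (p : mR * k.-tuple mR * n.-tuple mR) := (\1_(S : set (k.-tuple mR)) p.1.2)%:E *
   ((rweight p.2 p.1.2)%:E * (H (tmulX (p.1.1, tmulXs p.2 p.1.2)) *
     `|(monic_of (tmulXs p.2 p.1.2)).[p.1.1]|%:E) * (\1_sym_itv p.1.1)%:E).
have mI : measurable sym_itv by exact: measurable_itv.
have mi : measurable_fun setT (EFin \o \1_sym_itv : mR -> \bar R).
  by apply: (measurableT_comp (@EFin_measurable R setT)); exact: measurable_indic.
have m1 : measurable_fun setT (fst : mR * k.-tuple mR * n.-tuple mR -> _) by exact: measurable_fst.
have m2 : measurable_fun setT (snd : mR * k.-tuple mR * n.-tuple mR -> _) by exact: measurable_snd.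
have m11 : measurable_fun setT (fun p : mR * k.-tuple mR * n.-tuple mR => p.1.1).
  exact: (measurableT_comp measurable_fst m1).
have m12 : measurable_fun setT (fun p : mR * k.-tuple mR * n.-tuple mR => p.1.2).
  exact: (measurableT_comp measurable_snd m1).
have mS1 : measurable_fun setT (EFin \o \1_(S : set (k.-tuple mR)) : _ -> \bar R).
  by apply: (measurableT_comp (@EFin_measurable R setT)); exact: measurable_indic.
have mt : measurable_fun setT (fun p : mR * k.-tuple mR * n.-tuple mR => tmulXs p.2 p.1.2).
  exact: (measurableT_comp (@measurable_tmulXs k n) (measurable_fun_pair m2 m12)).
have mHx : measurable_fun setT (fun p : mR * N.-tuple mR =>
    H (tmulX p) * `|(monic_of p.2).[p.1]|%:E).
  apply: emeasurable_funM; first exact: (measurableT_comp mH (@measurable_tmulX R N)).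
  apply: (measurableT_comp (@EFin_measurable R setT)).
  apply: (measurableT_comp (@normr_measurable R setT)).
  exact: measurable_monic_eval.
have mf : measurable_fun setT f.
  apply: emeasurable_funM; first exact: (measurableT_comp mS1 m12).
  apply: emeasurable_funM; last exact: (measurableT_comp mi m11).
  apply: emeasurable_funM.
    apply: (measurableT_comp (@EFin_measurable R setT)).
    exact: (measurableT_comp (@measurable_rweight k n) (measurable_fun_pair m2 m12)).
  exact: (measurableT_comp mHx (measurable_fun_pair m11 mt)).
have f0 p : 0 <= f p by rewrite !mule_ge0 ?lee_fin ?rweight_ge0.
rewrite factS mulnC natrM EFinM -muleA peel_root//.
pose G (p : mR * N.-tuple mR) := H (tmulX p) * `|(monic_of p.2).[p.1]|%:E * (\1_(Eset S n) p.2)%:E.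
have G0 p : 0 <= G p by rewrite !mule_ge0// lee_fin.
have mG : measurable_fun setT G.
  apply: emeasurable_funM; first exact: mHx.
  apply: (measurableT_comp (@EFin_measurable R setT)).
  have mE1 : measurable_fun setT (\1_(Eset S n : set (N.-tuple mR)) : _ -> R).
    by apply: measurable_indic; exact: mE.
  exact: (measurableT_comp mE1 measurable_snd).
have mGi : measurable_fun setT (fun x : mR => \int[lamT N]_q G (x, q)).
  exact: measurable_integral_lamT.
rewrite -ge0_integralZl//; last 2 first.
- exact: measurable_funTS.
- by move=> x _; apply: integral_ge0 => q _; exact: G0.
transitivity (\int[mu]_x \int[lamT k]_c \int[lamT n]_t f (x, c, t)).
  rewrite integral_mkcond; apply: eq_integral => x _.
  rewrite patchE; case: ifPn => [xI|xI]; last first.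
    rewrite integral0_eq// => c _; rewrite integral0_eq// => t _.
    by rewrite /f /= indicE [\1_sym_itv _]indicE (negbTE xI) !mule0.
  rewrite (IH (fun q => H (tmulX (x, q)) * `|(monic_of q).[x]|%:E)); last 2 first.
  - exact: (measurable_fun_pair2 x mHx).
  - by move=> q; rewrite mule_ge0// lee_fin.
  apply: eq_integral => c _.
  have mV : measurable_fun setT (fun t : n.-tuple mR => (rweight t c)%:E *
      (H (tmulX (x, tmulXs t c)) * `|(monic_of (tmulXs t c)).[x]|%:E)).
    apply: emeasurable_funM.
      apply: (measurableT_comp (@EFin_measurable R setT)).
      exact: (measurable_fun_pair1 c (@measurable_rweight k n)).
    apply: (measurableT_comp mHx (g := fun t => (x, tmulXs t c))).
    apply: measurable_fun_pair; first exact: measurable_cst.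
    exact: (measurable_fun_pair1 c (@measurable_tmulXs k n)).
  rewrite -(ge0_integralZl _ measurableT mV) ?lee_fin//; last first.
    by move=> t _; rewrite !mule_ge0// lee_fin// rweight_ge0.
  apply: eq_integral => t _; rewrite /f /=.
  have -> : \1_sym_itv x = 1%R :> R by rewrite indicE xI.
  by rewrite mule1.
pose F (p : mR * k.-tuple mR) := \int[lamT n]_t f (p, t).
have mF : measurable_fun setT F by exact: measurable_integral_lamT.
have F0 p : 0 <= F p by apply: integral_ge0 => t _; exact: f0.
rewrite (@fubini_tonelli _ _ _ _ R mu (lamT k) F mF F0).
apply: eq_integral => c _; rewrite /F.
have mW : measurable_fun setT (fun t : n.+1.-tuple mR => (rweight t c)%:E * H (tmulXs t c)).
  apply: emeasurable_funM.
    apply: (measurableT_comp (@EFin_measurable R setT)).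
    exact: (measurable_fun_pair1 c (@measurable_rweight k n.+1)).
  apply: (measurableT_comp mH).
  exact: (measurable_fun_pair1 c (@measurable_tmulXs k n.+1)).
have W0 t : 0 <= (rweight t c)%:E * H (tmulXs t c) by rewrite mule_ge0// lee_fin rweight_ge0.
rewrite -(ge0_integralZl _ measurableT mW) ?lee_fin//.
rewrite [RHS](@ge0_integral_tcons R n (fun t => (\1_(S : set (k.-tuple mR)) c)%:E *
   ((rweight t c)%:E * H (tmulXs t c)))); last 2 first.
- by apply: emeasurable_funM => //; exact: measurable_cst.
- by move=> t; rewrite mule_ge0// lee_fin.
apply: eq_integral => x _; apply: eq_integral => t _.
rewrite rweight_cons tmulXs_cons /f.
congr (_ * _); rewrite !EFinM -!muleA; congr (_ * _).
by rewrite [LHS]muleC -!muleA.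
Qed.

End root_space.

(** * The absolute Vandermonde product *)

Section vandermonde_seq.
Variable R : realFieldType.
Implicit Types (s : seq R) (g : {poly R}) (x y w : R).

Fixpoint absD s : R :=
  if s is x :: s' then absD s' * `|\prod_(z <- s') (x - z)| else 1.

Lemma absD_ge0 s : 0 <= absD s.
Proof. by elim: s => //= x s IH; rewrite mulr_ge0. Qed.

Lemma absD_uniq s : (absD s != 0) = uniq s.
Proof.
elim: s => /= [|x s IH]; first by rewrite oner_eq0.
rewrite mulf_eq0 negb_or IH andbC normr_eq0; congr (_ && _).
rewrite prodf_seq_neq0; apply/allP/idP => [h|xs z zs]; last first.
  by apply/implyP => _; rewrite subr_eq0; apply: contraNneq xs => ->.
by apply/negP => /h; rewrite subrr eqxx.
Qed.

Lemma absD_insert s1 s2 x : absD (s1 ++ x :: s2) = absD (x :: s1 ++ s2).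
Proof.
elim: s1 => //= y s1 IH; rewrite IH /= !big_cons !normrM !big_cat /= !normrM.
by rewrite big_cons normrM (distrC x y); ring.
Qed.

Lemma perm_absD s t : perm_eq s t -> absD s = absD t.
Proof.
elim: s t => [|x s IH] t st; first by move: st; rewrite perm_sym => /perm_nilP ->.
have xt : x \in t by rewrite -(perm_mem st) inE eqxx.
have := st; case/splitPr: xt => t1 t2; rewrite absD_insert.
rewrite perm_sym -cat1s perm_catCA cat1s perm_cons perm_sym => st'.
by rewrite /= (IH _ st'); congr (_ * `|_|); exact: perm_big.
Qed.

Definition kap (n : nat) : R := - (1 + (-1) ^+ n) / 2.

Lemma sgn_sum_sorted s y : sorted >%O s ->
  \sum_(x <- s) Num.sg (y - x) * Num.sg (\prod_(z <- s | z != x) (x - z)) =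
  Num.sg (\prod_(z <- s) (y - z)) + kap (size s).
Proof.
elim: s => [_|a s IH /= pas].
  by rewrite !big_nil sgr1 /kap expr0; field.
have sa : all (< a) s.
  by move: pas; rewrite (path_sortedE (rev_trans lt_trans)) => /andP[].
have {}pas := path_sorted pas.
have pos u : a <= u -> Num.sg (\prod_(z <- s) (u - z)) = 1.
  move=> au; apply: gtr0_sg; rewrite big_seq; apply: prodr_gt0 => z zs.
  by rewrite subr_gt0 (lt_le_trans _ au)//; exact: (allP sa).
rewrite big_cons [X in _ * Num.sg X + _](_ : _ = \prod_(z <- s) (a - z)); last first.
  rewrite big_cons eqxx big_seq_cond [RHS]big_seq_cond; apply: eq_bigl => z.
  by case: (boolP (z \in s)) => //= zs; rewrite lt_eqF//; exact: (allP sa).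
rewrite pos// mulr1.
have -> : \sum_(x <- s) Num.sg (y - x) * Num.sg (\prod_(z <- a :: s | z != x) (x - z)) =
   - \sum_(x <- s) Num.sg (y - x) * Num.sg (\prod_(z <- s | z != x) (x - z)).
  rewrite -sumrN big_seq [RHS]big_seq; apply: eq_bigr => x xs.
  have xa : x < a by exact: (allP sa).
  rewrite big_cons gt_eqF// sgrM (ltr0_sg (_ : x - a < 0)) ?subr_lt0//.
  by ring.
rewrite IH// big_cons sgrM /=.
have -> : kap (size s).+1 = - 1 - kap (size s) by rewrite /kap exprS; field.
have [ya|ay] := ltP y a.
  by rewrite (ltr0_sg (_ : y - a < 0)) ?subr_lt0//; ring.
rewrite pos//; ring.
Qed.

Lemma sgn_sum s y : uniq s ->
  \sum_(x <- s) Num.sg (y - x) * Num.sg (\prod_(z <- s | z != x) (x - z)) =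
  Num.sg (\prod_(z <- s) (y - z)) + kap (size s).
Proof.
move=> us; pose t := sort >=%O s.
have st : perm_eq s t by rewrite perm_sym perm_sort.
rewrite (perm_big _ st) (perm_size st) (perm_big _ st (P := xpredT) (F := fun z => y - z)) /=.
rewrite -sgn_sum_sorted; last first.

  have : sorted >=%O t by apply: sort_sorted => x z; exact: le_total.
  have : uniq t by rewrite -(perm_uniq st).
  elim: t {st} => //= a t IH /andP[aNt ut] pt.
  case: t aNt ut pt IH => //= b t aNt ut /andP[ba pt] IH.
  rewrite IH//.
  rewrite andbT lt_neqAle ba andbT; apply: contraNneq aNt => ->.
  by rewrite inE eqxx.
by apply: eq_bigr => x _; congr (_ * Num.sg _); exact: perm_big.
Qed.

Lemma lagrange s g w : uniq s -> (size g <= size s)%N ->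
  \sum_(x <- s) g.[x] * \prod_(z <- s | z != x) ((w - z) / (x - z)) = g.[w].
Proof.
move=> us sg.
pose l x : {poly R} := \prod_(z <- s | z != x) ((x - z)^-1 *: ('X - z%:P)).
pose p : {poly R} := \sum_(x <- s) g.[x] *: l x.
have lE x u : (l x).[u] = \prod_(z <- s | z != x) ((u - z) / (x - z)).
  by rewrite horner_prod; apply: eq_bigr => z _; rewrite hornerZ hornerXsubC mulrC.
have pE u : p.[u] = \sum_(x <- s) g.[x] * \prod_(z <- s | z != x) ((u - z) / (x - z)).
  by rewrite horner_sum; apply: eq_bigr => x _; rewrite hornerZ lE.
rewrite -pE; suff -> : p = g by [].
apply/eqP; rewrite -subr_eq0; apply/negPn/negP => pg.
have szl x : x \in s -> (size (l x) <= size s)%N.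
  move=> xs; rewrite /l; under eq_bigr do rewrite -mul_polyC.
  rewrite big_split /= -rmorph_prod mul_polyC (leq_trans (size_scale_leq _ _))//.
  rewrite -big_filter size_prod_XsubC -(rem_filter x us) size_rem//.
  by case: (s) xs.
have szp : (size (p - g)%R <= size s)%N.
  apply: leq_trans (size_polyD _ _) _; rewrite size_polyN geq_max sg andbT.
  rewrite /p big_seq; apply: (leq_trans (size_sum _ _ _)).
  by apply/bigmax_leqP_seq => x xs _; rewrite (leq_trans (size_scale_leq _ _))// szl.
have := max_poly_roots pg _ us; rewrite ltnNge szp => /(_ _)/negP; apply => //.
apply/allP => y ys; rewrite rootE hornerD hornerN pE subr_eq0.
rewrite (bigD1_seq y)//= [X in _ * X]big1_seq => [|z /andP[zy zs]]; last first.
  by rewrite divff// subr_eq0 eq_sym.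
rewrite mulr1 big1_seq ?addr0 ?eqxx// => x /andP[xy xs].
suff -> : \prod_(z <- s | z != x) ((y - z) / (x - z)) = 0 by rewrite mulr0.
apply/eqP; rewrite prodf_seq_eq0; apply/hasP; exists y => //.
by rewrite eq_sym xy subrr mul0r eqxx.
Qed.

End vandermonde_seq.

(** * Integration over the cube *)

Section bounded_on.
Context d (T : measurableType d) (R : realType) (D : set T).
Implicit Types f g : T -> R.

(** Measurable everywhere but bounded only on D, so that polynomials qualify. The class is closed
    under ring operations, and its members are integrable on a D of finite measure, which makes
    real-valued integrals behave linearly. *)
Definition bmeas f := measurable_fun setT f /\ exists M, forall x, D x -> `|f x| <= M.

Lemma bmeas_cst c : bmeas (fun=> c).
Proof. by split; [exact: measurable_cst|exists `|c|]. Qed.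

Lemma bmeasD f g : bmeas f -> bmeas g -> bmeas (fun x => f x + g x).
Proof.
move=> [mf [M hM]] [mg [N hN]]; split; first exact: measurable_funD.
exists (M + N) => x Dx; rewrite (le_trans (ler_normD _ _))// lerD//; [exact: hM|exact: hN].
Qed.

Lemma bmeasM f g : bmeas f -> bmeas g -> bmeas (fun x => f x * g x).
Proof.
move=> [mf [M hM]] [mg [N hN]]; split; first exact: measurable_funM.
by exists (M * N) => x Dx; rewrite normrM ler_pM//; [exact: hM|exact: hN].
Qed.

Lemma bmeasB f g : bmeas f -> bmeas g -> bmeas (fun x => f x - g x).
Proof.
move=> [mf [M hM]] [mg [N hN]]; split; first exact: measurable_funB.
exists (M + N) => x Dx; rewrite (le_trans (ler_normB _ _))// lerD//; [exact: hM|exact: hN].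
Qed.

Lemma bmeas_norm f : bmeas f -> bmeas (fun x => `|f x|).
Proof.
move=> [mf [M hM]]; split; first exact: (measurableT_comp (@normr_measurable R setT)).
by exists M => x Dx; rewrite normr_id hM.
Qed.

Lemma bmeas_sg f : measurable_fun setT f -> bmeas (fun x => Num.sg (f x)).
Proof.
move=> mf; split; last by exists 1 => x _; rewrite normr_sg; case: (_ != _).
apply: (@measurableT_comp _ _ _ _ _ _ (fun x : R => Num.sg x)) => //.
apply: nondecreasing_measurable => //.
move=> x y xy.
by case: (sgrP x) => hx; case: (sgrP y) => hy //; lra.
Qed.

Lemma bmeas_sum (I : Type) (r : seq I) (F : I -> T -> R) :
  (forall i, bmeas (F i)) -> bmeas (fun x => \sum_(i <- r) F i x).
Proof.
move=> bF; elim: r => [|i r IH].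
  rewrite (_ : (fun _ => _) = fun=> 0); first exact: bmeas_cst.
  by apply/funext => x; rewrite big_nil.
rewrite (_ : (fun _ => _) = fun x => F i x + \sum_(i <- r) F i x); first exact: bmeasD.
by apply/funext => x; rewrite big_cons.
Qed.

Lemma bmeas_prod (I : Type) (r : seq I) (F : I -> T -> R) :
  (forall i, bmeas (F i)) -> bmeas (fun x => \prod_(i <- r) F i x).
Proof.
move=> bF; elim: r => [|i r IH].
  rewrite (_ : (fun _ => _) = fun=> 1); first exact: bmeas_cst.
  by apply/funext => x; rewrite big_nil.
rewrite (_ : (fun _ => _) = fun x => F i x * \prod_(i <- r) F i x); first exact: bmeasM.
by apply/funext => x; rewrite big_cons.
Qed.

Lemma bmeas_horner f (p : {poly R}) : bmeas f -> bmeas (fun x => p.[f x]).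
Proof.
move=> bf; elim/poly_ind: p => [|p c IH].
  rewrite (_ : (fun _ => _) = fun=> 0); first exact: bmeas_cst.
  by apply/funext => x; rewrite horner0.
rewrite (_ : (fun _ => _) = fun x => p.[f x] * f x + c); last first.
  by apply/funext => x; rewrite hornerMXaddC.
by apply: bmeasD; [exact: bmeasM|exact: bmeas_cst].
Qed.

Lemma bmeas_integrable (m : {measure set T -> \bar R}) f : measurable D ->
  (m D < +oo)%E -> bmeas f -> m.-integrable D (EFin \o f).
Proof.
move=> mD moo [mf [M hM]]; apply: measurable_bounded_integrable => //.
  exact: measurable_funTS.
apply: filterS (nbhs_pinfty_ge (num_real M)) => M' MM' x Dx /=.
by rewrite (le_trans (hM x Dx)).
Qed.

End bounded_on.

Lemma bmeas_comp d d' (T : measurableType d) (T' : measurableType d') (R : realType)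
    (D : set T) (D' : set T') (f : T' -> R) (phi : T -> T') :
  measurable_fun setT phi -> (forall x, D x -> D' (phi x)) ->
  bmeas D' f -> bmeas D (f \o phi).
Proof.
move=> mphi hphi [mf [M hM]]; split; first exact: measurableT_comp.
by exists M => x Dx; apply/hM/hphi.
Qed.

Section cube.
Context {R : realType}.
Local Notation mR := (measurableTypeR R).
Local Notation mu := (@lebesgue_measure R).
Definition sym_itv : set mR := `](-1)%R, 1%R[%classic.
Definition cubeT n : set (n.-tuple mR) := [set t | forall i, sym_itv (tnth t i)].
Arguments cubeT n _ : clear implicits.

Lemma I01P (x : R) : sym_itv x <-> -1 < x < 1.
Proof. by rewrite /sym_itv /= in_itv. Qed.

Lemma measurable_sym_itv : measurable sym_itv. Proof. exact: measurable_itv. Qed.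

Lemma mu_sym_itv : (mu sym_itv < +oo)%E.
Proof. by rewrite /sym_itv lebesgue_measure_itv/=; case: ifP => _; rewrite -?EFinD ltry. Qed.

Lemma measurable_cubeT n : measurable (cubeT n).
Proof.
rewrite (_ : cubeT n = \bigcap_(i in [set: 'I_n]) ((@tnth _ mR ^~ i) @^-1` sym_itv)); last first.
  by apply/seteqP; split => t /= h => [i _|i]; exact: h.
apply: fin_bigcap_measurable => // i _; rewrite -[X in measurable X]setTI.
by apply: measurable_tnth => //; exact: measurable_sym_itv.
Qed.

Lemma lamT_cubeT n : (lamT n (cubeT n) < +oo)%E.
Proof.
rewrite lamTE (@lebesgue_tuple_box R n (fun=> sym_itv)); last by move=> _; exact: measurable_sym_itv.
have : (mu sym_itv \is a fin_num) by rewrite ge0_fin_numE// mu_sym_itv.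
move=> /fineK <-; elim: n => [|n IH]; first by rewrite big_ord0 ltry.
by rewrite big_ord_recl lte_mul_pinfty// lee_fin fine_ge0.
Qed.

Lemma cubeT_tins n j x (t : n.-tuple mR) : (j <= n)%N ->
  cubeT n.+1 (tins j (x, t)) <-> sym_itv x /\ cubeT n t.
Proof.
move=> jn; split=> [h|[Ix ht] i]; last first.
  rewrite tnth_mktuple /=; case: ltngtP => // ij.
    have i' : (i < n)%N by rewrite (leq_trans ij).
    by rewrite -[X in nth _ _ X]/(nat_of_ord (Ordinal i')) -tnth_nth.
  have i' : (i.-1 < n)%N by have := ltn_ord i; lia.
  by rewrite -[X in nth _ _ X]/(nat_of_ord (Ordinal i')) -tnth_nth.
split.
  have jn' : (j < n.+1)%N by rewrite ltnS.
  by have := h (Ordinal jn'); rewrite tnth_mktuple /= ltnn eqxx.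
move=> i; have [ij|ji] := ltnP i j.
  have i' : (i < n.+1)%N by rewrite ltnS ltnW.
  by have := h (Ordinal i'); rewrite tnth_mktuple /= ij -tnth_nth.
have i' : (i.+1 < n.+1)%N by rewrite ltnS.
have := h (Ordinal i'); rewrite tnth_mktuple /= ltnNge leqW//= gtn_eqF//.
by rewrite -tnth_nth.
Qed.

Definition cube_int n (f : n.-tuple mR -> R) : R := (\int[lamT n]_(t in cubeT n) f t)%R.
Definition itv_int (f : mR -> R) : R := (\int[mu]_(x in sym_itv) f x)%R.
Definition boxT n : set (mR * n.-tuple mR) := sym_itv `*` cubeT n.
Arguments boxT n _ : clear implicits.

Lemma cube_int_integrable n f : bmeas (cubeT n) f -> (lamT n).-integrable (cubeT n) (EFin \o f).
Proof. by apply: bmeas_integrable; [exact: measurable_cubeT|exact: lamT_cubeT]. Qed.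

Lemma eq_cube_int n f g : (forall t, cubeT n t -> f t = g t) -> cube_int f = cube_int g.
Proof. by move=> fg; apply: eq_Rintegral => t /set_mem; exact: fg. Qed.

Lemma eq_itv_int f g : (forall x, sym_itv x -> f x = g x) -> itv_int f = itv_int g.
Proof. by move=> fg; apply: eq_Rintegral => t /set_mem; exact: fg. Qed.

Lemma CID n f g : bmeas (cubeT n) f -> bmeas (cubeT n) g ->
  cube_int (fun t => f t + g t) = cube_int f + cube_int g.
Proof. by move=> bf bg; apply: RintegralD; [exact: measurable_cubeT|exact: cube_int_integrable..]. Qed.

Lemma CIZ n f c : bmeas (cubeT n) f -> cube_int (fun t => c * f t) = c * cube_int f.
Proof. by move=> bf; apply: RintegralZl; [exact: measurable_cubeT|exact: cube_int_integrable]. Qed.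

Lemma cube_int_sum n (I : Type) (r : seq I) (F : I -> n.-tuple mR -> R) :
  (forall i, bmeas (cubeT n) (F i)) ->
  cube_int (fun t => \sum_(i <- r) F i t) = \sum_(i <- r) cube_int (F i).
Proof.
move=> bF; elim: r => [|i r IH].
  rewrite big_nil (@eq_cube_int _ _ (fun=> 0 * 1)); last by move=> t _; rewrite big_nil mul0r.
  by rewrite CIZ ?mul0r//; exact: bmeas_cst.
rewrite big_cons -IH -CID//; last exact: bmeas_sum.
by apply: eq_cube_int => t _; rewrite big_cons.
Qed.

Lemma lamT_pushforward n j (A : set (n.+1.-tuple mR)) : (j <= n)%N -> measurable A ->
  lamT n.+1 A = (mu \x lamT n)%E (tins j @^-1` A).
Proof.
move=> jn mA.
have mB : measurable (@tins R n j @^-1` A).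
  by rewrite -[X in measurable X]setTI; exact: measurable_tins.
have := @ge0_integral_tins R n j (EFin \o \1_A) jn.
rewrite integral_indic// setIT => ->; last 2 first.
- by apply: (measurableT_comp (@EFin_measurable R setT)); exact: measurable_indic.
- by move=> t; rewrite lee_fin.
have := @indic_fubini_tonelli1 _ _ _ _ R mu (lamT n) (tins j @^-1` A) mB.
by rewrite integral_indic// setIT.
Qed.

Lemma cube_int_prod n (f : mR * n.-tuple mR -> R) : bmeas (boxT n) f ->
  itv_int (fun x => cube_int (fun t => f (x, t))) =
  fine (\int[mu \x lamT n]_(p in boxT n) (f p)%:E)%E.
Proof.
move=> bf; have mbox : measurable (boxT n).
  by apply: measurableX; [exact: measurable_sym_itv|exact: measurable_cubeT].
have boxoo : ((mu \x lamT n) (boxT n) < +oo)%E.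
  rewrite /boxT product_measure1E//; [|exact: measurable_sym_itv|exact: measurable_cubeT].
  rewrite lte_mul_pinfty//; last exact: lamT_cubeT.
  by rewrite ge0_fin_numE//; exact: mu_sym_itv.
have := bmeas_integrable mbox boxoo bf.
rewrite -[X in integrable _ X]setTI => /(integrable_restrict _ mbox measurableT) intF.
rewrite integral_mkcond -(integral12_prod_meas1 intF).
rewrite /itv_int /Rintegral integral_mkcond; congr fine.
apply: eq_integral => x _; rewrite patchE /fubini_F; case: ifPn => [/set_mem Ix|xI].
  rewrite /cube_int /Rintegral fineK.
    rewrite integral_mkcond; apply: eq_integral => t _; rewrite !patchE.
    rewrite in_setX (mem_set Ix) /=; reflexivity.
  apply: integrable_fin_num; first exact: measurable_cubeT.
  apply: cube_int_integrable.
  apply: (@bmeas_comp _ _ _ _ R _ (boxT n) f (fun t => (x, t))) => //.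
  exact: measurable_pair1.
by rewrite integral0_eq// => t _; rewrite patchE in_setX (negbTE xI).
Qed.

Lemma cube_int_tins n j (f : n.+1.-tuple mR -> R) : (j <= n)%N -> bmeas (cubeT n.+1) f ->
  cube_int f = itv_int (fun x => cube_int (fun t => f (tins j (x, t)))).
Proof.
move=> jn bf; have mt := @measurable_tins R n j.
have bfp : bmeas (boxT n) (f \o tins j).
  apply: (bmeas_comp mt _ bf) => -[x t] [Ix ht]; exact/(cubeT_tins _ _ jn).
rewrite (cube_int_prod bfp) /cube_int /Rintegral; congr fine.
transitivity (\int[pushforward (mu \x lamT n) (tins j)]_(t in cubeT n.+1) (f t)%:E)%E.
  apply: eq_measure_integral => // A mA _; exact: lamT_pushforward.
have pre : tins j @^-1` cubeT n.+1 = boxT n.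
  by apply/seteqP; split => -[x t] /(cubeT_tins _ _ jn).
rewrite (integral_pushforward mt) ?pre//.
- by apply: (measurableT_comp (@EFin_measurable R setT)); case: bf.
- have mbox : measurable (boxT n).
    by apply: measurableX; [exact: measurable_sym_itv|exact: measurable_cubeT].
  have boxoo : ((mu \x lamT n) (boxT n) < +oo)%E.
    rewrite /boxT product_measure1E//; [|exact: measurable_sym_itv|exact: measurable_cubeT].
    rewrite lte_mul_pinfty//; last exact: lamT_cubeT.
    by rewrite ge0_fin_numE//; exact: mu_sym_itv.
  exact: bmeas_integrable.
- exact: measurable_cubeT.
Qed.

(** The iterated integral is turned into a single one over the cube of one more dimension, so that
    no regularity of the inner integral has to be established. *)
Lemma itv_int_CIZ n (f : mR * n.-tuple mR -> R) c : bmeas (boxT n) f ->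
  itv_int (fun x => cube_int (fun t => c * f (x, t))) = c * itv_int (fun x => cube_int (fun t => f (x, t))).
Proof.
move=> bf.
have bt : bmeas (cubeT n.+1) (fun t => f (thead t, [tuple of behead t])).
  apply: (@bmeas_comp _ _ _ _ R _ (boxT n) f (fun t => (thead t, [tuple of behead t]))) => //.
    by apply: measurable_fun_pair; [exact: measurable_tnth|exact: measurable_behead].
  move=> t ht; split; first exact: ht.
  move=> i; have := ht (lift ord0 i); rewrite [in X in X -> _](tuple_eta t) tnthS; exact.
have e x (t : n.-tuple mR) : (thead (tins 0 (x, t)), [tuple of behead (tins 0 (x, t))]) = (x, t).
  by rewrite tins0 behead_tcons /tcons theadE.
have E g : bmeas (boxT n) g -> bmeas (cubeT n.+1) (fun t => g (thead t, [tuple of behead t])) ->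
    itv_int (fun x => cube_int (fun t => g (x, t))) = cube_int (fun t => g (thead t, [tuple of behead t])).
  move=> bg bgt; rewrite (cube_int_tins (leq0n n) bgt).
  by apply: eq_itv_int => x _; apply: eq_cube_int => t _; rewrite e.
rewrite (E f bf bt) -(CIZ c bt); apply: (E (fun p => c * f p)).
  by apply: bmeasM => //; exact: bmeas_cst.
by apply: bmeasM => //; exact: bmeas_cst.
Qed.

Definition tdel n j (X : n.+1.-tuple mR) : n.-tuple mR :=
  [tuple (nth 0 X (if (i < j)%N then (i : nat) else i.+1) : R) | i < n].

Lemma tdel_tins n j x (t : n.-tuple mR) : (j <= n)%N -> tdel j (tins j (x, t)) = t.
Proof.
move=> jn; apply: eq_from_tnth => i; rewrite tnth_mktuple.
have [ij|ji] := ltnP i j.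
  have i' : (i < n.+1)%N by rewrite ltnS ltnW.
  rewrite -[X in nth _ _ X]/(nat_of_ord (Ordinal i')) -tnth_nth tnth_mktuple /= ij.
  by rewrite -tnth_nth.
have i' : (i.+1 < n.+1)%N by rewrite ltnS.
rewrite -[X in nth _ _ X]/(nat_of_ord (Ordinal i')) -tnth_nth tnth_mktuple /=.
by rewrite ltnNge leqW//= gtn_eqF// -tnth_nth.
Qed.

Lemma nth_tins n j x (t : n.-tuple mR) : (j <= n)%N -> nth 0 (tins j (x, t)) j = x :> R.
Proof.
move=> jn; have j' : (j < n.+1)%N by rewrite ltnS.
rewrite -[X in nth _ _ X]/(nat_of_ord (Ordinal j')) -tnth_nth tnth_mktuple /=.
by rewrite ltnn eqxx.
Qed.

Lemma nth_tdel n j (X : n.+1.-tuple mR) i : (i < n)%N ->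
  nth 0 (tdel j X) i = nth 0 X (if (i < j)%N then i else i.+1) :> R.
Proof.
move=> i'; rewrite -[X in nth _ _ X = _]/(nat_of_ord (Ordinal i')) -tnth_nth.
by rewrite tnth_mktuple.
Qed.

Lemma tins_tdel n j (X : n.+1.-tuple mR) : (j <= n)%N ->
  tins j (nth 0 X j : mR, tdel j X) = X.
Proof.
move=> jn; apply: eq_from_tnth => i; rewrite tnth_mktuple (tnth_nth (0 : R)).
set T := tdel j X; cbn [fst snd].
case: ltngtP => ij; last by rewrite ij.
  by rewrite nth_tdel ?ij// (leq_trans ij).
rewrite nth_tdel; last by have := ltn_ord i; lia.
by rewrite ltnNge -ltnS prednK ?ij//; case: (nat_of_ord i) ij.
Qed.

Lemma measurable_unins n j : measurable_fun setT
  (fun X : n.+1.-tuple mR => (nth 0 X j : mR, tdel j X)).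
Proof.
apply: measurable_fun_pair; first exact: measurable_nth_tuple.
apply/measurable_fun_tnthP => i.
rewrite (_ : _ \o _ = fun X : n.+1.-tuple mR => nth 0 X (if (i < j)%N then (i : nat) else i.+1) : mR).
  exact: measurable_nth_tuple.
by apply/funext => X /=; rewrite tnth_mktuple.
Qed.

Lemma bmeas_unins n j (f : mR * n.-tuple mR -> R) : (j <= n)%N -> bmeas (boxT n) f ->
  bmeas (cubeT n.+1) (fun X => f (nth 0 X j : mR, tdel j X)).
Proof.
move=> jn; apply: bmeas_comp; first exact: measurable_unins.
by move=> X hX; apply/(cubeT_tins _ _ jn); rewrite tins_tdel.
Qed.

(** Each of the n + 1 coordinates can play the part of the distinguished variable, with the same
    integral. *)
Lemma cube_int_sym n (f : mR * n.-tuple mR -> R) : bmeas (boxT n) f ->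
  n.+1%:R * itv_int (fun x => cube_int (fun t => f (x, t))) =
  cube_int (fun X : n.+1.-tuple mR => \sum_(j < n.+1) f (nth 0 X j : mR, tdel j X)).
Proof.
move=> bf; rewrite cube_int_sum; last first.
  by move=> j; apply: bmeas_unins => //; rewrite -ltnS.
rewrite mulr_natl -[X in _ *+ X]card_ord -sumr_const; apply: eq_bigr => j _.
have jn : (j <= n)%N by rewrite -ltnS.
rewrite (cube_int_tins jn); last exact: bmeas_unins.
by apply: eq_itv_int => x _; apply: eq_cube_int => t _; rewrite nth_tins// tdel_tins.
Qed.

Lemma perm_tdel n j (X : n.+1.-tuple R) : (j <= n)%N ->
  perm_eq (X : seq R) (nth 0 X j :: (tdel j X : n.-tuple R)).
Proof.
move=> jn.
have e : tval (tdel j X) = take j X ++ drop j.+1 X.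
  apply: (@eq_from_nth _ (0 : R)).
    by rewrite size_cat size_tuple size_take size_drop size_tuple ltnS jn; lia.
  rewrite size_tuple => i iN.
  rewrite -[i in LHS]/(nat_of_ord (Ordinal iN)) -tnth_nth tnth_mktuple /=.
  rewrite nth_cat size_take size_tuple ltnS jn; case: ltnP => ij; first by rewrite nth_take.
  by rewrite nth_drop; congr (nth _ _ _); lia.
rewrite e -[X in perm_eq X _](cat_take_drop j X) (drop_nth 0) ?size_tuple ?ltnS//.
by rewrite -cat1s perm_catCA.
Qed.

End cube.
Arguments cubeT {R} n _.
Arguments boxT {R} n _.

(** * The kernel of the skew pairing *)

Section kernel.
Context {R : realType}.
Local Notation mR := (measurableTypeR R).
Local Notation mu := (@lebesgue_measure R).
Local Notation sym_itv := (@sym_itv R).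

Definition root_prod (s : seq R) (w : R) : R := \prod_(z <- s) (w - z).

Lemma bmeas_tnth n i : bmeas (@cubeT R n) (fun t => tnth t i : R).
Proof.
split; first exact: measurable_tnth.
by exists 1 => t /(_ i)/I01P /andP[h1 h2]; rewrite ler_norml !ltW.
Qed.

Lemma bmeas_root_prod d (T : measurableType d) (D : set T) n (phi : T -> n.-tuple mR) (f : T -> R) :
  measurable_fun setT phi -> (forall x, D x -> cubeT n (phi x)) -> bmeas D f ->
  bmeas D (fun x => root_prod (phi x) (f x)).
Proof.
move=> mphi hphi bf.
rewrite (_ : (fun _ => _) = fun x => \prod_(i < n) (f x - tnth (phi x) i)); last first.
  by apply/funext => x; rewrite /root_prod big_tuple.
apply: bmeas_prod => i; apply: bmeasB => //.
exact: (bmeas_comp mphi hphi (bmeas_tnth i)).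
Qed.

Lemma bmeas_fst n : bmeas (@boxT R n) (fun p => p.1 : R).
Proof.
split; first exact: measurable_fst.
by exists 1 => p [/I01P /andP[h1 h2] _]; rewrite ler_norml !ltW.
Qed.

Lemma cubeT_behead n (t : n.+1.-tuple mR) : cubeT n.+1 t -> cubeT n [tuple of behead t].
Proof.
by move=> ht i; have := ht (lift ord0 i); rewrite [in X in X -> _](tuple_eta t) tnthS; exact.
Qed.

Lemma bmeas_absD n : bmeas (@cubeT R n) (fun t => absD (t : seq R)).
Proof.
elim: n => [|n IH].
  rewrite (_ : (fun _ => _) = fun=> 1); first exact: bmeas_cst.
  by apply/funext => t; rewrite tuple0.
have mb : measurable_fun setT (fun t : n.+1.-tuple mR => [tuple of behead t]).
  exact: measurable_behead.
rewrite (_ : (fun _ => _) = fun t : n.+1.-tuple mR =>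
    absD ([tuple of behead t] : seq R) * `|root_prod [tuple of behead t] (thead t)|); last first.
  by apply/funext => t; case/tupleP: t => x t; rewrite theadE.
apply: bmeasM; first exact: (bmeas_comp mb (@cubeT_behead n) IH).
apply: bmeas_norm; apply: (bmeas_root_prod mb (@cubeT_behead n)).
exact: bmeas_tnth.
Qed.

Lemma boxT_snd n p : @boxT R n p -> cubeT n p.2.
Proof. by case. Qed.

Lemma bmeas_absD2 n : bmeas (@boxT R n) (fun p => absD (p.2 : seq R)).
Proof. exact: (bmeas_comp (@measurable_snd _ _ mR (n.-tuple mR)) (@boxT_snd n) (@bmeas_absD n)). Qed.

Lemma bmeas_root_prod2 n f : bmeas (@boxT R n) f -> bmeas (@boxT R n) (fun p => root_prod p.2 (f p)).
Proof. exact: (bmeas_root_prod (@measurable_snd _ _ mR (n.-tuple mR)) (@boxT_snd n)). Qed.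

Lemma bmeas_root_prod1 n w : bmeas (@cubeT R n) (fun t => root_prod t w).
Proof. exact: (bmeas_root_prod (@measurable_id _ _ setT) (fun _ h => h) (bmeas_cst _ w)). Qed.

Lemma root_prod_tdel n j (X : n.+1.-tuple mR) w : (j <= n)%N ->
  root_prod X w = (w - nth 0 X j) * root_prod (tdel j X) w.
Proof. by move=> jn; rewrite /root_prod (perm_big _ (perm_tdel X jn)) /= big_cons. Qed.

Lemma absD_tdel n j (X : n.+1.-tuple mR) : (j <= n)%N ->
  absD (X : seq R) = absD (tdel j X : seq R) * `|root_prod (tdel j X) (nth 0 X j)|.
Proof. by move=> jn; rewrite (perm_absD (perm_tdel X jn)). Qed.

Lemma root_prod_tdel_uniq n j (X : n.+1.-tuple mR) w : (j <= n)%N -> uniq (X : seq R) ->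
  root_prod (tdel j X) w = \prod_(z <- (X : seq R) | z != nth 0 X j) (w - z).
Proof.
move=> jn; have pX := perm_tdel X jn; rewrite (perm_uniq pX) /= => /andP[xN _].
rewrite (perm_big _ pX) /= big_cons eqxx /= /root_prod big_seq [RHS]big_seq_cond.
apply: eq_bigl => z; case: (boolP (z \in _)) => //= zt.
by apply/esym; apply: contraNneq xN => <-.
Qed.

Lemma sum_tuple n (X : n.-tuple mR) (G : R -> R) :
  \sum_(x <- (X : seq R)) G x = \sum_(j < n) G (nth 0 X j).
Proof. by rewrite big_tuple; apply: eq_bigr => j _; rewrite (tnth_nth (0 : R)). Qed.

(** The factor [absD X] covers repeated coordinates, where [sgn_sum] does not apply: both sides are
    then 0. *)
Lemma sgn_sum_tdel n (X : n.+1.-tuple mR) y :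
  absD (X : seq R) * (\sum_(j < n.+1) Num.sg (y - nth 0 X j) * Num.sg (root_prod (tdel j X) (nth 0 X j))) =
  absD (X : seq R) * (Num.sg (root_prod X y) + kap R n.+1).
Proof.
have [->|] := eqVneq (absD (X : seq R)) 0; first by rewrite !mul0r.
rewrite absD_uniq => uX; congr (_ * _).
have := sgn_sum y uX; rewrite size_tuple => <-; rewrite sum_tuple.
apply: eq_bigr => j _; congr (_ * Num.sg _); apply: root_prod_tdel_uniq => //.
by rewrite -ltnS.
Qed.

(** Lagrange interpolation multiplied by [absD X]: the part of [absD X] that involves x_j is the
    absolute value of the j-th denominator and cancels it up to its sign. *)
Lemma lagrange_tdel n (X : n.+1.-tuple mR) (g : {poly R}) w : (size g <= n.+1)%N ->
  \sum_(j < n.+1) g.[nth 0 X j] * (root_prod (tdel j X) w *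
     (absD (tdel j X : seq R) * Num.sg (root_prod (tdel j X) (nth 0 X j)))) =
  absD (X : seq R) * g.[w].
Proof.
move=> sg; have [aX|] := eqVneq (absD (X : seq R)) 0.
  rewrite aX mul0r big1// => j _; have jn : (j <= n)%N by rewrite -ltnS.
  move/eqP: aX; rewrite (absD_tdel X jn) mulf_eq0 normr_eq0 => /orP[]/eqP ->.
    by rewrite mul0r !mulr0.
  by rewrite sgr0 !mulr0.
move=> aX; have := aX; rewrite absD_uniq => uX.
have sgX : (size g <= size (X : seq R))%N by rewrite size_tuple.
rewrite -(lagrange w uX sgX) sum_tuple mulr_sumr; apply: eq_bigr => j _.
have jn : (j <= n)%N by rewrite -ltnS.
move: aX; rewrite prodf_div -!(root_prod_tdel_uniq _ jn uX) (absD_tdel X jn).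
rewrite mulf_eq0 normr_eq0 negb_or => /andP[_ P0].
by rewrite normrEsg; field.
Qed.

Lemma C1Z c f : bmeas sym_itv f -> itv_int (fun x => c * f x) = c * itv_int f.
Proof.
move=> bf; apply: RintegralZl; first exact: measurable_sym_itv.
by apply: bmeas_integrable => //; [exact: measurable_sym_itv|exact: mu_sym_itv].
Qed.

(** This is F(- (x + w), x w): the quadratic factor is given by its real roots x and w. *)
Definition pair_avg n x w :=
  cube_int (fun t : n.-tuple mR => absD (t : seq R) * root_prod t x * root_prod t w).

(** Let X be t with x added. Then (x - w) times [root_prod t w] is - [root_prod X w], and
    [absD t * root_prod t x] is [absD X] up to a sign. Symmetrising over the position of x leaves
    the sum of signs evaluated by [sgn_sum_tdel]. *)
Lemma kernel_inner n y w :
  n.+1%:R * itv_int (fun x => Num.sg (y - x) * ((x - w) * pair_avg n x w)) =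
  cube_int (fun X : n.+1.-tuple mR => - root_prod X w * absD (X : seq R) *
    (Num.sg (root_prod X y) + kap R n.+1)).
Proof.
pose f (p : mR * n.-tuple mR) : R :=
  (Num.sg (y - p.1) * (p.1 - w)) * (absD (p.2 : seq R) * root_prod p.2 p.1 * root_prod p.2 w).
have b1 := bmeas_fst n.
have bf : bmeas (boxT n) f.
  apply: bmeasM.
    apply: bmeasM; last by apply: bmeasB => //; exact: bmeas_cst.
    by apply: bmeas_sg; apply: measurable_funB; [exact: measurable_cst|exact: measurable_fst].
  by apply: bmeasM; [apply: bmeasM; [exact: bmeas_absD2|exact: bmeas_root_prod2]|
    apply: bmeas_root_prod2; exact: bmeas_cst].
transitivity (n.+1%:R * itv_int (fun x => cube_int (fun t => f (x, t)))).
  congr (_ * _); apply: eq_itv_int => x _; rewrite mulrA -CIZ//.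
  by apply: bmeasM; [apply: bmeasM; [exact: bmeas_absD|exact: bmeas_root_prod1]|exact: bmeas_root_prod1].
rewrite (cube_int_sym bf); apply: eq_cube_int => X _.
rewrite -[RHS]mulrA -sgn_sum_tdel mulrA mulr_sumr; apply: eq_bigr => j _.
have jn : (j <= n)%N by rewrite -ltnS.
rewrite /f /= (absD_tdel X jn) (root_prod_tdel X w jn) normrEsg.
set P := root_prod _ (nth 0 X j).
have [->|P0] := eqVneq P 0; first by rewrite !(mulr0,mul0r).
have sP : Num.sg P * Num.sg P = 1 by rewrite -expr2 sqr_sg P0.
rewrite [RHS](_ : _ = (Num.sg P * Num.sg P) * (- (w - nth 0 X j) * root_prod (tdel j X) w *
  (absD (tdel j X : seq R) * P) * Num.sg (y - nth 0 X j))); last by ring.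
by rewrite sP; ring.
Qed.

(** The same move with y as the next coordinate: [absD X] times the sign of [root_prod X y],
    symmetrised, is the Lagrange sum of [g] on n + 2 nodes, whence the bound on its size. The
    constant [kap] contributes a multiple of the integral of [g], which is 0. *)
Lemma kernel_pairing n (g : {poly R}) w : (size g <= n.+2)%N -> itv_int (horner g) = 0 ->
  n.+2%:R * n.+1%:R * itv_int (fun y => g.[y] *
    itv_int (fun x => Num.sg (y - x) * ((x - w) * pair_avg n x w))) =
  - cube_int (fun Y : n.+2.-tuple mR => absD (Y : seq R)) * g.[w].
Proof.
move=> sg g0; pose h (X : n.+1.-tuple mR) : R := - root_prod X w * absD (X : seq R).
have bh : bmeas (cubeT n.+1) h.
  rewrite (_ : h = fun X => (-1 * root_prod X w) * absD (X : seq R)).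
    by apply: bmeasM; [apply: bmeasM; [exact: bmeas_cst|exact: bmeas_root_prod1]|exact: bmeas_absD].
  by apply/funext => X; rewrite mulN1r.
have bg1 : bmeas sym_itv (horner g).
  apply: bmeas_horner; split; first exact: measurable_id.
  by exists 1 => x /I01P /andP[? ?]; rewrite ler_norml !ltW.
have bg : bmeas (boxT n.+1) (fun p => g.[p.1]) by apply: bmeas_horner; exact: bmeas_fst.
have bh2 : bmeas (boxT n.+1) (fun p => h p.2).
  exact: (bmeas_comp (@measurable_snd _ _ mR (n.+1.-tuple mR)) (@boxT_snd n.+1) bh).
pose f1 (p : mR * n.+1.-tuple mR) := g.[p.1] * (h p.2 * Num.sg (root_prod p.2 p.1)).
pose f2 (p : mR * n.+1.-tuple mR) := kap R n.+1 * (g.[p.1] * h p.2).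
have bf1 : bmeas (boxT n.+1) f1.
  apply: bmeasM => //; apply: bmeasM => //; apply: bmeas_sg.
  by case: (bmeas_root_prod2 (bmeas_fst n.+1)).
have bf2 : bmeas (boxT n.+1) f2 by apply: bmeasM; [exact: bmeas_cst|exact: bmeasM].
rewrite -mulrA; transitivity (n.+2%:R * itv_int (fun y => cube_int (fun X => f1 (y, X) + f2 (y, X)))).
  have n0 : n.+1%:R != 0 :> R by rewrite pnatr_eq0.
  rewrite -[itv_int (fun y => cube_int _)](mulVKf n0); congr (_ * (_ * _)).
  rewrite -(itv_int_CIZ _ (bmeasD bf1 bf2)); apply: eq_itv_int => y _.
  rewrite -[X in _ * X](mulKf n0) kernel_inner mulrA -CIZ.
    by apply: eq_cube_int => X _; rewrite /f1 /f2 /h /=; ring.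
  apply: bmeasM; first exact: bh.
  apply: bmeasD; last exact: bmeas_cst.
  by apply: bmeas_sg; case: (bmeas_root_prod1 n.+1 y).
rewrite (cube_int_sym (bmeasD bf1 bf2)).
rewrite (@eq_cube_int _ _ _ (fun X : n.+2.-tuple mR => \sum_(j < n.+2) f1 (nth 0 X j : mR, tdel j X) +
    \sum_(j < n.+2) f2 (nth 0 X j : mR, tdel j X))); last by move=> X _; rewrite big_split.
rewrite CID; last 2 first.
- by apply: bmeas_sum => j; apply: bmeas_unins => //; rewrite -ltnS.
- by apply: bmeas_sum => j; apply: bmeas_unins => //; rewrite -ltnS.
rewrite -(cube_int_sym bf2) [X in _ * X](_ : _ = 0); last first.
  transitivity (itv_int (fun y => (kap R n.+1 * cube_int h) * g.[y])).
    apply: eq_itv_int => y _; rewrite mulrAC -CIZ//.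
    by apply: eq_cube_int => X _; rewrite /f2 /=; ring.
  by rewrite C1Z// g0 mulr0.
rewrite mulr0 addr0 mulNr mulrC -mulNr -CIZ; last exact: bmeas_absD.
apply: eq_cube_int => Y _; rewrite mulNr mulrC -(lagrange_tdel Y w sg) -sumrN.
by apply: eq_bigr => j _; rewrite /f1 /h /=; ring.
Qed.

Lemma itv_int_horner (p : {poly R}) : itv_int (horner p) = intg (-1) 1 p.
Proof.
rewrite /itv_int /Rintegral -[in LHS](deriv_prim p) integral_deriv_horner//.
Qed.

Lemma itv_int_sg_horner (p : {poly R}) y : sym_itv y ->
  itv_int (fun x => Num.sg (y - x) * p.[x]) =
  2 * (prim p).[y] - ((prim p).[1] + (prim p).[-1]).
Proof.
move=> /I01P /andP[y1 y2].
have bp : bmeas sym_itv (fun x => Num.sg (y - x) * p.[x]).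
  apply: bmeasM.
    by apply: bmeas_sg; apply: measurable_funB; [exact: measurable_cst|exact: measurable_id].
  apply: bmeas_horner; split; first exact: measurable_id.
  by exists 1 => x /I01P /andP[? ?]; rewrite ler_norml !ltW.
have ip : mu.-integrable sym_itv (EFin \o (fun x => Num.sg (y - x) * p.[x])).
  by apply: bmeas_integrable => //; [exact: measurable_sym_itv|exact: mu_sym_itv].
have := @Rintegral_itvB R _ (BRight (-1)) (BLeft 1) y ip.
rewrite !bnd_simp => /(_ (ltW y1) y2) /eqP; rewrite subr_eq => /eqP e.
rewrite /itv_int e -Rintegral_itv_bndo_bndc; last first.
  apply: (integrableS _ _ _ ip) => //; first exact: measurable_sym_itv.
  by move=> x /=; rewrite /sym_itv /= !in_itv /= => /andP[-> h]; exact: lt_trans h y2.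
have -> : (\int[mu]_(x in `]y, 1%R[) (Num.sg (y - x) * p.[x]) = - ((prim p).[1] - (prim p).[y]))%R.
  transitivity (\int[mu]_(x in `]y, 1%R[) (- prim p)^`().[x])%R.
    apply: eq_Rintegral.
    move=> x /set_mem /=; rewrite in_itv /= => /andP[yx _].
    by rewrite derivN deriv_prim hornerN ltr0_sg ?subr_lt0// mulN1r.
  by rewrite /Rintegral integral_deriv_horner ?ltW//= !hornerN; ring.
have -> : (\int[mu]_(x in `](-1)%R, y[) (Num.sg (y - x) * p.[x]) = (prim p).[y] - (prim p).[-1])%R.
  transitivity (\int[mu]_(x in `](-1)%R, y[) (prim p)^`().[x])%R.
    apply: eq_Rintegral.
    move=> x /set_mem /=; rewrite in_itv /= => /andP[_ yx].
    by rewrite deriv_prim gtr0_sg ?subr_gt0// mul1r.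
  by rewrite /Rintegral integral_deriv_horner ?ltW.
by ring.
Qed.

(** Interpolation at the nodes 0, ..., N - 1 builds P from integrals of values, so that no
    coefficient has to be integrated. *)
Lemma cube_int_poly n N (p : n.-tuple mR -> {poly R}) : (forall t, size (p t) <= N)%N ->
  (forall x, bmeas (cubeT n) (fun t => (p t).[x])) ->
  exists2 P : {poly R}, (size P <= N)%N & forall x, P.[x] = cube_int (fun t => (p t).[x]).
Proof.
move=> sp bp; pose s : seq R := [seq i%:R | i <- iota 0 N].
have us : uniq s.
  by rewrite map_inj_uniq ?iota_uniq// => i j /eqP; rewrite eqr_nat => /eqP.
have ss : size s = N by rewrite size_map size_iota.
pose l x : {poly R} := \prod_(z <- s | z != x) ((x - z)^-1 *: ('X - z%:P)).
have lE x u : (l x).[u] = \prod_(z <- s | z != x) ((u - z) / (x - z)).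
  by rewrite horner_prod; apply: eq_bigr => z _; rewrite hornerZ hornerXsubC mulrC.
have szl x : x \in s -> (size (l x) <= N)%N.
  move=> xs; rewrite /l; under eq_bigr do rewrite -mul_polyC.
  rewrite big_split /= -rmorph_prod mul_polyC (leq_trans (size_scale_leq _ _))//.
  rewrite -big_filter size_prod_XsubC -(rem_filter x us) size_rem// -ss.
  by case: (s) xs.
exists (\sum_(a <- s) cube_int (fun t => (p t).[a]) *: l a).
  rewrite big_seq; apply: (leq_trans (size_sum _ _ _)).
  by apply/bigmax_leqP_seq => x xs _; rewrite (leq_trans (size_scale_leq _ _))// szl.
move=> x; rewrite horner_sum.
transitivity (\sum_(a <- s) cube_int (fun t => (l a).[x] * (p t).[a])).
  by apply: eq_bigr => a _; rewrite hornerZ CIZ// mulrC.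
rewrite -cube_int_sum; last by move=> a; apply: bmeasM => //; exact: bmeas_cst.
apply: eq_cube_int => t _; rewrite -[RHS](lagrange x us); last by rewrite ss.
by apply: eq_bigr => a _; rewrite lE mulrC.
Qed.

End kernel.

(** * Uniqueness of the kernel *)

Section skew_pairing.
Variable R : realFieldType.
Implicit Types (f g h p : {poly R}) (w x : R).
Local Notation leg := (@leg R).
Local Notation intg := (@intg R (-1) 1).

(* [(skew_prim f).[y]] is the integral of [sgn (y - x) * f.[x]] over [-1 < x < 1]. *)
Definition skew_prim f : {poly R} := 2 *: prim f - ((prim f).[1] + (prim f).[-1])%:P.
Definition skew_pair f g : R := intg (skew_prim f * g).

Lemma skew_prim_lin a f h : skew_prim (a *: f + h) = a *: skew_prim f + skew_prim h.
Proof.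
rewrite /skew_prim linearP /= !(hornerD, hornerZ).
rewrite -!mul_polyC !(polyCD, polyCM).
set x := (prim f).[1]%:P; set x' := (prim f).[-1]%:P; set y := (prim h).[1]%:P.
by set y' := (prim h).[-1]%:P; set u := a%:P; rewrite -[1%:P + 1%:P]polyCD; set z := _%:P; ring.
Qed.

Lemma skew_pair_lin a f h g : skew_pair (a *: f + h) g = a * skew_pair f g + skew_pair h g.
Proof. by rewrite /skew_pair skew_prim_lin mulrDl -scalerAl linearP. Qed.

Lemma pr0 g : skew_pair 0 g = 0.
Proof. by have := skew_pair_lin 1 0 0 g; rewrite scale1r addr0 mul1r; lra. Qed.

Lemma prZ a f g : skew_pair (a *: f) g = a * skew_pair f g.
Proof. by rewrite -[a *: f]addr0 skew_pair_lin pr0 addr0. Qed.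

Lemma prD f h g : skew_pair (f + h) g = skew_pair f g + skew_pair h g.
Proof. by rewrite -[f in LHS]scale1r skew_pair_lin mul1r. Qed.

Lemma prB f h g : skew_pair (f - h) g = skew_pair f g - skew_pair h g.
Proof. by rewrite prD -scaleN1r prZ mulN1r. Qed.

Lemma skew_pair_sum I (r : seq I) (P : pred I) (F : I -> {poly R}) g :
  skew_pair (\sum_(i <- r | P i) F i) g = \sum_(i <- r | P i) skew_pair (F i) g.
Proof.
elim: r => [|i r IH]; first by rewrite !big_nil pr0.
by rewrite !big_cons; case: (P i); rewrite ?prD IH.
Qed.

(** [skew_prim] of p' is 2 p up to an additive constant, and [g] does not see constants. *)
Lemma skew_pair_derivl p g : intg g = 0 -> skew_pair p^`() g = 2 * intg (p * g).
Proof.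
move=> g0; rewrite /skew_pair /skew_prim prim_deriv.
set c := _ + _.[-1].
have -> : (2 *: (p - (p`_0)%:P) - c%:P) * g = 2 *: (p * g) - (2 * p`_0 + c) *: g.
  rewrite -!mul_polyC (polyCD (2 * p`_0)) (polyCM 2); set x := c%:P; set y := 2%:P; set z := _%:P.
  by ring.
have lin a b (u v : {poly R}) : intg (a *: u - b *: v) = a * intg u - b * intg v.
  by rewrite linearB /= !linearZ.
by rewrite lin g0 mulr0 subr0.
Qed.

Lemma intg_legM k j : intg (leg k * leg j) = if k == j then 2 / (2 * j + 1)%:R else 0.
Proof. by case: eqVneq => [->|kj]; [rewrite intg_leg_sqr|rewrite intg_leg_orth]. Qed.

Lemma skew_pair_leg_deriv k j : skew_pair (leg k)^`() (leg j.+1) =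
  if k == j.+1 then 4 / (2 * j.+1 + 1)%:R else 0.
Proof.
rewrite skew_pair_derivl ?intg_leg// intg_legM; case: ifP => _; rewrite ?mulr0//.
by rewrite mulrA; congr (_ / _); ring.
Qed.

(** (2k+1) P_k is the derivative of P_(k+1) - P_(k-1), which reduces the pairing to orthogonality;
    P_0 is the derivative of P_1. *)
Lemma skew_pair_leg k j : (2 * k + 1)%:R * skew_pair (leg k) (leg j.+1) =
  ((k == j)%:R - (k == j.+2)%:R) * (4 / (2 * j.+1 + 1)%:R).
Proof.
case: k => [|k].
  have -> : leg 0 = (leg 1)^`() by rewrite leg0 leg1 derivX.
  by rewrite skew_pair_leg_deriv eqSS eq_sym; case: ifP => _; rewrite ?mulr0 subr0 !(mul1r,mul0r).
rewrite -prZ -deriv_leg -derivB skew_pair_derivl ?intg_leg// mulrBl linearB /= !intg_legM.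
rewrite !eqSS; do 2![case: ifP => _]; rewrite ?subr0 ?sub0r ?subrr ?mulr0 ?mul0r ?mul1r ?mulN1r ?mulrN//.
  by rewrite mulrA; congr (_ / _); ring.
by rewrite mulrA; congr (- (_ / _)); ring.
Qed.

Definition skew_kernel d w : {poly R} := \sum_(k < d | odd k != odd d) ((2 * k + 1)%:R / 4) *:
  ((leg k)^`().[w] *: leg k - (leg k).[w] *: (leg k)^`()).

Lemma skew_kernel_antisym d w x : (skew_kernel d w).[x] = - (skew_kernel d x).[w].
Proof.
rewrite !horner_sum -sumrN; apply: eq_bigr => k _.
by rewrite !hornerE; ring.
Qed.

Lemma size_skew_kernel d w : (size (skew_kernel d w) <= d)%N.
Proof.
apply: (leq_trans (size_sum _ _ _)); apply/bigmax_leqP => k _.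
rewrite (leq_trans (size_scale_leq _ _))// (leq_trans (size_polyD _ _))// size_polyN geq_max.
rewrite !(leq_trans (size_scale_leq _ _))// ?size_leg//.
have /lt_size_deriv : leg k != 0 by rewrite -size_poly_gt0 size_leg.
by rewrite size_leg => /leq_trans h; apply: ltnW; apply: h.
Qed.

(** Against P_(j+1), the terms in P_k' respond only for k = j + 1 and those in P_k only for k = j
    and k = j + 2. The parity condition keeps one of the two groups: either the diagonal term gives
    the result at once, or the neighbours combine through [deriv_leg]. *)
Lemma skew_pair_skew_kernel d w j : (j.+1 < d)%N -> skew_pair (skew_kernel d w) (leg j.+1) = - (leg j.+1).[w].
Proof.
move=> jd; rewrite skew_pair_sum.
have c0 k : (2 * k + 1)%:R != 0 :> R by rewrite pnatr_eq0 addn1.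
transitivity (\sum_(k < d | odd k != odd d)
   ((leg k)^`().[w] * (((k == j :> nat)%:R - (k == j.+2 :> nat)%:R)) / (2 * j.+1 + 1)%:R -
    (k == j.+1 :> nat)%:R * (leg j.+1).[w])).
  apply: eq_bigr => k _; rewrite prZ prB !prZ skew_pair_leg_deriv mulrBr; congr (_ - _).
    rewrite -[_ * skew_pair _ _](mulKf (c0 k)) [(2 * k + 1)%:R * (_ * _)]mulrCA skew_pair_leg.
    have := c0 k; have := c0 j.+1; set a := (_%:R : R); set b := (_%:R : R) => h1 h2.
    by clearbody a b; field; rewrite ?h1 ?h2.
  case: eqVneq => [->|_]; last by rewrite !mulr0 mul0r.
  rewrite mul1r; have := c0 j.+1; set a := (2 * j.+1 + 1)%:R => h.
  by clearbody a; field.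
have [jp|jp] := boolP (odd j.+1 != odd d).
  rewrite (bigD1 (Ordinal jd))//= eqxx mul1r big1 ?addr0 => [|k /andP[ko kj]].
    have -> : (j.+1 == j) = false by lia.
    have -> : (j.+1 == j.+2) = false by lia.
    by rewrite subrr mulr0 mul0r sub0r.
  have -> : (k == j.+1 :> nat) = false by apply/negbTE.
  have -> : (k == j :> nat) = false by apply/negP => /eqP kE; move: ko jp; rewrite kE /=; do 2!case: odd.
  have -> : (k == j.+2 :> nat) = false by apply/negP => /eqP kE; move: ko jp; rewrite kE /=; do 2!case: odd.
  by rewrite !(subrr,mulr0,mul0r).
(* Parity excludes [j.+2 = d], so both neighbours occur in the sum. *)
have jd2 : (j.+2 < d)%N.
  rewrite ltn_neqAle jd andbT; apply: contraNneq jp => <-.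
  by rewrite /=; case: odd.
have jd0 : (j < d)%N by rewrite ltnW// ltnW.
have hj : odd j != odd d by move: jp; rewrite /=; do 2!case: odd.
rewrite (bigD1 (Ordinal jd0))//= eqxx (bigD1 (Ordinal jd2))/=; last first.
  by rewrite /= negbK hj -val_eqE /=; lia.
rewrite eqxx big1 ?addr0 => [|k /andP[/andP[ko k1 k2]]].
  have -> : (j == j.+2) = false by lia.
  have -> : (j == j.+1) = false by lia.
  have -> : (j.+2 == j) = false by lia.
  have -> : (j.+2 == j.+1) = false by lia.
  rewrite !mul0r !subr0 sub0r mulr1 mulrN1 -mulrDl.
  have := congr1 (fun p => p.[w]) (deriv_leg R j); rewrite !hornerE => e.
  by apply: (mulfI (c0 j.+1)); rewrite mulrC divfK// mulrN -e; ring.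
have -> : (k == j :> nat) = false by apply/negbTE.
have -> : (k == j.+2 :> nat) = false by apply/negbTE.
have -> : (k == j.+1 :> nat) = false by apply/negP => /eqP kE; move: ko jp; rewrite kE /=; do 2!case: odd.
by rewrite !(subrr,mulr0,mul0r).
Qed.

(** [skew_prim C] has degree at most d + 1 and is orthogonal to P_1, ..., P_d, so it is a constant
    plus a multiple of P_(d+1). Its derivative is 2 C. *)
Lemma skew_pair_uniq d (C : {poly R}) : (size C <= d.+1)%N ->
  (forall j, (j < d)%N -> skew_pair C (leg j.+1) = 0) -> exists c, C = c *: (leg d.+1)^`().
Proof.
move=> sC hC.
have sQ : (size (skew_prim C) <= d.+2)%N.
  rewrite (leq_trans (size_polyD _ _))// size_polyN geq_max.
  rewrite (leq_trans (size_scale_leq _ _)) ?(leq_trans (size_prim _))//=.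
  by rewrite (leq_trans (size_polyC_leq1 _)).
have [c cE] := leg_basis sQ.
have c0 j : (j < d)%N -> c j.+1 = 0.
  move=> jd; have := hC j jd; rewrite /skew_pair cE mulr_suml linear_sum /=.
  have jd' : (j.+1 < d.+2)%N by lia.
  rewrite (bigD1 (Ordinal jd'))//= big1 ?addr0 => [|k kj].
    rewrite -scalerAl linearZ /= intg_leg_sqr => /eqP; rewrite mulf_eq0 => /orP[/eqP//|].
    by rewrite mulf_eq0 invr_eq0 !pnatr_eq0 addn1.
  by rewrite -scalerAl linearZ /= intg_leg_orth ?mulr0.
exists (c d.+1 / 2).
have dQ : (skew_prim C)^`() = 2 *: C by rewrite derivB derivC subr0 derivZ deriv_prim.
have : 2 *: C = c d.+1 *: (leg d.+1)^`().
  rewrite -dQ cE big_ord_recr big_ord_recl /= big1 => [|k _].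
    by rewrite addr0 derivD leg0 !derivZ derivC scaler0 add0r.
  by rewrite /bump /= add1n c0 ?scale0r.
move=> e; rewrite mulrC -scalerA -e scalerA mulVf ?scale1r//.
Qed.

Lemma deriv_leg_neq0 d : (leg d.+1)^`() != 0.
Proof.
apply/eqP => e; have := prim_deriv (leg d.+1); rewrite e.
have -> : prim 0 = 0 :> {poly R} by rewrite linear0.
move=> /esym/eqP; rewrite subr_eq0 => /eqP e'.
by have := size_leg R d.+1; rewrite e' => h; have := size_polyC_leq1 ((leg d.+1)`_0); rewrite h.
Qed.

(* The pairing determines [A w] up to a multiple of [(leg d.+1)^`()]; since [A w] vanishes at
   [w], that multiple is zero for all but finitely many [w]. *)
Lemma kernel_uniq d (K : R) (A : R -> {poly R}) :
  (forall w x, (A w).[x] = - (A x).[w]) -> (forall w, size (A w) <= d.+1)%N ->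
  (forall w j, (j < d)%N -> skew_pair (A w) (leg j.+1) = - (K * (leg j.+1).[w])) ->
  forall w, A w = K *: skew_kernel d.+1 w.
Proof.
move=> asA sA hA; pose C w := A w - K *: skew_kernel d.+1 w.
have asC w x : (C w).[x] = - (C x).[w].
  by rewrite !hornerE asA (skew_kernel_antisym _ w); ring.
have C0 w : (leg d.+1)^`().[w] != 0 -> C w = 0.
  move=> w0; have [] := @skew_pair_uniq d (C w).
  - rewrite (leq_trans (size_polyD _ _))// size_polyN geq_max sA.
    by rewrite (leq_trans (size_scale_leq _ _))// size_skew_kernel.
  - by move=> j jd; rewrite prB prZ hA// skew_pair_skew_kernel//; ring.
  move=> c cE; have : (C w).[w] = 0 by have := asC w w; lra.
  rewrite cE hornerZ => /eqP; rewrite mulf_eq0 (negbTE w0) orbF => /eqP ->.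
  by rewrite scale0r.
move=> w; apply/eqP; rewrite -subr_eq0 -/(C w).
(* At each x where the derivative does not vanish, antisymmetry gives [(C w).[x] = 0]; at the other
   x the second factor is 0. *)
have : C w * (leg d.+1)^`() = 0.
  apply: poly_ext => x; rewrite hornerM horner0.
  have [->|x0] := eqVneq ((leg d.+1)^`().[x]) 0; first by rewrite mulr0.
  by rewrite asC C0// horner0 oppr0 mul0r.
by move/eqP; rewrite mulf_eq0 (negbTE (deriv_leg_neq0 d)) orbF.
Qed.

Lemma skew_kernel_legN d z w : (skew_kernel d w).[z] =
  (z - w) * \sum_(k < d | odd k != odd d) (2 * k + 1)%:R / 4 * (legN k (- (z + w)))^`().[z * w].
Proof.
rewrite mulr_sumr horner_sum; apply: eq_bigr => k _.
by rewrite mulrCA deriv_legN !hornerE; ring.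
Qed.

End skew_pairing.

(** * Averages of quadratic products *)

Section selberg_kernel.
Context {R : realType}.
Local Notation mR := (measurableTypeR R).
Local Notation mu := (@lebesgue_measure R).

Definition absD_mass n : R := cube_int (fun Y : n.-tuple mR => absD (Y : seq R)).

Lemma pair_avg_sym n x w : @pair_avg R n x w = pair_avg n w x.
Proof. by apply: eq_cube_int => t _; rewrite -!mulrA [root_prod t x * _]mulrC. Qed.

(** As a function of x and w, (x - w) [pair_avg n x w] is antisymmetric and polynomial of degree at
    most n + 1 in x, and [kernel_pairing] computes its pairings with P_1, ..., P_(n+1): these are
    the hypotheses of [kernel_uniq]. *)
Lemma pair_avg_kernel n x w :
  n.+2%:R * n.+1%:R * ((x - w) * pair_avg n x w) = absD_mass n.+2 * (skew_kernel n.+2 w).[x].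
Proof.
have nz : n.+2%:R * n.+1%:R != 0 :> R by rewrite mulf_neq0 ?pnatr_eq0.
have /choice[P hP] : forall w, exists P : {poly R}, (size P <= n.+1)%N /\ forall x, P.[x] = pair_avg n x w.
  move=> {}w; have [||P sP PE] := @cube_int_poly R n n.+1
      (fun t => (absD (t : seq R) * root_prod t w) *: \prod_(z <- (t : seq R)) ('X - z%:P)).
  - by move=> t; rewrite (leq_trans (size_scale_leq _ _))// size_prod_XsubC size_tuple.
  - move=> y; rewrite (_ : (fun _ => _) = fun t : n.-tuple mR =>
      absD (t : seq R) * root_prod t w * root_prod t y).
      by do 2?apply: bmeasM; [exact: bmeas_absD|exact: bmeas_root_prod1|exact: bmeas_root_prod1].
    apply/funext => t; rewrite hornerZ horner_prod; congr (_ * _).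
    by apply: eq_bigr => z _; rewrite hornerXsubC.
  exists P; split => // y; rewrite PE; apply: eq_cube_int => t _.
  rewrite hornerZ horner_prod mulrAC; congr (_ * _ * _).
  by apply: eq_bigr => z _; rewrite hornerXsubC.
pose A w := ('X - w%:P) * P w.
have AE u v : (A u).[v] = (v - u) * pair_avg n v u by rewrite hornerM hornerXsubC (hP u).2.
pose K := absD_mass n.+2 / (n.+2%:R * n.+1%:R).
have := @kernel_uniq R n.+1 K A _ _ _ w.
rewrite -AE => -> //; first by rewrite hornerZ mulrA [_ * K]mulrC divfK.
- by move=> u v; rewrite !AE pair_avg_sym; ring.
- move=> u; rewrite (leq_trans (size_polyMleq _ _))// size_XsubC.
  by rewrite add2n /= ltnS; exact: (hP u).1.
- move=> u j jn.
  have sg : (size (leg R j.+1) <= n.+2)%N by rewrite size_leg; lia.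
  have := kernel_pairing u sg; rewrite itv_int_horner intg_leg => /(_ erefl).
  rewrite (@eq_itv_int _ _ (horner (skew_prim (A u) * leg R j.+1))).
    rewrite itv_int_horner -/(skew_pair _ _) -/(absD_mass _) => e.
    by apply: (mulfI nz); rewrite e /K mulrN mulrA [X in - (X * _)]mulrC divfK// mulNr.
  move=> y Iy; rewrite hornerM mulrC; congr (_ * _).
  rewrite (@eq_itv_int _ _ (fun x => Num.sg (y - x) * (A u).[x])); last by move=> v _; rewrite AE.
  by rewrite itv_int_sg_horner// /skew_prim !hornerE.
Qed.

(** No absolute value on the quadratic factor: it is positive where complex pairs live, and without
    it the integral is a polynomial in c. *)
Definition quad_avg n b c := cube_int (fun t : n.-tuple mR =>
  absD (t : seq R) * \prod_(z <- (t : seq R)) (z ^+ 2 + b * z + c)).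

Definition leg_sum n b : {poly R} :=
  \sum_(k < n.+2 | odd k != odd n.+2) ((2 * k + 1)%:R / 4) *: (legN k b).

Lemma bmeas_quad_avg n b c : bmeas (cubeT n) (fun t : n.-tuple mR =>
  absD (t : seq R) * \prod_(z <- (t : seq R)) (z ^+ 2 + b * z + c)).
Proof.
apply: bmeasM; first exact: bmeas_absD.
rewrite (_ : (fun _ => _) = fun t => \prod_(i < n) ((tnth t i) ^+ 2 + b * tnth t i + c)); last first.
  by apply/funext => t; rewrite big_tuple.
apply: bmeas_prod => i; have bi := @bmeas_tnth R n i.
apply: bmeasD; last exact: bmeas_cst.
by apply: bmeasD; [exact: bmeasM|apply: bmeasM => //; exact: bmeas_cst].
Qed.

(** [pair_avg_kernel] yields this only at c = z w with z + w = - b and z, w real and distinct, that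
    is for 4 c < b^2. For fixed b both sides are polynomials in c, so infinitely many such c give
    the identity everywhere, in particular for 4 c > b^2. *)
Lemma quad_avg_leg_sum n b c : n.+2%:R * n.+1%:R * quad_avg n b c = absD_mass n.+2 * (leg_sum n b)^`().[c].
Proof.
have [||Q sQ QE] := @cube_int_poly R n n.+1
   (fun t => absD (t : seq R) *: \prod_(z <- (t : seq R)) ('X - (- (z ^+ 2 + b * z))%:P)).
- move=> t; rewrite (leq_trans (size_scale_leq _ _))//.
  rewrite -(big_map (fun z => - (z ^+ 2 + b * z)) xpredT (fun y => 'X - y%:P)).
  by rewrite size_prod_XsubC size_map size_tuple.
- move=> y; rewrite (_ : (fun _ => _) = fun t : n.-tuple mR =>
     absD (t : seq R) * \prod_(z <- (t : seq R)) (z ^+ 2 + b * z + y)); first exact: bmeas_quad_avg.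
  apply/funext => t; rewrite hornerZ horner_prod; congr (_ * _).
  by apply: eq_bigr => z _; rewrite hornerXsubC opprK addrC.
have QF y : Q.[y] = quad_avg n b y.
  rewrite QE; apply: eq_cube_int => t _; rewrite hornerZ horner_prod; congr (_ * _).
  by apply: eq_bigr => z _; rewrite hornerXsubC opprK addrC.
suff e : (n.+2%:R * n.+1%:R) *: Q = absD_mass n.+2 *: (leg_sum n b)^`().
  by rewrite -QF -!hornerZ e.
(* Large enough that z = - b - w differs from w and that the products z w are pairwise distinct. *)
pose ww i : R := `|b| + 1 + i%:R.
have wb i : 0 <= i%:R + 1 + `|b| + b.
  have := ler0n R i; have := ler_norm (- b); rewrite normrN => h1 h2; lra.
apply: (@poly_ext_infinite R _ _ (fun i => (- b - ww i) * ww i)).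
  move=> i j /eqP; rewrite -subr_eq0.
  have -> : (- b - ww i) * ww i - (- b - ww j) * ww j = (ww j - ww i) * (b + ww i + ww j) by ring.
  rewrite mulf_eq0 => /orP[|/eqP h].
    by rewrite /ww opprD addrACA subrr add0r subr_eq0 eqr_nat => /eqP.
  by exfalso; have := ler0n R j; have := wb i; have := normr_ge0 b; move: h; rewrite /ww; lra.
move=> i; set w := ww i; set z := - b - w; rewrite !hornerZ QF.
have bE : b = - (z + w) by rewrite /z; ring.
have zw : z - w != 0.
  have := wb i; have := ler0n R i; have := normr_ge0 b => h1 h2 h3.
  by apply/eqP; rewrite /z /w /ww => h; lra.
have := pair_avg_kernel n z w; rewrite skew_kernel_legN mulrCA [X in _ = X]mulrCA => /(mulfI zw) e.
transitivity (n.+2%:R * n.+1%:R * pair_avg n z w).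
  congr (_ * _); apply: eq_cube_int => t _; rewrite -mulrA; congr (_ * _).
  rewrite /root_prod -big_split /=; apply: eq_bigr => x _; rewrite bE; ring.
rewrite e /leg_sum raddf_sum /= horner_sum; congr (_ * _); apply: eq_bigr => k _.
by rewrite -bE linearZ hornerZ.
Qed.

End selberg_kernel.

(** * Volumes in root coordinates *)

Section volumes.
Context {R : realType}.
Local Notation mR := (measurableTypeR R).
Local Notation mu := (@lebesgue_measure R).

Lemma rweightE k n (t : n.-tuple mR) (c : k.-tuple mR) :
  rweight t c = absD (t : seq R) *
    \prod_(x <- (t : seq R)) `|(monic_of (c : k.-tuple R)).[x]| * \1_(cubeT n) t.
Proof.
elim: n t => [t|n IH t].
  rewrite tuple0 /= big_nil !mul1r indicE mem_set// => i; by case: i.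
have [x [u ->]] : exists x u, t = tcons (x, u).
  by exists (thead t), [tuple of behead t]; rewrite /tcons /= [LHS]tuple_eta.
rewrite rweight_cons IH /= big_cons monic_of_tmulXs hornerM horner_prod normrM.
have -> : \prod_(z <- (u : seq R)) ('X - z%:P).[x] = \prod_(z <- (u : seq R)) (x - z).
  by apply: eq_bigr => z _; rewrite hornerXsubC.
have -> : \1_(cubeT n.+1) (tcons (x, u)) = \1_sym_itv x * \1_(cubeT n) u :> R.
  rewrite !indicE -natrM mulnb; congr (_%:R); apply/f_equal.
  rewrite -tins0; apply/idP/andP => [/set_mem /(cubeT_tins _ _ (leq0n n))[h1 h2]|].
    by rewrite !mem_set.
  by move=> [/set_mem h1 /set_mem h2]; apply/mem_set/(cubeT_tins _ _ (leq0n n)).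
rewrite /sym_itv; ring.
Qed.

Definition core_avg k n (c : k.-tuple mR) : R := cube_int (fun t : n.-tuple mR =>
  absD (t : seq R) * \prod_(x <- (t : seq R)) `|(monic_of (c : k.-tuple R)).[x]|).

Lemma bmeas_core_avg k n (c : k.-tuple mR) : bmeas (cubeT n) (fun t : n.-tuple mR =>
  absD (t : seq R) * \prod_(x <- (t : seq R)) `|(monic_of (c : k.-tuple R)).[x]|).
Proof.
apply: bmeasM; first exact: bmeas_absD.
rewrite (_ : (fun _ => _) = fun t : n.-tuple mR =>
   \prod_(i < n) `|(monic_of (c : k.-tuple R)).[tnth t i]|); last first.
  by apply/funext => t; rewrite big_tuple.
by apply: bmeas_prod => i; apply: bmeas_norm; apply: bmeas_horner; exact: bmeas_tnth.
Qed.

Lemma cube_int_fineK n (f : n.-tuple mR -> R) : bmeas (cubeT n) f ->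
  (\int[lamT n]_(t in cubeT n) (f t)%:E = (cube_int f)%:E)%E.
Proof.
move=> bf; rewrite /cube_int /Rintegral fineK//.
by apply: integrable_fin_num; [exact: measurable_cubeT|exact: cube_int_integrable].
Qed.

Lemma integral_rweight k n (c : k.-tuple mR) :
  (\int[lamT n]_t (rweight t c)%:E = (core_avg n c)%:E)%E.
Proof.
rewrite -cube_int_fineK; last exact: bmeas_core_avg.
rewrite [RHS]integral_mkcond; apply: eq_integral => t _.
by rewrite patchE rweightE indicE; case: ifP => _; rewrite ?mulr1 ?mulr0.
Qed.

Lemma lamT_Eset k (S : set (k.-tuple R)) n :
  (forall c, S c -> forall z, ~~ root (monic_of c) z) ->
  measurable (S : set (k.-tuple mR)) ->
  (forall n, measurable (Eset S n : set ((n + k).-tuple mR))) ->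
  (n`!%:R%:E * lamT (n + k) (Eset S n) =
   \int[lamT k]_c ((\1_(S : set (k.-tuple mR)) c)%:E * (core_avg n c)%:E))%E.
Proof.
move=> Sr mS mE.
have := @root_formula R k S n (cst 1%E) Sr mS mE (measurable_cst _) (fun _ => lee01).
under eq_integral do rewrite /cst mul1e.
have -> : (\int[lamT (n + k)]_x (\1_(Eset S n) x)%:E = lamT (n + k) (Eset S n))%E.
  by rewrite integral_indic ?setIT//; exact: mE.
move=> ->; apply: eq_integral => c _; congr (_ * _)%E.
by rewrite -integral_rweight; apply: eq_integral => t _; rewrite /cst mule1.
Qed.

Lemma measurable_core_avg k n (S : set (k.-tuple R)) : measurable (S : set (k.-tuple mR)) ->
  measurable_fun setT (fun c : k.-tuple mR => (\1_(S : set (k.-tuple mR)) c)%:E * (core_avg n c)%:E)%E.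
Proof.
move=> mS; apply: emeasurable_funM.
  by apply: (measurableT_comp (@EFin_measurable R setT)); exact: measurable_indic.
rewrite (_ : (fun _ => _) = fun c => (\int[lamT n]_t (rweight t c)%:E)%E); last first.
  by apply/funext => c; rewrite integral_rweight.
apply: (@measurable_integral_lamT R _ _ n (fun p => (rweight p.2 p.1)%:E)) => [|p]; last first.
  by rewrite lee_fin rweight_ge0.
apply: (measurableT_comp (@EFin_measurable R setT)).
apply: (measurableT_comp (@measurable_rweight R k n) (g := fun p => (p.2, p.1))).
by apply: measurable_fun_pair; [exact: measurable_snd|exact: measurable_fst].
Qed.

Lemma tcompact0 : tcompact (setT : set (0.-tuple R)).
Proof.
rewrite /tcompact; have := @rV_compact R 0 (fun=> set0).
rewrite (_ : [set v | forall i, _] = [set v | True])//; last first.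
  by apply/seteqP; split => // v _ [].
by apply => -[].
Qed.

Lemma lamT_Eset0 d :
  (d`!%:R%:E * lamT (d + 0) (Eset (setT : set (0.-tuple R)) d) = (absD_mass d)%:E)%E.
Proof.
have m1 (c : 0.-tuple R) : monic_of c = 1 by rewrite /monic_of big_ord0 addr0 expr0.
rewrite lamT_Eset.
- rewrite integral_tuple0; last by apply: measurable_core_avg; exact: measurableT.
  rewrite indicE mem_set// mul1e; congr _%:E; apply: eq_cube_int => t _.
  by rewrite big1 ?mulr1// => x _; rewrite m1 hornerC normr1.
- by move=> c _ z; rewrite m1 root1.
- exact: measurableT.
- move=> n; apply: (@measurable_Eset R 0 setT (fun=> setT)) => //.
    by move=> _; exact: tcompact0.
  by apply/seteqP; split => // c _; exists 0%N.
Qed.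

Definition quad_core : set (2.-tuple R) :=
  [set c | nth 0 c 0 ^+ 2 < 4 * nth 0 c 1 /\ nth 0 c 1 < 1].

(** A compact exhaustion of the open set [quad_core], as [measurable_Eset] requires; it is bounded
    because b^2 <= 4 c <= 4. *)
Definition quad_exh m : set (2.-tuple R) :=
  [set c | nth 0 c 0 ^+ 2 + m.+1%:R^-1 <= 4 * nth 0 c 1 /\ nth 0 c 1 <= 1 - m.+1%:R^-1].

Lemma quad_core_quad_exh : quad_core = \bigcup_m quad_exh m.
Proof.
apply/seteqP; split => c; last first.
  move=> [m _ [h1 h2]]; have m0 : 0 < m.+1%:R^-1 :> R by rewrite invr_gt0 ltr0n.
  split; first by apply: lt_le_trans h1; rewrite ltrDl.
  by apply: le_lt_trans h2 _; rewrite ltrBlDr ltrDl.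
move=> [h1 h2]; pose e := Num.min (4 * nth 0 c 1 - nth 0 c 0 ^+ 2) (1 - nth 0 c 1).
have e0 : 0 < e by rewrite lt_min !subr_gt0 h1 h2.
have [m _ hm] := near_infty_natSinv_lt (PosNum e0).
have {hm} := hm m (leqnn m) => /= /ltW; rewrite le_min => /andP[l1 l2].
exists m => //; split; first by rewrite addrC -lerBrDr.
by rewrite lerBrDr addrC -lerBrDr.
Qed.

Lemma quad_exh_homo : {homo quad_exh : m p / (m <= p)%N >-> m `<=` p}.
Proof.
move=> m p mp c [h1 h2].
have pm : p.+1%:R^-1 <= m.+1%:R^-1 :> R by rewrite lef_pV2 ?posrE ?ltr0n// ler_nat.
split; first by apply: le_trans h1; rewrite lerD2l.
by apply: (le_trans h2); rewrite lerD2l lerN2.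
Qed.

Lemma continuous_disc (T : topologicalType) (f g : T -> R) (e : R) :
  continuous f -> continuous g -> continuous (fun v => 4 * g v - (f v * f v + e)).
Proof.
move=> cf cg v; apply: cvgB; first by apply: cvgM; [exact: cvg_cst|exact: cg].
by apply: cvgD; [apply: cvgM; exact: cf|exact: cvg_cst].
Qed.

Lemma continuous_cstB (T : topologicalType) (f : T -> R) (e : R) :
  continuous f -> continuous (fun v => e - f v).
Proof. by move=> cf v; apply: cvgB; [exact: cvg_cst|exact: cf]. Qed.

Lemma tcompact_quad_exh m : tcompact (quad_exh m).
Proof.
have m0 : 0 < m.+1%:R^-1 :> R by rewrite invr_gt0 ltr0n.
have E (v : 'rV[R]_2) : quad_exh m (tvr v) <->
   v ord0 0 ^+ 2 + m.+1%:R^-1 <= 4 * v ord0 1 /\ v ord0 1 <= 1 - m.+1%:R^-1.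
  rewrite /quad_exh /=.
  have -> : nth 0 (tvr v) 0 = v ord0 0 by rewrite -(tnth_nth 0 _ (0 : 'I_2)) tnth_mktuple.
  by have -> : nth 0 (tvr v) 1 = v ord0 1 by rewrite -(tnth_nth 0 _ (1 : 'I_2)) tnth_mktuple.
rewrite /tcompact.
apply: (@subclosed_compact _ _ [set v : 'rV[R]_2 | forall i, `[(-2)%R, 2%R]%classic (v ord0 i)]).
- have -> : [set v | quad_exh m (tvr v)] =
     (fun v : 'rV[R]_2 => 4 * v ord0 1 - (v ord0 0 * v ord0 0 + m.+1%:R^-1)) @^-1` [set x | 0 <= x] `&`
     (fun v : 'rV[R]_2 => 1 - m.+1%:R^-1 - v ord0 1) @^-1` [set x | 0 <= x].
    apply/seteqP; split => v.
      by move=> /E; rewrite /= !subr_ge0.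
    by rewrite /= !subr_ge0 => h; apply/E.
  have cc i : continuous (fun v : 'rV[R]_2 => v ord0 i) by exact: coord_continuous.
  have c1 : continuous (fun v : 'rV[R]_2 => 4 * v ord0 1 - (v ord0 0 * v ord0 0 + m.+1%:R^-1)).
    exact: continuous_disc.
  have c2 : continuous (fun v : 'rV[R]_2 => 1 - m.+1%:R^-1 - v ord0 1).
    exact: continuous_cstB.
  apply: closedI; apply: preimage_closed; try exact: closed_ge.
    by move=> v _; exact: c1.
  by move=> v _; exact: c2.
- exact: (@rV_compact R 2 (fun=> `[(-2)%R, 2%R]%classic) (fun=> @segment_compact R (-2) 2)).
- move=> v /E[h1 h2] i /=; rewrite in_itv /=.
  have v1 : v ord0 1 < 1 by apply: le_lt_trans h2 _; rewrite ltrBlDr ltrDl.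
  have v0 : v ord0 0 ^+ 2 < 4 * v ord0 1 by apply: lt_le_trans h1; rewrite ltrDl.
  have v02 : v ord0 0 ^+ 2 <= 2 ^+ 2.
    apply: (le_trans (ltW v0)); rewrite expr2 -natrM.
    by rewrite -[leRHS]mulr1 ler_pM2l ?ltW// ltr0n.
  have v10 : 0 < v ord0 1 by have := le_lt_trans (sqr_ge0 _) v0; rewrite pmulr_rgt0 ?ltr0n.
  case: (unliftP ord0 i) => [j|] -> /=.
    have -> : lift ord0 j = 1 by apply/val_inj; case: j => -[].
    by apply/andP; split; lra.
  rewrite -ler_norml -(@ler_pXn2r _ 2)// ?nnegrE// -normrX ger0_norm ?sqr_ge0//.
Qed.

Lemma monic_of2 (c : 2.-tuple R) x :
  (monic_of c).[x] = x ^+ 2 + nth 0 c 0 * x + nth 0 c 1.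
Proof.
rewrite /monic_of !big_ord_recl big_ord0 !hornerE /= !(tnth_nth 0) /=.
by rewrite !hornerE; ring.
Qed.

Lemma quad_core_gt0 c x : quad_core c -> 0 < (monic_of c).[x].
Proof.
move=> [h _]; rewrite monic_of2; have := sqr_ge0 (x + nth 0 c 0 / 2); nra.
Qed.

Lemma measurable_quad_core : measurable (quad_core : set (2.-tuple mR)).
Proof.
rewrite quad_core_quad_exh; apply: bigcup_measurable => m _.
exact: (tcompact_measurable (tcompact_quad_exh (m := m))).
Qed.

(** The range of b follows from b^2 < 4 c < 4, and the absolute values of [core_avg] drop because
    the quadratic is positive on the real line. *)
Lemma lamT_Eset1 n :
  (n`!%:R%:E * lamT (n + 2) (Eset quad_core n) =
   \int[mu]_(b in `](-2)%R, 2%R[) \int[mu]_(c in `](b ^+ 2 / 4)%R, 1%R[) (quad_avg n b c)%:E)%E.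
Proof.
rewrite lamT_Eset; last 3 first.
- by move=> c Sc z; rewrite /root gt_eqF// quad_core_gt0.
- exact: measurable_quad_core.
- by move=> p; exact: (measurable_Eset (n := p) tcompact_quad_exh quad_exh_homo quad_core_quad_exh).
have mh := measurable_core_avg n measurable_quad_core.
have GC0 (c : 2.-tuple mR) : (0 <= (\1_(quad_core : set (2.-tuple mR)) c)%:E * (core_avg n c)%:E)%E.
  rewrite mule_ge0 ?lee_fin// -lee_fin -integral_rweight; apply: integral_ge0 => t _.
  by rewrite lee_fin rweight_ge0.
rewrite (ge0_integral_tcons mh GC0) [RHS]integral_mkcond; apply: eq_integral => b _.
have mb := measurable_fun_pair2 b (measurableT_comp mh (@measurable_tcons R 1)).
rewrite (ge0_integral_tcons mb); last by move=> t; exact: GC0.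
have bc (c : mR) : (\int[lamT 0]_t ((\1_(quad_core : set (2.-tuple mR)) (tcons (b, tcons (c, t))))%:E *
      (core_avg n (tcons (b, tcons (c, t))))%:E) =
    if ((b : R) ^+ 2 < 4 * c)%R && (c < 1 :> R)%R then (quad_avg n b c)%:E else 0)%E.
  have mc := measurable_fun_pair2 c (measurableT_comp mb (@measurable_tcons R 0)).
  rewrite (integral_tuple0 mc) /= indicE.
  case: ifPn => [/andP[h1 h2]|h].
    have Sc : quad_core (tcons (b, tcons (c, [tuple]))) by [].
    rewrite mem_set// mul1e; congr _%:E; apply: eq_cube_int => t _; congr (_ * _).
    by apply: eq_bigr => x _; rewrite gtr0_norm ?quad_core_gt0// monic_of2.
  rewrite memNset ?mul0e// => -[h1 h2]; move: h; by rewrite h1 h2.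
under eq_integral do rewrite bc.
rewrite patchE; case: ifPn => [_|/negP bN].
  rewrite [RHS]integral_mkcond; apply: eq_integral => c _; rewrite patchE mem_setE in_itv /=.
  by rewrite ltr_pdivrMr ?ltr0n// mulrC.
apply: integral0_eq => c _; case: ifP => // /andP[h1 h2]; exfalso; apply: bN.
rewrite inE /= in_itv /= -ltr_norml -(@ltr_pXn2r _ 2)// ?nnegrE// -normrX ger0_norm ?sqr_ge0//.
apply: (lt_trans h1); rewrite expr2 -natrM.
by rewrite -[ltRHS]mulr1 ltr_pM2l// ltr0n.
Qed.

End volumes.

(** * Location of the complex roots *)

Section root_location.
Context {R : realType}.
Implicit Types (z : R[i]) (p q : {poly R}).
Local Notation mR := (measurableTypeR R).
Local Notation rc := (real_complex R).

Definition quad z : {poly R} :=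
  'X^2 - (2 * complex.Re z) *: 'X + (complex.Re z ^+ 2 + complex.Im z ^+ 2)%:P.

Lemma size_quad z : size (quad z) = 3%N.
Proof.
rewrite /quad -addrA size_polyDl size_polyXn//.
rewrite (leq_ltn_trans (size_polyD _ _))// gtn_max size_polyN.
rewrite (leq_ltn_trans (size_scale_leq _ _)) ?size_polyX//=.
by rewrite (leq_ltn_trans (size_polyC_leq1 _)).
Qed.

Lemma quad_monic z : quad z \is monic.
Proof.
apply/monicP; rewrite lead_coefE size_quad /= /quad.
by rewrite !(coefD, coefN, coefZ, coefXn, coefX, coefC) /= mulr0 subr0 addr0.
Qed.

Lemma quadE z x : (quad z).[x] =
  x ^+ 2 - 2 * complex.Re z * x + (complex.Re z ^+ 2 + complex.Im z ^+ 2).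
Proof. by rewrite /quad !hornerE. Qed.

Lemma complexify_XsubC x : complexify ('X - x%:P) = 'X - (rc x)%:P.
Proof. by rewrite /complexify rmorphB /= map_polyX map_polyC. Qed.

Lemma complexify_quad z : complexify (quad z) = ('X - z%:P) * ('X - (conjc z)%:P).
Proof.
rewrite /complexify /quad rmorphD rmorphB /= map_polyXn linearZ /= map_polyX map_polyC /=.
have e1 : rc (2 * complex.Re z) = z + conjc z.
  by case: z => a b; rewrite /real_complex_def /=; apply/eqP;
    rewrite eq_complex /= addrN mulr_natl mulr2n !eqxx.
have e2 : rc (complex.Re z ^+ 2 + complex.Im z ^+ 2) = z * conjc z.
  case: z {e1} => a b; apply/eqP; rewrite eq_complex /=; apply/andP; split; apply/eqP; ring.
by rewrite e1 e2 -mul_polyC polyCD polyCM; ring.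
Qed.

Lemma complexifyM p q : complexify (p * q) = complexify p * complexify q.
Proof. exact: rmorphM. Qed.

Lemma complexify_prod I (s : seq I) (F : I -> {poly R}) :
  complexify (\prod_(i <- s) F i) = \prod_(i <- s) complexify (F i).
Proof. exact: rmorph_prod. Qed.

Lemma complexify_inj : injective (@complexify R).
Proof. exact: map_poly_inj. Qed.

Lemma norm_lt1 z : (`|z| < 1) = (complex.Re z ^+ 2 + complex.Im z ^+ 2 < 1).
Proof.
rewrite normc_def (_ : 1 = rc 1)// ltcR -[X in _ < X]sqrtr1 ltr_sqrt//.
Qed.

Lemma norm_rc_lt1 (x : R) : (`|rc x| < 1) = (x \in `](-1)%R, 1%R[).
Proof.
rewrite norm_lt1 /= expr0n /= addr0 in_itv /= -ltr_norml.
by rewrite -[in RHS](@ltr_pXn2r _ 2)// ?nnegrE// expr1n -normrX ger0_norm ?sqr_ge0.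
Qed.

Definition core s : set ((2 * s).-tuple R) := [set c | exists zs : seq R[i],
  [/\ size zs = s, {in zs, forall z, z \isn't Num.real},
      {in zs, forall z, `|z| < 1} & monic_of c = \prod_(z <- zs) quad z]].

Lemma complexify_split (xs : seq R) (zs : seq R[i]) :
  complexify (\prod_(x <- xs) ('X - x%:P) * \prod_(z <- zs) quad z) =
  \prod_(x <- xs) ('X - (rc x)%:P) *
  \prod_(z <- zs) (('X - z%:P) * ('X - (conjc z)%:P)).
Proof.
rewrite complexifyM !complexify_prod; congr (_ * _).
  by apply: eq_bigr => x _; rewrite complexify_XsubC.
by apply: eq_bigr => z _; rewrite complexify_quad.
Qed.

Lemma size_prod_quad (zs : seq R[i]) : size (\prod_(z <- zs) quad z) = (2 * size zs).+1.
Proof.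
elim: zs => [|z zs IH]; first by rewrite big_nil size_poly1.
rewrite big_cons size_monicM ?quad_monic// ?size_quad ?IH /=; first by lia.
by rewrite -size_poly_gt0 IH.
Qed.

(** Complexification is injective, so the factorisation over R[i] descends to real linear and
    quadratic factors. The bound on all roots splits between the real ones and the core, conjugates
    having equal modulus. *)
Lemma E_s_Eset n s : @E_s R (n + 2 * s) s = Eset (core (s := s)) n.
Proof.
apply/seteqP; split => a.
  move=> [Ea [xs [zs [szs nzs]]]]; rewrite -complexify_split => aE.
  have {}aE := complexify_inj aE.
  have sx : size xs = n.
    have := size_monic_of a; rewrite aE size_monicM ?monic_prod_XsubC//; last first.
      by rewrite -size_poly_gt0 size_prod_quad.
    by rewrite size_prod_XsubC size_prod_quad szs /=; lia.
  have mq : \prod_(z <- zs) quad z \is monic by apply: monic_prod => z _; exact: quad_monic.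
  have sq : size (\prod_(z <- zs) quad z) = (2 * s).+1 by rewrite size_prod_quad szs.
  have [c cE] := monic_of_surj mq sq.
  have sx' : size xs == n by apply/eqP.
  exists c, (Tuple sx'); split.
  - exists zs; split => // z zz; apply: Ea; rewrite aE complexify_split rootM; apply/orP; right.
    rewrite rootE horner_prod prodf_seq_eq0; apply/hasP; exists z => //=.
    by rewrite hornerM hornerXsubC subrr mul0r.
  - move=> x xx; rewrite -norm_rc_lt1; apply: Ea.
    rewrite aE complexify_split rootM; apply/orP; left.
    rewrite rootE horner_prod prodf_seq_eq0; apply/hasP; exists x => //=.
    by rewrite hornerXsubC subrr.
  - by rewrite cE.
move=> [c [xs [[zs [szs nzs lzs cE]] hxs aE]]]; rewrite cE in aE; split; last first.
  by exists xs, zs; split => //; rewrite aE complexify_split.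
move=> z; rewrite aE complexify_split rootM => /orP[]; rewrite rootE horner_prod prodf_seq_eq0.
  move=> /hasP[x xx] /=; rewrite hornerXsubC subr_eq0 => /eqP ->.
  by rewrite norm_rc_lt1 hxs.
move=> /hasP[y yz] /=; rewrite hornerM !hornerXsubC mulf_eq0 !subr_eq0 => /orP[]/eqP ->.
  exact: lzs.
by rewrite normcJ; exact: lzs.
Qed.

Lemma core0 : core (s := 0) = setT.
Proof.
apply/seteqP; split => // c _; exists [::]; split => //.
by rewrite big_nil /monic_of big_ord0 addr0 expr0.
Qed.

Lemma core1 : core (s := 1) = quad_core.
Proof.
apply/seteqP; split => c.
  move=> [zs [szs]]; case: zs szs => [//|z zs]; case: zs => [_ nz lz|//]; rewrite big_seq1 => cE.
  have nzz := nz z (mem_head _ _); have lzz := lz z (mem_head _ _).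
  have e x := congr1 (fun p : {poly R} => p.[x]) cE.
  have e0 := e 0; have e1 := e 1; move: e0 e1.
  rewrite !quadE -[monic_of c]/(monic_of (c : 2.-tuple R)) !monic_of2.
  move: nzz lzz; rewrite norm_lt1; case: z {nz lz cE e} => u v /=.
  rewrite complex_real => v0 h e0 e1.
  have v2 : 0 < v ^+ 2 by rewrite exprn_even_gt0.
  rewrite /quad_core /=.
  have c1 : nth 0 c 1 = u ^+ 2 + v ^+ 2 by lra.
  have c0 : nth 0 c 0 = - 2 * u by lra.
  by rewrite c0 c1; split; nra.
move=> [h1 h2]; set b := nth 0 c 0 in h1; set d := nth 0 c 1 in h1 h2.
have d0 : 0 < d - b ^+ 2 / 4 by lra.
(* The root of X^2 + b X + d in the upper half-plane. *)
pose z : R[i] := Complex (- b / 2) (Num.sqrt (d - b ^+ 2 / 4)).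
exists [:: z]; split => //.
- by move=> y; rewrite inE => /eqP ->; rewrite complex_real sqrtr_eq0 -ltNge.
- move=> y; rewrite inE => /eqP ->; rewrite norm_lt1 /= sqr_sqrtr ?ltW//.
  by have -> : (- b / 2) ^+ 2 + (d - b ^+ 2 / 4) = d by field.
- rewrite big_seq1; apply: poly_ext => x.
  rewrite -[monic_of c]/(monic_of (c : 2.-tuple R)) monic_of2 quadE /= sqr_sqrtr ?ltW//.
  by rewrite -/b -/d; field.
Qed.

End root_location.

(** * The ratio of the volumes *)

Section volume_ratio.
Context {R : realType}.
Local Notation mR := (measurableTypeR R).
Local Notation mu := (@lebesgue_measure R).
Local Notation leg := (@leg R).

(** Disjoint intervals inside ]0, 1[: their product is a box of positive measure on which the
    coordinates are pairwise distinct, so that [absD] is nonzero there. *)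
Let cell n (i : 'I_n) : set mR := `](i%:R / n.+1%:R)%R, (i.+1%:R / n.+1%:R)%R[%classic.
Let cells n : set (n.-tuple mR) := [set t | forall i, @cell n i (tnth t i)].

Let cells_uniq n (t : n.-tuple mR) : cells t -> uniq (t : seq R).
Proof.
move=> ht; apply/tuple_uniqP.
have lt (i j : 'I_n) : (i < j)%N -> (tnth t i : R) < tnth t j.
  move=> ij; have := ht i; have := ht j; rewrite /cell /= !in_itv /= => /andP[h1 _] /andP[_ h2].
  apply: (lt_trans h2); apply: le_lt_trans h1.
  by rewrite ler_pM2r ?invr_gt0 ?ltr0n// ler_nat.
move=> i j e; apply/val_inj; case: (ltngtP i j) => // /lt; first by rewrite e ltxx.
by rewrite e ltxx.
Qed.

Let cells_cubeT n : @cells n `<=` cubeT n.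
Proof.
move=> t ht i; have := ht i; rewrite /cell /sym_itv /= !in_itv /= => /andP[h1 h2].
apply/andP; split.
  by apply: le_lt_trans h1; apply: (@le_trans _ _ 0); rewrite ?divr_ge0 ?ler0n ?lerN10.
by apply: (lt_le_trans h2); rewrite ler_pdivrMr ?ltr0n// mul1r ler_nat (leqW (ltn_ord i)).
Qed.

Let measurable_cells n : measurable (@cells n).
Proof.
rewrite (_ : @cells n = \bigcap_(i in [set: 'I_n]) ((@tnth _ mR ^~ i) @^-1` (@cell n i))); last first.
  by apply/seteqP; split => t /= h => [i _|i]; exact: h.
apply: fin_bigcap_measurable => // i _; rewrite -[X in measurable X]setTI.
by apply: measurable_tnth => //; exact: measurable_itv.
Qed.

Let lamT_cells n : (0 < lamT n (@cells n))%E.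
Proof.
rewrite lamTE (@lebesgue_tuple_box R n (@cell n)); last by move=> i; exact: measurable_itv.
have cE i : mu (@cell n i) = (n.+1%:R^-1)%:E.
  rewrite /cell lebesgue_measure_itv /= lte_fin ltr_pM2r ?invr_gt0 ?ltr0n// ltr_nat ltnSn.
  by rewrite -EFinD -mulrBl -natrB// subSnn mul1r.
under eq_bigr do rewrite cE.
have : 0 < n.+1%:R^-1 :> R by rewrite invr_gt0 ltr0n.
move: (n.+1%:R^-1 : R) => e e0; elim: n {cE} => [|n IH]; first by rewrite big_ord0 lte01.
by rewrite big_ord_recl mule_gt0.
Qed.

(** With integral 0, the nonnegative [absD] would vanish almost everywhere on the box [cells], where
    it has no zero. *)
Lemma absD_mass_gt0 n : 0 < @absD_mass R n.
Proof.
have bD := @bmeas_absD R n.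
have mD : measurable_fun setT (fun t : n.-tuple mR => (absD (t : seq R))%:E).
  by apply: (measurableT_comp (@EFin_measurable R setT)); case: bD.
have V0 : 0 <= @absD_mass R n.
  by rewrite -lee_fin -cube_int_fineK//; apply: integral_ge0 => t _; rewrite lee_fin absD_ge0.
rewrite lt_neqAle V0 andbT eq_sym; apply/eqP => VD0.
have := cube_int_fineK bD; rewrite -/(absD_mass n) VD0 => I0.
have : (\int[lamT n]_(t in @cells n) `|(absD (t : seq R))%:E| = 0)%E.
  apply/eqP; rewrite eq_le; apply/andP; split; last by apply: integral_ge0.
  rewrite -[leRHS]/(0%:E)%E -I0; under eq_integral do rewrite gee0_abs ?lee_fin ?absD_ge0//.
  have mc : measurable (@cells n) by exact: measurable_cells.
  have mC : measurable (@cubeT R n) by exact: measurable_cubeT.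
  apply: (ge0_subset_integral (lamT n) mc mC).
  - exact: measurable_funTS.
  - by move=> t _; rewrite lee_fin absD_ge0.
  - exact: (@cells_cubeT n).
have mc : measurable (@cells n) by exact: measurable_cells.
move=> /(ae_eq_integral_abs _ mc (measurable_funTS mD)).
move=> [N [mN N0 sN]].
have : (lamT n (@cells n) <= lamT n N)%E.
  apply: le_measure; rewrite ?inE//.
  move=> t ct; apply: sN => /= /(_ ct) /eqP; rewrite eqe => /eqP e.
  by have := absD_uniq (t : seq R); rewrite e eqxx (cells_uniq ct).
by rewrite N0 leNgt lamT_cells.
Qed.

(** As a polynomial in b, the integral over b^2 / 4 < c < 1 of the k-th summand of the derivative of
    [leg_sum]. *)
Definition area k : {poly R} :=
  ((2 * k + 1)%:R / 4) *: (legN1 R k - ((leg k ^+ 2) \Po ((- 2^-1) *: 'X))).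

(** Passing from d to d + 2 keeps the parity and adds only k = d + 1, whose contribution is the
    telescoping term of [legN_area]. Both base cases are 0. *)
Lemma sum_area d : \sum_(k < d | odd k != odd d) intg (-2) 2 (area k) =
  ((leg d).[3] - 2 * d%:R - 1) / 4.
Proof.
pose P d := \sum_(k < d | odd k != odd d) intg (-2) 2 (area k) =
  ((leg d).[3] - 2 * d%:R - 1) / 4.
suff: P d /\ P d.+1 by case.
elim: d => [|d [IH1 IH2]]; split => //.
- by rewrite /P big_ord0 leg0 hornerC mulr0 subr0 subrr mul0r.
- rewrite /P big_mkcond big_ord_recl big_ord0 /= leg1 hornerX.
  have -> : area 0 = 0.
    rewrite /area /legN1 leg0 big_ord1 /= /pc fact0 !expr1n !expr0 mulr1 invr1 mul1r hornerC.
    by rewrite mulr1 scale1r (comp_polyC 1) subrr scaler0.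
  by rewrite linear0; lra.
rewrite /P big_mkcond !big_ord_recr /= negbK eqxx /= addr0 -big_mkcond /=.
have -> : ~~ odd d != odd d by case: odd.
rewrite -[X in X + _]/(\sum_(k < d | odd k != odd d) intg (-2) 2 (area k)) IH1.
have := legN_area R d; rewrite -linearB /= -linearZ /= -/(area _) => ->.
by rewrite -!natr1; field.
Qed.

(** The inner integrand is a derivative in c, and its antiderivative at the two endpoints is a
    polynomial in b, so both integrations are exact. *)
Lemma volume_one_pair n :
  (n`!%:R%:E * lamT (n + 2) (Eset quad_core n) =
   (absD_mass n.+2 / (n.+2%:R * n.+1%:R) * (((leg n.+2).[3] - 2 * n.+2%:R - 1) / 4))%:E)%E.
Proof.
rewrite lamT_Eset1; set K := absD_mass n.+2 / _.
have nz : n.+2%:R * n.+1%:R != 0 :> R by rewrite mulf_neq0 ?pnatr_eq0.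
pose G := \sum_(k < n.+2 | odd k != odd n.+2) area k.
transitivity (\int[mu]_(b in `](-2)%R, 2%R[) ((prim (K *: G))^`().[b])%:E)%E; last first.
  rewrite integral_deriv_horner ?ler_nat//; last by lra.
  by rewrite -/(intg _ _ _) linearZ /= /G linear_sum /= sum_area.
apply: eq_integral => b; rewrite inE /= in_itv /= => /andP[b1 b2].
rewrite deriv_prim.
transitivity (\int[mu]_(c in `](b ^+ 2 / 4)%R, 1%R[) ((K *: leg_sum n b)^`().[c])%:E)%E.
  apply: eq_integral => c _; congr _%:E; apply: (mulfI nz).
  by rewrite quad_avg_leg_sum derivZ hornerZ /K mulrA [_ * (_ / _)]mulrC divfK.
rewrite integral_deriv_horner; last by rewrite ler_pdivrMr ?ltr0n// mul1r; nra.
congr _%:E; rewrite !hornerZ -mulrBr; congr (_ * _).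
rewrite /leg_sum /G !horner_sum -sumrB; apply: eq_bigr => k _.
rewrite /area !hornerZ -mulrBr hornerD hornerN legN1E legN_sqr horner_comp hornerZ hornerX.
by rewrite horner_exp (mulrC (- 2^-1)) mulrN mulNr.
Qed.

Lemma v_Eset n s N : N = (n + 2 * s)%N ->
  v_ R N s = fine (lamT (n + 2 * s) (Eset (core (s := s)) n)).
Proof. by move=> ->; rewrite /v_ lamTE E_s_Eset. Qed.

(** A finite product with m > 0 excludes infinite x, so [fine] in [v_] loses nothing. *)
Lemma fine_mulr (m r : R) x : 0 < m -> (m%:E * x = r%:E)%E -> m * fine x = r.
Proof.
move=> m0; case: x => [x [->]//||]; first by rewrite gt0_muley ?lte_fin.
by rewrite gt0_muleNy ?lte_fin.
Qed.

Lemma v_0 d : d`!%:R * v_ R d 0 = absD_mass d.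
Proof.
rewrite (@v_Eset d 0) ?addn0// core0; apply: fine_mulr; last exact: lamT_Eset0.
by rewrite ltr0n fact_gt0.
Qed.

Lemma v_1 n : n`!%:R * v_ R n.+2 1 =
  absD_mass n.+2 / (n.+2%:R * n.+1%:R) * (((leg n.+2).[3] - 2 * n.+2%:R - 1) / 4).
Proof.
rewrite (@v_Eset n 1) ?addn2// core1; apply: fine_mulr; last exact: volume_one_pair.
by rewrite ltr0n fact_gt0.
Qed.

Lemma volume_ratio n : v_ R n.+2 1 / v_ R n.+2 0 = ((leg n.+2).[3] - 2 * n.+2%:R - 1) / 4.
Proof.
have f0 m : m`!%:R != 0 :> R by rewrite pnatr_eq0 -lt0n fact_gt0.
have V0 : absD_mass n.+2 != 0 :> R by rewrite gt_eqF// absD_mass_gt0.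
have := v_0 n.+2; rewrite 2!factS !natrM => e0.
have := v_1 n => e1.
have n1 : n.+1%:R != 0 :> R by rewrite pnatr_eq0.
have n2 : n.+2%:R != 0 :> R by rewrite pnatr_eq0.
have v0 : v_ R n.+2 0 != 0 by apply: contra_neq V0 => h; rewrite -e0 h mulr0.
apply: (mulIf v0); rewrite divfK//; apply: (mulfI (f0 n)); rewrite e1 -e0.
move: n1 n2; set x := n.+1%:R; set y := n.+2%:R => n1 n2.
by clearbody x y; field; rewrite n1 n2.
Qed.

End volume_ratio.

Theorem theorem2p1 (R : realType) (d : nat) (hd : (2 <= d)%N) :
  [/\ v_ R d 1 / v_ R d 0 \is a Num.int,
      v_ R d 1 / v_ R d 0 = ((legendre R d).[3] - 2 * d%:R - 1) / 4 &
      legendre R d =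
        \sum_(0 <= k < d.+1)
          ('C(d + k, 2 * k)%:R * 'C(2 * k, k)%:R) *: (2^-1 *: ('X - 1)) ^+ k].
Proof.
have legE : legendre R d = leg R d by rewrite leg_legendre.
case: d hd legE => [|[|n]]// _ legE.
split; last by rewrite legE legE_bin.
- rewrite volume_ratio; have [m ->] := leg3_int R n.+2.
  rewrite (_ : _ / 4 = m%:R); first exact: natr_int.
  by rewrite !natrD !natrM; field.
- by rewrite volume_ratio legE.
Qed.
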